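(* Let $V,H$ be separable complex Hilbert spaces such that $V$ is continuously and densely imbedded in $H$, let $a,b:V\times V\to\mathbb C$ be continuous sesquilinear forms, and let $b$ be $H$-elliptic. Assume that for some constant $M_b>0$ $$|\mathrm{Im}\,b(u,u)|\le M_b\|u\|_H\|u\|_V,\qquad u\in V.$$ Set $\mathbf V:=V\times V$, $\mathbf H:=V\times H$ and let $\mathbf A$ be the operator on $\mathbf H$ associated with the form $$\mathbf a(\mathbf u,\mathbf v):=-(u_2\mid v_1)_V+a(u_1,v_2)+b(u_2,v_2),\qquad \mathbf u=(u_1,u_2)^\top,\ \mathbf v=(v_1,v_2)^\top\in\mathbf V.$$ Then $\mathbf A$ generates a cosine operator function on $\mathbf H$ (i.e., $-\mathbf A$ is the generator of a cosine operator function). Moreover, the form domain $\mathbf V$ is isometric to the fractional power domain $D((\lambda+\mathbf A)^{\frac12})$, for $\lambda>0$ large enough.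
   Context: $\mathbf V$ and $\mathbf H$ carry their canonical product Hilbert space structures. A sesquilinear form $b:V\times V\to\mathbb C$ is $H$-elliptic if there exist $\delta>0$, $\omega\in\mathbb R$ with $\mathrm{Re}\,b(u,u)+\omega\|u\|_H^2\ge\delta\|u\|_V^2$ for all $u\in V$. The operator $\mathbf A$ on $\mathbf H$ associated with $\mathbf a$ is defined by $D(\mathbf A):=\{\mathbf u\in\mathbf V:\exists\,\mathbf z\in\mathbf H \text{ s.t. } \mathbf a(\mathbf u,\mathbf v)=(\mathbf z\mid\mathbf v)_{\mathbf H}\ \forall\mathbf v\in\mathbf V\}$, $\mathbf A\mathbf u:=\mathbf z$. With this sign convention, generation statements for $\mathbf A$ (such as the semigroup $(e^{-t\mathbf a})_{t\ge 0}$) refer to $-\mathbf A$ as the infinitesimal generator. *)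

(* Defs.v *)
From HB Require Import structures.
From mathcomp Require Import all_boot all_order all_algebra.
From mathcomp Require Import complex.
From mathcomp Require Import all_classical all_reals all_analysis.

Set Implicit Arguments.
Unset Strict Implicit.
Unset Printing Implicit Defensive.

Import Order.TTheory GRing.Theory Num.Theory.
Import numFieldNormedType.Exports.

Local Open Scope classical_set_scope.
Local Open Scope ring_scope.

(* The inner product is linear in its first argument and conjugate-linear in
   its second one; it induces the (R[i]-valued) norm of the normed module. *)
HB.mixin Record CompleteNormedModule_isHilbert (R : realType) V
    & CompleteNormedModule R[i] V := {
  inner : V -> V -> R[i] ;
  inner_linearl : forall w : V, linear_for *%R (inner ^~ w) ;
  inner_conj : forall u v : V, inner u v = (inner v u)^*%R ;
  inner_norm : forall u : V, inner u u = `|u| ^+ 2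
}.

#[short(type="hilbertType")]
HB.structure Definition Hilbert (R : realType) :=
  {V of CompleteNormedModule R[i] V & CompleteNormedModule_isHilbert R V}.

(* An alias of [U * W]: the library puts the max norm on [U * W], which is not
   a Hilbert norm. *)
Definition hprod (U W : Type) : Type := (U * W)%type.

Section hprod.
Context {R : realType} {U W : hilbertType R}.
Implicit Types x y : hprod U W.

HB.instance Definition _ := GRing.Lmodule.copy (hprod U W) (U * W)%type.

Definition hprod_norm x : R[i] := sqrtC (`|x.1| ^+ 2 + `|x.2| ^+ 2).

Let hprod_normE x : hprod_norm x = `| `|x.1| + 'i * `|x.2| |.
Proof. by rewrite normC_rect ?normr_real. Qed.

Let sqr_sum_ge0 x : 0 <= `|x.1| ^+ 2 + `|x.2| ^+ 2 :> R[i].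
Proof. by rewrite addr_ge0 ?exprn_ge0. Qed.

Let ler_hprod_normD x y : hprod_norm (x + y) <= hprod_norm x + hprod_norm y.
Proof.
rewrite (hprod_normE x) (hprod_normE y).
apply: le_trans (ler_normD _ _).
rewrite addrACA -mulrDr normC_rect ?realD ?normr_real//.
rewrite /hprod_norm ler_sqrtC ?nnegrE ?addr_ge0 ?exprn_ge0 ?addr_ge0//.
by apply: lerD; apply: lerXn2r; rewrite ?nnegrE ?addr_ge0 ?ler_normD.
Qed.

Let hprod_normZ (l : R[i]) x : hprod_norm (l *: x) = `|l| * hprod_norm x.
Proof. by rewrite !hprod_normE !normrZ mulrCA -mulrDr normrM normr_id. Qed.

Let hprod_norm_eq0 x : hprod_norm x = 0 -> x = 0.
Proof.
move/eqP; rewrite sqrtC_eq0 paddr_eq0 ?exprn_ge0// !expf_eq0/= !normr_eq0.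
by case: x => x1 x2 /= /andP[/eqP-> /eqP->].
Qed.

HB.instance Definition _ := Lmodule_isNormed.Build R[i] (hprod U W)
  ler_hprod_normD hprod_normZ hprod_norm_eq0.

Let norm_fst x : `|x.1| <= `|x|.
Proof.
rewrite -[leLHS]sqrCK//.
by rewrite ler_sqrtC ?nnegrE ?exprn_ge0// ?sqr_sum_ge0// lerDl exprn_ge0.
Qed.

Let norm_snd x : `|x.2| <= `|x|.
Proof.
rewrite -[leLHS]sqrCK//.
by rewrite ler_sqrtC ?nnegrE ?exprn_ge0// ?sqr_sum_ge0// lerDr exprn_ge0.
Qed.

Let norm_le_sum x : `|x| <= `|x.1| + `|x.2|.
Proof.
rewrite [leLHS]hprod_normE; apply: le_trans (ler_normD _ _) _.
by rewrite normrM normCi mul1r !normr_id.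
Qed.

Let hprod_complete (F : set_system (hprod U W)) :
  ProperFilter F -> cauchy F -> cvg F.
Proof.
move=> FF /cauchy_ballP F_cauchy; apply/cvg_ex.
have cvg_comp (T : hilbertType R) (p : hprod U W -> T) :
    (forall x y, `|p x - p y| <= `|x - y|) -> exists l : T, p @ F --> l.
  move=> p1; apply/cvg_ex; apply: cauchy_cvg.
  apply/cauchy_ballP => e e0; have [[A B] [/= FA FB] AB] := F_cauchy e e0.
  exists (p @` A, p @` B); first by split; rewrite nbhs_simpl /=;
    [apply: filterS FA|apply: filterS FB]; exact: preimage_image.
  move=> [_ _] [/= [u Au <-] [v Bv <-]].
  have := AB (u, v) (conj Au Bv); rewrite /= -!ball_normE /ball_/=.
  exact: le_lt_trans.
have [l1 Fl1] := cvg_comp U (fun x => x.1) (fun x y => norm_fst (x - y)).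
have [l2 Fl2] := cvg_comp W (fun x => x.2) (fun x y => norm_snd (x - y)).
exists ((l1, l2) : hprod U W); apply/cvgrPdist_lt => e e0.
have e20 : 0 < e / 2 by rewrite divr_gt0.
have /cvgrPdist_lt/(_ _ e20) N1 := Fl1.
have /cvgrPdist_lt/(_ _ e20) N2 := Fl2.
rewrite !near_simpl in N1 N2; near=> x.
apply: le_lt_trans (norm_le_sum _) _; rewrite [e]splitr ltrD//=.
- by near: x.
- by near: x.
Unshelve. all: by end_near. Qed.

HB.instance Definition _ := Uniform_isComplete.Build (hprod U W) hprod_complete.

Definition hprod_inner x y : R[i] := inner x.1 y.1 + inner x.2 y.2.

Let hprod_inner_linearl w : linear_for *%R (hprod_inner ^~ w).
Proof.
by move=> l x y; rewrite /hprod_inner !inner_linearl mulrDr addrACA.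
Qed.

Let hprod_inner_conj x y : hprod_inner x y = (hprod_inner y x)^*%R.
Proof. by rewrite /hprod_inner rmorphD/= -!inner_conj. Qed.

Let hprod_inner_norm x : hprod_inner x x = `|x| ^+ 2.
Proof. by rewrite /hprod_inner !inner_norm [in RHS]sqrtCK. Qed.

HB.instance Definition _ := CompleteNormedModule_isHilbert.Build R (hprod U W)
  hprod_inner_linearl hprod_inner_conj hprod_inner_norm.

End hprod.

(* Unbounded operators are represented by their graphs. *)

Section operators.
Context {R : realType} {X : hilbertType R}.
Implicit Types (B : set (X * X)) (l : R).

Definition op_domain B : set X := [set x | exists y, B (x, y)].

Definition op_opp B : set (X * X) := [set p | B (p.1, - p.2)].

(* [l + B] *)
Definition op_shift l B : set (X * X) :=
  [set p | B (p.1, p.2 - l%:C%C *: p.1)].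

Definition op_bounded_inverse B (S : {linear X -> X}) : Prop :=
  continuous S /\ forall x y, B (y, x) <-> y = S x.

End operators.

(* The operator associated with a form [a] on [U], where [j] is the imbedding
   of the form domain [U] into [X]. *)
Definition form_op (R : realType) (U : Type) (X : hilbertType R) (j : U -> X)
    (a : U -> U -> R[i]) : set (X * X) :=
  [set p | exists2 u, j u = p.1 & forall v, a u v = inner p.2 (j v)].

Section cosine.
Context {R : realType} {X : hilbertType R}.
Implicit Type C : R -> {linear X -> X}.

Definition cosine_function C : Prop :=
  [/\ forall t, continuous (C t),
      forall x, C 0 x = x,
      forall s t x, C (t + s) x + C (t - s) x = 2 *: C t (C s x)
    & forall x, continuous (fun t => C t x)].

(* [C''(0)] *)
Definition cosine_generator C : set (X * X) :=
  [set p | (2 / t ^+ 2)%:C%C *: (C t p.1 - p.1) @[t --> 0^'] --> p.2].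

Definition generates_cosine (G : set (X * X)) : Prop :=
  exists2 C, cosine_function C & cosine_generator C = G.

End cosine.

Section fractional_powers.
Context {R : realType} {X : hilbertType R}.
Implicit Type B : set (X * X).

(* [v] is the Bochner integral of [f] over [D] ([X] separable): by Pettis'
   theorem, strong measurability amounts to weak measurability, and the integral
   is determined by duality. The real parts are enough, since the imaginary part
   of [inner x y] is the real part of [inner x ('i *: y)]. *)
Definition is_Bochner_integral (D : set R) (f : R -> X) (v : X) : Prop :=
  [/\ forall y, measurable_fun D (fun s => complex.Re (inner (f s) y)),
      lebesgue_measure.-integrable D (fun s => (complex.Re `|f s|)%:E)
    & forall y, complex.Re (inner v y) =
        Rintegral lebesgue_measure D (fun s => complex.Re (inner (f s) y))].

(* The operators with bounded inverse for which fractional powers are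
   considered: the resolvent set contains the negative half-line and 0, and the
   resolvent decays there like [1 / (1 + s)]. *)
Definition positive_op B : Prop :=
  exists M : R, forall s : R, 0 <= s ->
    exists2 S, op_bounded_inverse (op_shift s B) S &
      forall x, `|S x| <= (M / (1 + s))%:C%C * `|x|.

(* [y = B^(- al) x], for [0 < al < 1], by Balakrishnan's formula
   [B^(- al) = sin (pi al) / pi * \int_0^oo s^(- al) (s + B)^-1 ds] *)
Definition op_negpower (al : R) B : set (X * X) :=
  [set p | exists2 S : R -> {linear X -> X},
     forall s, 0 < s -> op_bounded_inverse (op_shift s B) (S s) &
     is_Bochner_integral `]0, +oo[ (fun s => (s `^ (- al))%:C%C *: S s p.1)
       ((pi / sin (pi * al))%:C%C *: p.2)].

(* [B^al] is the inverse of [B^(- al)]. *)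
Definition op_power (al : R) B : set (X * X) :=
  [set p | op_negpower al B (p.2, p.1)].

End fractional_powers.

(* The domain [D(B)] with its Hilbert graph norm is canonically isomorphic to
   the normed space [U] imbedded in [X] by [j]: [D(B) = j(U)], with equivalent
   norms. *)
Definition domain_equiv (R : realType) (U X : hilbertType R) (j : U -> X)
    (B : set (X * X)) : Prop :=
  op_domain B = range j /\
  exists c1 c2 : R, [/\ 0 < c1, 0 < c2 &
    forall u y, B (j u, y) ->
      c1%:C%C * `|u| <= sqrtC (`|j u| ^+ 2 + `|y| ^+ 2) <= c2%:C%C * `|u|].

(* [U] is isometrically isomorphic to [D(B)] with its Hilbert graph norm. *)
Definition domain_isometric (R : realType) (U X : hilbertType R)
    (B : set (X * X)) : Prop :=
  exists T : {linear U -> X}, op_domain B = range T /\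
    forall u y, B (T u, y) -> sqrtC (`|T u| ^+ 2 + `|y| ^+ 2) = `|u|.

Definition separable (T : topologicalType) : Prop :=
  exists2 D : set T, countable D & dense D.

Notation sesquilinear_form U :=
  {bilinear U%type -> U%type -> _ | *%R & (Num.conj \; *%R)}.

Definition continuous_form (R : realType) (V : hilbertType R)
    (a : V -> V -> R[i]) : Prop :=
  continuous (fun p : V * V => a p.1 p.2 : R[i]^o).

Definition elliptic (R : realType) (V H : hilbertType R) (j : V -> H)
    (b : V -> V -> R[i]) : Prop :=
  exists de om : R, 0 < de /\ forall u,
    de%:C%C * `|u| ^+ 2 <= 'Re (b u u) + om%:C%C * `|j u| ^+ 2.

Section matrix_form.
Context {R : realType} {V H : hilbertType R}.

(* [u |-> (u_1, j u_2)], the imbedding of [V * V] into [V * H] *)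
Definition matrix_imbedding (j : V -> H) (u : hprod V V) : hprod V H :=
  (u.1, j u.2).

Definition matrix_form (a b : V -> V -> R[i]) (u v : hprod V V) : R[i] :=
  - inner u.2 v.1 + a u.1 v.2 + b u.2 v.2.

End matrix_form.

(* Main.v *)
(* Let [alpha = Re a]. The hypotheses make [a] elliptic with numerical range in a
   parabola, also for the matrix form.

   Cosine function. For [k = h^2 / 4] and [J = (1 + k A)^-1] put [B = 2 J - 1]. The
   parabola yields [Re <(1 - z^2) x, (1 + z^2) x - 2 z B x> >= 0] for
   [|z| <= 1 - O(h)], and Caratheodory's inequality for this positive function bounds
   its Taylor coefficients, the Chebyshev operators [T_n(B)], by [exp (c n h)]. Since
   [B_h - T_2(B_(h/2)) = O(h^4) A^2], the [T_n(B_h)] with [n h -> t] converge as [h] is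
   halved, and [2 T_m T_n = T_(m+n) + T_(m-n)] passes to the limit.

   Square root. Let [ [u, v] ] be the symmetric part of [alpha] shifted by [la]; there
   are a positive operator [g] and a unitary [N] from [H] onto [(V, [.,.])] with
   [j N = g]. With [R_s] the resolvent of [A] into [V],
   [<Z x, z> = pi^-1 \int_0^oo s^(-1/2) [R_s x, N z] ds] gives
   [(la + A)^(-1/2) = j N Z]. Replacing [R_s] by the resolvent of the symmetric part
   contributes [\int s^(-1/2) g (1 + s g^2)^-1 ds = pi] and the skew part, controlled by
   the parabola, contributes [O(la^(-1/2))]. Hence [Z] is bounded and coercive, so
   bijective, and [(la + A)^(-1/2)] has range [j V]. *)

Require Import Defs.
From HB Require Import structures.
From mathcomp Require Import all_boot all_order all_algebra.
From mathcomp Require Import complex.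
From mathcomp Require Import ring lra zify.
From mathcomp Require Import all_classical all_reals all_analysis.
From mathcomp Require Import measurable_realfun.

Set Implicit Arguments.
Unset Strict Implicit.
Unset Printing Implicit Defensive.

Import Order.TTheory GRing.Theory Num.Theory.
Import numFieldNormedType.Exports.

Local Open Scope classical_set_scope.
Local Open Scope ring_scope.

(** * Hilbert spaces as real inner product spaces *)

(** The quotient [2 J - 1 = (1 - k A) (1 + k A)^-1] is formally [1 - h^2 A / 2 + O(h^4)]: it stands
    for the cosine function at time [h], and [T_n(B)] for its value at [n h]. As [A] is not normal,
    the growth of [T_n(B)] cannot be read off a spectrum; only the numerical range is available.
    Positivity turns this range into norm bounds, and is exploited through finite coefficient sums
    and averages over roots of unity.

    For the square root, the energy estimate only makes [R_s x] of order [s^(-1/2)] in [V], so the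
    [V]-norm of [s^(-1/2) R_s x] is merely bounded by a multiple of [1 / s], which diverges at
    infinity. Hence the integral is defined weakly, against [N z], and estimated as a quadratic
    form, by comparison with integrands that have explicit antiderivatives.

    Equivalence of norms becomes an isometry because two equivalent Hilbert norms on [V] are both
    unitary images of the norm of [H].

    Estimates use real parts only; complex linearity is recovered from commutation with ['i]. *)

Notation "c *r x" := ((c%:C)%C *: x) (at level 40, left associativity).

Section real_structure.
Context {R : realType} {V : hilbertType R}.
Implicit Types (x y z : V) (c : R) (a : R[i]).

(** The norm of the structure is [R[i]]-valued; with [nr] and [ip] all estimates become inequalities
    between real numbers, within reach of [lra] and [nra]. *)
Definition nr x : R := complex.Re `|x|.
Definition ip x y : R := complex.Re (inner x y).

Lemma ge0_ReK (a : R[i]) : 0 <= a -> a = (complex.Re a)%:C%C.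
Proof. by move=> a0; rewrite RRe_real// ger0_real. Qed.

Lemma nrE x : `|x| = (nr x)%:C%C.
Proof. by rewrite /nr -ge0_ReK. Qed.

Lemma nr_ge0 x : 0 <= nr x.
Proof. by rewrite -ler0c -nrE. Qed.

Lemma nr0 : nr 0 = 0.
Proof. by rewrite /nr normr0. Qed.

Lemma nr0_eq0 x : nr x = 0 -> x = 0.
Proof. by move=> h; apply/eqP; rewrite -normr_eq0 nrE h. Qed.

Lemma nrN x : nr (- x) = nr x.
Proof. by rewrite /nr normrN. Qed.

Lemma nrB x y : nr (x - y) = nr (y - x).
Proof. by rewrite /nr distrC. Qed.

Lemma ler_nrD x y : nr (x + y) <= nr x + nr y.
Proof. by rewrite -lecR rmorphD/= -!nrE ler_normD. Qed.

Lemma ler_nrBD x y : nr (x - y) <= nr x + nr y.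
Proof. by apply: (le_trans (ler_nrD _ _)); rewrite nrN. Qed.

Lemma ler_nr3 z x y : nr (x - y) <= nr (x - z) + nr (z - y).
Proof. by rewrite -[in leLHS](subrK z x) -addrA ler_nrD. Qed.

Lemma nrZ a x : nr (a *: x) = complex.Re `|a| * nr x.
Proof.
by apply: complexI; rewrite rmorphM/= -!nrE normrZ; congr (_ * _).
Qed.

Lemma nrZr c x : nr (c *r x) = `|c| * nr x.
Proof. by rewrite nrZ normc_def/= expr0n/= addr0 sqrtr_sqr. Qed.

Lemma nrZi x : nr ('i%C *: x) = nr x.
Proof. by rewrite nrZ normc_def/= expr0n/= add0r expr1n sqrtr1 mul1r. Qed.

Lemma ipDl x y z : ip (x + y) z = ip x z + ip y z.
Proof. by rewrite /ip -[x]scale1r inner_linearl mul1r scale1r; case: inner; case: inner. Qed.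

Lemma inner0l z : inner (0 : V) z = 0.
Proof.
have := inner_linearl z 1 0 0; rewrite scale1r addr0 mul1r.
by move/eqP; rewrite -subr_eq subrr eq_sym => /eqP.
Qed.

Lemma innerZl a x z : inner (a *: x) z = a * inner x z.
Proof. by have := inner_linearl z a x 0; rewrite addr0 inner0l addr0. Qed.

Lemma innerDl x y z : inner (x + y) z = inner x z + inner y z.
Proof. by have := inner_linearl z 1 x y; rewrite scale1r mul1r. Qed.

Lemma conjcE a : a^*%R = (a^*)%C.
Proof. by case: a. Qed.

Lemma innerZr a x z : inner x (a *: z) = a^*%R * inner x z.
Proof. by rewrite inner_conj innerZl rmorphM/= -inner_conj. Qed.

Lemma innerDr x y z : inner x (y + z) = inner x y + inner x z.
Proof. by rewrite inner_conj innerDl rmorphD/= -!inner_conj. Qed.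

Lemma ipC x y : ip x y = ip y x.
Proof. by rewrite /ip inner_conj conjcE; case: (inner y x). Qed.

Lemma ipDr x y z : ip x (y + z) = ip x y + ip x z.
Proof. by rewrite ipC ipDl (ipC y) (ipC z). Qed.

Lemma ipZl c x y : ip (c *r x) y = c * ip x y.
Proof. by rewrite /ip innerZl; case: (inner x y) => ? ? /=; rewrite mul0r subr0. Qed.

Lemma ipZr c x y : ip x (c *r y) = c * ip x y.
Proof. by rewrite ipC ipZl ipC. Qed.

Lemma rN1 x : - x = (-1) *r x.
Proof. by rewrite rmorphN/= rmorph1 scaleN1r. Qed.

Lemma ipNl x y : ip (- x) y = - ip x y.
Proof. by rewrite rN1 ipZl mulN1r. Qed.

Lemma ipNr x y : ip x (- y) = - ip x y.
Proof. by rewrite ipC ipNl ipC. Qed.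

Lemma ip0l x : ip 0 x = 0.
Proof. by rewrite /ip inner0l. Qed.

Lemma ip0r x : ip x 0 = 0.
Proof. by rewrite ipC ip0l. Qed.

Lemma ip_nr x : ip x x = nr x ^+ 2.
Proof. by apply: complexI; rewrite /ip inner_norm nrE -rmorphXn. Qed.

Definition ipE := (ipDl, ipDr, ipNl, ipNr, ipZl, ipZr, ip0l, ip0r).

(** Multiplication by ['i] is an isometry, hence skew for the real inner product ([ip_iN]); with
    [innerE], this recovers complex data from [ip]. *)
Lemma ipii x y : ip ('i%C *: x) ('i%C *: y) = ip x y.
Proof.
rewrite /ip innerZl innerZr conjcE mulrA.
suff -> : 'i%C * ('i%C)^*%C = 1 :> R[i] by rewrite mul1r.
by apply/eqP; rewrite eq_complex/=; apply/andP; split; apply/eqP; ring.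
Qed.

Lemma ip_iN x y : ip ('i%C *: x) y = - ip x ('i%C *: y).
Proof. by rewrite -ipii scalerA -expr2 sqr_i scaleN1r ipNl. Qed.

Lemma Im_inner x y : complex.Im (inner x y) = ip x ('i%C *: y).
Proof. by rewrite /ip innerZr conjcE; case: (inner x y) => ? ? /=; ring. Qed.

Lemma innerE x y : inner x y = (ip x y +i* ip x ('i%C *: y))%C.
Proof. by rewrite -Im_inner /ip; case: (inner x y). Qed.

Lemma nrD2 x y : nr (x + y) ^+ 2 = nr x ^+ 2 + 2 * ip x y + nr y ^+ 2.
Proof. by rewrite -!ip_nr !ipE (ipC y x); ring. Qed.

Lemma nrB2 x y : nr (x - y) ^+ 2 = nr x ^+ 2 - 2 * ip x y + nr y ^+ 2.
Proof. by rewrite nrD2 nrN ipNr; ring. Qed.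

(** Cauchy-Schwarz follows from the triangle inequality of the normed module by comparing
    squares. *)
Lemma ip_le x y : ip x y <= nr x * nr y.
Proof.
have := ler_nrD x y; have := nr_ge0 (x + y).
have := nrD2 x y; have := nr_ge0 x; have := nr_ge0 y; nra.
Qed.

Lemma ip_abs x y : `|ip x y| <= nr x * nr y.
Proof.
by rewrite ler_norml ip_le andbT lerNl -ipNl (le_trans (ip_le _ _))// nrN.
Qed.

Lemma ip_ext x y : (forall z, ip x z = ip y z) -> x = y.
Proof.
move=> h; apply/eqP; rewrite -subr_eq0; apply/eqP/nr0_eq0.
have : nr (x - y) ^+ 2 = 0 by rewrite -ip_nr ipDl h -ipDl subrr ip0l.
by move/eqP; rewrite sqrf_eq0 => /eqP.
Qed.

Lemma rsD c d x : (c + d) *r x = c *r x + d *r x.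
Proof. by rewrite rmorphD/= scalerDl. Qed.

Lemma rsA c d x : c *r (d *r x) = (c * d) *r x.
Proof. by rewrite scalerA -rmorphM. Qed.

Lemma rs1 x : 1 *r x = x.
Proof. by rewrite rmorph1 scale1r. Qed.

Lemma rs0 x : 0 *r x = 0.
Proof. by rewrite rmorph0 scale0r. Qed.

Definition hcvg (u : nat -> V) x :=
  forall e : R, 0 < e -> exists N, forall n, (N <= n)%N -> nr (u n - x) < e.

Lemma cauchy_hcvg (u : nat -> V) :
  (forall e : R, 0 < e -> exists N, forall m n, (N <= m)%N -> (N <= n)%N ->
    nr (u m - u n) < e) -> exists x, hcvg u x.
Proof.
move=> hu.
have : cvg (u @ \oo).
  apply: cauchy_cvg; apply/cauchy_ballP => e e0.
  have e0' : 0 < complex.Re e.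
    by move: e0; rewrite ltcE => /andP[].
  have eE : e = (complex.Re e)%:C%C by apply: ge0_ReK; exact: ltW.
  have [N hN] := hu _ e0'.
  exists ([set x | exists2 m, (N <= m)%N & x = u m],
          [set x | exists2 m, (N <= m)%N & x = u m]).
    by split; exists N => // n /= Nn; exists n.
  move=> [_ _] [/= [m Nm ->] [n Nn ->]].
  by rewrite -ball_normE /ball_/= nrE eE ltcR hN.
move=> /cvg_ex[x ux]; exists x => e e0.
have /cvgrPdist_lt/(_ e%:C%C) : u @ \oo --> x by [].
rewrite ltcR => /(_ e0)[N _ hN]; exists N => n Nn.
by have := hN n Nn; rewrite /= nrE ltcR nrB.
Qed.

Lemma hcvg_unique u x y : hcvg u x -> hcvg u y -> x = y.
Proof.
move=> ux uy; apply/eqP; rewrite -subr_eq0; apply/eqP/nr0_eq0.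
apply/eqP; rewrite eq_le nr_ge0 andbT; apply/ler_addgt0Pr => e e0; rewrite add0r.
have e20 : 0 < e / 2 by lra.
have [N hN] := ux _ e20; have [M hM] := uy _ e20.
have := hN _ (leq_maxl N M); have := hM _ (leq_maxr N M).
have := ler_nr3 (u (maxn N M)) x y; rewrite (nrB x (u _)); lra.
Qed.

Lemma le_hcvg (u : nat -> V) x c N :
  hcvg u x -> (forall n, (N <= n)%N -> nr (u n) <= c) -> nr x <= c.
Proof.
move=> ux uc; apply/ler_addgt0Pr => e e0.
have [M hM] := ux _ e0.
have := hM _ (leq_maxr N M); have := uc _ (leq_maxl N M).
have := ler_nrD (u (maxn N M)) (x - u (maxn N M)); rewrite addrC subrK nrB; lra.
Qed.

End real_structure.

Lemma hcvg_lip {R : realType} {V W : hilbertType R} (f : V -> W) (u : nat -> V) x c :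
  (forall y, nr (f y - f x) <= c * nr (y - x)) ->
  hcvg u x -> hcvg (fun n => f (u n)) (f x).
Proof.
move=> hf ux e e0; pose c' := `|c| + 1.
have c'0 : 0 < c' by rewrite /c'; have := normr_ge0 c; lra.
have [N hN] := ux (e / c') (divr_gt0 e0 c'0); exists N => n Nn.
apply: le_lt_trans (hf _) _; have := hN n Nn; rewrite ltr_pdivlMr// mulrC.
have : c * nr (u n - x) <= c' * nr (u n - x).
  by rewrite ler_wpM2r ?nr_ge0// /c'; have := ler_norm c; lra.
lra.
Qed.

Section hcvg_theory.
Context {R : realType} {V : hilbertType R}.

Lemma hcvg_cst (x : V) : hcvg (fun=> x) x.
Proof. by move=> e e0; exists 0%N => n _; rewrite subrr nr0. Qed.

Lemma hcvgD (u v : nat -> V) x y :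
  hcvg u x -> hcvg v y -> hcvg (fun n => u n + v n) (x + y).
Proof.
move=> ux vy e e0; have e20 : 0 < e / 2 by lra.
have [N hN] := ux _ e20; have [M hM] := vy _ e20.
exists (maxn N M) => n; rewrite geq_max => /andP[/hN h1 /hM h2].
have := ler_nrD (u n - x) (v n - y); rewrite addrACA -opprD; lra.
Qed.

Lemma hcvgZ (a : R[i]) (u : nat -> V) x :
  hcvg u x -> hcvg (fun n => a *: u n) (a *: x).
Proof.
apply: (hcvg_lip (f := fun z => a *: z) (c := complex.Re `|a|)) => y.
by rewrite -scalerBr nrZ.
Qed.

Lemma hcvgN (u : nat -> V) x : hcvg u x -> hcvg (fun n => - u n) (- x).
Proof.
by move=> /(hcvgZ (-1)); rewrite scaleN1r; under eq_fun do rewrite scaleN1r.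
Qed.

Lemma hcvgB (u v : nat -> V) x y :
  hcvg u x -> hcvg v y -> hcvg (fun n => u n - v n) (x - y).
Proof. by move=> ux vy; apply: hcvgD => //; apply: hcvgN. Qed.

Lemma hcvg_dist (u v : nat -> V) x : hcvg u x ->
  (forall e : R, 0 < e -> exists N, forall n, (N <= n)%N -> nr (v n - u n) < e) ->
  hcvg v x.
Proof.
move=> ux h e e0; have e20 : 0 < e / 2 by lra.
have [N hN] := ux _ e20; have [M hM] := h _ e20.
exists (maxn N M) => n; rewrite geq_max => /andP[/hN h1 /hM h2].
have := ler_nr3 (u n) (v n) x; lra.
Qed.

Lemma eq_hcvg (u v : nat -> V) x : u =1 v -> hcvg u x -> hcvg v x.
Proof. by move=> /funext ->. Qed.

Lemma hcvg_shift (u : nat -> V) x : hcvg u x -> hcvg (fun n => u n.+1) x.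
Proof.
move=> ux e /ux[N hN]; exists N => n Nn; apply: hN; exact: leqW.
Qed.

Lemma geometric_hcvg (u : nat -> V) c q : 0 <= q -> q < 1 ->
  (forall n, nr (u n.+1 - u n) <= c * q ^+ n) -> exists x, hcvg u x.
Proof.
move=> q0 q1 hu.
have c0 : 0 <= c by have := hu 0%N; rewrite expr0 mulr1; apply: le_trans (nr_ge0 _).
have dec m n : nr (u (m + n)%N - u m) <= c / (1 - q) * q ^+ m.
  have q10 : 0 < 1 - q by lra.
  (* Keeping the term [- q ^+ (m + n)] makes the induction on [n] telescope. *)
  suff : nr (u (m + n)%N - u m) <= c / (1 - q) * (q ^+ m - q ^+ (m + n)).
    move/le_trans; apply; apply: ler_wpM2l; first by rewrite divr_ge0// ltW.
    by rewrite gerBl exprn_ge0.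
  elim: n => [|n IH]; first by rewrite addn0 !subrr nr0 mulr0.
  apply: le_trans (ler_nr3 (u (m + n)%N) _ _) _.
  have := hu (m + n)%N; rewrite addnS => h.
  apply: le_trans (lerD h IH) _; rewrite exprS le_eqVlt; apply/orP; left.
  apply/eqP; field; lra.
apply: cauchy_hcvg => e e0.
have q10 : 0 < 1 - q by lra.
have : exists N, c / (1 - q) * q ^+ N < e / 2.
  have : (fun n => c / (1 - q) * q ^+ n) @ \oo --> c / (1 - q) * 0.
    by apply: cvgMr; apply: cvg_expr; rewrite ger0_norm.
  rewrite mulr0 => /cvgrPdist_lt/(_ (e / 2)); case; first by lra.
  move=> N _ /(_ N (leqnn N)) /=; rewrite sub0r normrN => h; exists N.
  exact: le_lt_trans (ler_norm _) h.
move=> [N hN]; exists N => m n Nm Nn.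
have := dec N (m - N)%N; have := dec N (n - N)%N; rewrite !subnKC// => h1 h2.
have := ler_nr3 (u N) (u m) (u n); rewrite (nrB (u N)); lra.
Qed.

End hcvg_theory.

(** * Elliptic forms and their resolvents *)

Section riesz.
Context {R : realType} {V : hilbertType R}.
Variables (phi : V -> R) (M : R).
Hypothesis M0 : 0 <= M.
Hypothesis phiD : forall x y : V, phi (x + y) = phi x + phi y.
Hypothesis phiZ : forall (c : R) (x : V), phi (c *r x) = c * phi x.
Hypothesis phi_le : forall x : V, phi x <= M * nr x.

Let phi0 : phi 0 = 0.
Proof. by rewrite -(rs0 0) phiZ mul0r. Qed.

(* The representative minimises [|x|^2 - 2 phi x]. *)
Lemma riesz : exists v, forall x, phi x = ip v x.
Proof.
pose f (x : V) : R := nr x ^+ 2 - 2 * phi x.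
have fP (x : V) : - M ^+ 2 <= f x.
  by rewrite /f; have := phi_le x; have := sqr_ge0 (nr x - M); nra.
pose F : set R := [set f x | x in [set: V]].
have F0 : F !=set0 by exists (f 0), 0.
have Finf : has_inf F by split => //; exists (- M ^+ 2) => _ [x _ <-].
pose m : R := inf F.
have mP (x : V) : m <= f x by apply: ge_inf; [case: Finf|exists x].
have mex (n : nat) : exists x, f x < m + n.+1%:R^-1 :> R.
  have [] := @inf_adherent _ F (n.+1%:R^-1) _ Finf; first by rewrite invr_gt0 ltr0n.
  by move=> _ [x _ <-] h; exists x.
have [u hu] := choice mex.
(* Parallelogram law: [f] at the midpoint is still at least [m], which makes a minimising sequence
   Cauchy. *)
have par (x y : V) : nr (x - y) ^+ 2 <= 2 * (f x - m) + 2 * (f y - m).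
  have := mP (2^-1 *r (x + y)).
  rewrite /f phiZ phiD nrZr exprMn ger0_norm ?invr_ge0// nrB2 nrD2; nra.
have [v uv] : exists v, hcvg u v.
  apply: cauchy_hcvg => e e0.
  have : exists N, forall n, (N <= n)%N -> n.+1%:R^-1 < e ^+ 2 / 4 :> R.
    have := @cvg_harmonic R; move/cvgrPdist_lt => /(_ (e ^+ 2 / 4)).
    case; first by rewrite divr_gt0 ?exprn_gt0.
    move=> N _ hN; exists N => n /hN /=; rewrite sub0r normrN.
    by apply: le_lt_trans; exact: ler_norm.
  move=> [N hN]; exists N => k l Nk Nl.
  rewrite -ltr_sqr ?nnegrE ?nr_ge0 ?ltW//.
  have h1 := par (u k) (u l); have h2 := hu k; have h3 := hu l.
  have h4 := hN _ Nk; have h5 := hN _ Nl.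
  by move: h1 h2 h3 h4 h5; move: (k.+1%:R^-1) (l.+1%:R^-1) => a b; lra.
have fv : f v = m.
  apply/eqP; rewrite eq_le mP andbT; apply/ler_addgt0Pr => e e0.
  pose c : R := 2 * nr v + 2 * M + 2.
  have c0 : 0 < c.
    by rewrite /c; have := nr_ge0 v; have := M0; lra.
  have ec0 : 0 < Num.min 1 (e / 2 / c) by rewrite lt_min ltr01 !divr_gt0.
  have [N hN] := uv _ ec0.
  have [K hK] : exists K, forall n, (K <= n)%N -> n.+1%:R^-1 < e / 2 :> R.
    have := @cvg_harmonic R; move/cvgrPdist_lt => /(_ (e / 2)).
    case; first by lra.
    move=> K _ hK; exists K => n /hK /=; rewrite sub0r normrN.
    by apply: le_lt_trans; exact: ler_norm.
  pose n := maxn N K.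
  have := hN n (leq_maxl _ _); have := hK n (leq_maxr _ _); have := hu n.
  rewrite lt_min (ltr_pdivlMr _ _ c0) => h1 h2 /andP[h3 h4].
  pose d := u n - v.
  have E : u n = v + d by rewrite /d addrC subrK.
  have : f (u n) = f v + nr d ^+ 2 + 2 * ip v d - 2 * phi d.
    by rewrite E /f nrD2 phiD; ring.
  have := ip_abs v d; rewrite ler_norml => /andP[h5 _].
  have h6 : phi d <= M * nr d.
    exact: phi_le.
  move: h4 h1 h2; rewrite -/d /c; move: (n.+1%:R^-1) => i.
  have := sqr_ge0 (nr d); have := nr_ge0 d; nra.
exists v => x.
apply/eqP; rewrite -subr_eq0; apply/eqP.
pose p : R := phi x - ip v x.
(* Minimality along the line [v + t x]; taking [t = p / nr x ^+ 2] below forces [p ^+ 2 <= 0]. *)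
have key (t : R) : 0 <= t ^+ 2 * nr x ^+ 2 - 2 * t * p.
  have := mP (v + t *r x); rewrite -fv /f nrD2 phiD phiZ ipZr nrZr exprMn.
  by rewrite real_normK ?num_real// /p; nra.
have [x0|x0] := eqVneq (nr x) 0.
  by rewrite (nr0_eq0 x0) phi0 ip0r subrr.
have := key (p / nr x ^+ 2); rewrite -/p.
have -> : (p / nr x ^+ 2) ^+ 2 * nr x ^+ 2 - 2 * (p / nr x ^+ 2) * p =
    - (p ^+ 2 / nr x ^+ 2) by field.
rewrite oppr_ge0 pmulr_lle0 ?invr_gt0 ?exprn_gt0 ?lt_neqAle ?nr_ge0 ?andbT 1?eq_sym//.
by move=> h; apply/eqP; rewrite -sqrf_eq0 eq_le h sqr_ge0.
Qed.

End riesz.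

Section lax_milgram.
Context {R : realType} {V : hilbertType R}.
Variables (b : V -> V -> R) (M c : R).
Hypothesis M0 : 0 <= M.
Hypothesis bDl : forall x y z : V, b (x + y) z = b x z + b y z.
Hypothesis bZl : forall (a : R) (x z : V), b (a *r x) z = a * b x z.
Hypothesis bDr : forall x y z : V, b z (x + y) = b z x + b z y.
Hypothesis bZr : forall (a : R) (x z : V), b z (a *r x) = a * b z x.
Hypothesis b_le : forall x y : V, b x y <= M * nr x * nr y.
Hypothesis c0 : 0 < c.
Hypothesis b_ge : forall x : V, c * nr x ^+ 2 <= b x x.

(** With [b u v = ip (T u) v], the map [x - r (T x - f)] is a contraction, as [|x - r T x|^2 <= (1 -
    2 r c + r^2 K^2) |x|^2]; the factor is smallest at [r = c / K ^+ 2]. Taking [K = M + c] ensures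
    [0 < K] and [c <= K], so that the factor lies in [[0, 1)]. *)
Lemma lax_milgram f : exists u, forall v, b u v = ip f v.
Proof.
have [T hT] := choice (fun x => riesz (mulr_ge0 M0 (nr_ge0 x)) (fun y z => bDr y z x)
  (fun a y => bZr a y x) (b_le x)).
have TD (x y : V) : T (x + y) = T x + T y.
  by apply: ip_ext => z; rewrite ipDl -!hT bDl.
have TZ (a : R) (x : V) : T (a *r x) = a *r T x.
  by apply: ip_ext => z; rewrite ipZl -!hT bZl.
have T_le x : nr (T x) <= M * nr x.
  have := b_le x (T x); rewrite hT ip_nr => h.
  have := nr_ge0 (T x); rewrite le_eqVlt => /orP[/eqP <-|T0].
    by rewrite mulr_ge0 ?nr_ge0.
  by rewrite -(ler_pM2r T0) -expr2.
pose K : R := M + c.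
have K0 : 0 < K by exact: ltr_wpDl.
pose r : R := c / K ^+ 2.
have r0 : 0 < r by rewrite divr_gt0 ?exprn_gt0.
have cK : c <= K by rewrite lerDr.
pose q2 : R := 1 - c ^+ 2 / K ^+ 2.
have q20 : 0 <= q2.
  by rewrite /q2 subr_ge0 ler_pdivrMr ?exprn_gt0// mul1r ler_sqr// nnegrE ltW.
have q21 : q2 < 1 by rewrite /q2 ltrBlDr ltrDl divr_gt0 ?exprn_gt0.
pose q : R := Num.sqrt q2.
have qq : q ^+ 2 = q2 by rewrite sqr_sqrtr.
have q0 : 0 <= q by rewrite sqrtr_ge0.
have q1 : q < 1 by rewrite -(ltr_sqr (y := 1)) ?nnegrE// qq expr1n.
have contr (x : V) : nr (x - r *r T x) <= q * nr x.
  rewrite -ler_sqr ?nnegrE ?mulr_ge0 ?nr_ge0// exprMn qq nrB2 nrZr exprMn ipZr.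
  rewrite real_normK ?num_real// ipC -hT.
  have h1 := b_ge x.
  have h2 : nr (T x) ^+ 2 <= K ^+ 2 * nr x ^+ 2.
    rewrite -exprMn; apply: lerXn2r; rewrite ?nnegrE ?mulr_ge0 ?nr_ge0 ?(ltW K0)//.
    by apply: (le_trans (T_le x)); rewrite ler_wpM2r ?nr_ge0// lerDl ltW.
  have h3 : r * K ^+ 2 = c by rewrite /r; field; rewrite gt_eqF.
  have h4 : q2 = 1 - r * c by rewrite /q2 /r; field; rewrite gt_eqF.
  rewrite h4.
  have : r * (r * nr (T x) ^+ 2) <= r * (r * (K ^+ 2 * nr x ^+ 2)).
    by rewrite !ler_pM2l.
  have : r * (c * nr x ^+ 2) <= r * b x x by rewrite ler_pM2l.
  have -> : r * (r * (K ^+ 2 * nr x ^+ 2)) = r * (c * nr x ^+ 2) by rewrite -h3; ring.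
  nra.
pose F x := x - r *r (T x - f).
have FB (x y : V) : F x - F y = (x - y) - r *r T (x - y).
  have -> : T (x - y) = T x - T y by rewrite (rN1 y) TD TZ -rN1.
  by rewrite /F; apply: ip_ext => z; rewrite !ipE; ring.
have hF (x y : V) : nr (F x - F y) <= q * nr (x - y) by rewrite FB.
pose u n := iter n F 0.
have [l ul] : exists l, hcvg u l.
  apply: (@geometric_hcvg _ _ _ (nr (u 1%N - u 0%N)) q) => //.
  elim=> [|n IH]; first by rewrite expr0 mulr1.
  by apply: le_trans (hF _ _) _; rewrite exprS mulrCA ler_wpM2l.
exists l => v.
have Fl : F l = l.
  apply: (hcvg_unique (u := fun n => u n.+1)); last exact: hcvg_shift.
  exact: (hcvg_lip (f := F) (c := q)).
have : r *r (T l - f) = 0.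
  by move: Fl => /eqP; rewrite /F -subr_eq0 addrAC subrr sub0r oppr_eq0 => /eqP.
move/eqP; rewrite scaler_eq0 => /orP[|].
  by rewrite eq_complex/= eqxx andbT gt_eqF.
by rewrite subr_eq0 hT => /eqP ->.
Qed.

Lemma lax_milgram_unique u u' : (forall v, b u v = b u' v) -> u = u'.
Proof.
move=> h; apply/eqP; rewrite -subr_eq0; apply/eqP/nr0_eq0.
have : b (u - u') (u - u') = 0 by rewrite rN1 bDl bZl h; ring.
have := b_ge (u - u'); have := sqr_ge0 (nr (u - u')) => h1 h2 h3.
by apply/eqP; rewrite -sqrf_eq0 eq_le h1 andbT -(pmulr_rle0 _ c0); lra.
Qed.

End lax_milgram.

Ltac pos := solve [ repeat first
  [ assumption | by [] | exact: nr_ge0 | exact: sqr_ge0 | apply: exprn_ge0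
  | apply: divr_ge0 | apply: mulr_ge0 | (rewrite invr_ge0) | apply: addr_ge0 | (apply: sumr_ge0 => ? _)
  | match goal with h : is_true (@Order.lt _ _ _ _) |- _ => exact: (ltW h)
      | h : is_true (@Order.le _ _ _ _) |- _ => exact: h end ] ].

Section topology.
Context {R : realType}.
Implicit Types (V H X : hilbertType R).

Lemma cvg_nrP H (T : Type) (F : set_system T) (FF : Filter F) (f : T -> H) l :
  f @ F --> l <-> forall e : R, 0 < e -> \forall x \near F, nr (l - f x) < e.
Proof.
split=> [/cvgrPdist_lt h e e0|h].
  have e0' : 0 < e%:C%C by rewrite ltcR.
  by have := h _ e0'; apply: filterS => x; rewrite nrE ltcR.
apply/cvgrPdist_lt => -[e i]; rewrite ltcE/= => /andP[/eqP i0 e0].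
rewrite i0; apply: filterS (h _ e0) => x; rewrite nrE -ltcR; exact.
Qed.

Lemma lipschitz_continuous V H (f : {linear V -> H}) (M : R) :
  (forall x, nr (f x) <= M * nr x) -> continuous f.
Proof.
move=> fM x; apply/cvg_nrP => e e0.
have M0 : 0 < `|M| + 1 by rewrite ltr_wpDl.
have /cvg_nrP/(_ (e / (`|M| + 1))) : y @[y --> x] --> x by exact: cvg_id.
rewrite divr_gt0// => /(_ isT); apply: filterS => y.
rewrite ltr_pdivlMr// -linearB => h; apply: (le_lt_trans (fM _)).
apply: le_lt_trans h; rewrite mulrC ler_wpM2l ?nr_ge0//.
by apply: (le_trans (ler_norm _)); rewrite lerDl.
Qed.

Lemma continuous_lipschitz V H (f : {linear V -> H}) :
  continuous f -> exists2 M : R, 0 < M & forall x, nr (f x) <= M * nr x.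
Proof.
move=> /(_ 0)/cvg_nrP/(_ 1 ltr01); rewrite linear0 /= => /nbhs_ballP[[d i]/=].
rewrite ltcE/= => /andP[/eqP i0 d0] hd.
exists (2 / d) => [|x]; first by rewrite divr_gt0.
have [x0|x0] := eqVneq (nr x) 0.
  by rewrite x0 mulr0 (nr0_eq0 x0) linear0 nr0.
have nx0 : 0 < nr x by rewrite lt_neqAle eq_sym x0 nr_ge0.
pose k := d / 2 / nr x.
have k0 : 0 < k by rewrite /k !divr_gt0.
have := hd (k *r x); rewrite -ball_normE /ball_/= sub0r normrN nrE nrZr gtr0_norm//.
rewrite ltcE/= i0 eqxx/=.
have -> : k * nr x = d / 2 by rewrite /k -mulrA mulVf ?mulr1.
rewrite ltr_pdivrMr// ltr_pMr// ltr1n => /(_ isT).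
rewrite sub0r nrN linearZ/= nrZr gtr0_norm// -ltr_pdivlMl// mulr1.
have -> : k^-1 = 2 / d * nr x by rewrite /k; field; rewrite x0 gt_eqF.
exact: ltW.
Qed.

End topology.

(** Maps obtained by uniqueness from real identities are only seen to commute with real scalars and
    with ['i]; these generate [R[i]]. *)
Lemma complex_linear {R : realType} {V W : lmodType R[i]} (f : V -> W) :
  (forall x y : V, f (x + y) = f x + f y) ->
  (forall (c : R) (x : V), f (c *r x) = c *r f x) ->
  (forall x : V, f ('i%C *: x) = 'i%C *: f x) ->
  exists F : {linear V -> W}, F =1 f.
Proof.
move=> fD fZ fi.
have fL : linear f.
  move=> c x y; rewrite fD; congr (_ + _).
  by rewrite (complexE c) !scalerDl -!scalerA fD fZ fi fZ.
pose F : {linear V -> W} := HB.pack f (GRing.isLinear.Build _ _ _ _ f fL).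
by exists F.
Qed.

Lemma linZ {R : realType} {V W : lmodType R[i]} (f : {linear V -> W}) (c : R[i]) x :
  f (c *: x) = c *: f x.
Proof. exact: linearZ. Qed.

Lemma dense_nr {R : realType} {V : hilbertType R} (D : set V) : dense D ->
  forall x (e : R), 0 < e -> exists2 y, D y & nr (x - y) < e.
Proof.
move=> dD x e e0.
have [] := dD (ball x (e%:C)%C).
- by exists x; apply: ballxx; rewrite ltcR.
- by apply: ball_open; rewrite ltcR.
- by move=> y [+ Dy]; rewrite -ball_normE /ball_/= nrE ltcR; exists y.
Qed.

Section form.
Context {R : realType} {V H : hilbertType R} {j : {linear V -> H}}.
Variables (a : V -> V -> R[i]) (Mj M d w : R).
Hypothesis Mj0 : 0 <= Mj.
Hypothesis j_le : forall u : V, nr (j u) <= Mj * nr u.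
Hypothesis aDl : forall u u' v : V, a (u + u') v = a u v + a u' v.
Hypothesis aZl : forall (c : R[i]) (u v : V), a (c *: u) v = c * a u v.
Hypothesis aDr : forall u v v' : V, a u (v + v') = a u v + a u v'.
Hypothesis aZr : forall (c : R[i]) (u v : V), a u (c *: v) = c^*%R * a u v.

Definition al (u v : V) : R := complex.Re (a u v).

Hypothesis M0 : 0 <= M.
Hypothesis al_le : forall u v : V, al u v <= M * nr u * nr v.
Hypothesis d0 : 0 < d.
Hypothesis w0 : 0 <= w.
Hypothesis al_ge : forall u : V, d * nr u ^+ 2 <= al u u + w * nr (j u) ^+ 2.

Lemma alDl (u u' v : V) : al (u + u') v = al u v + al u' v.
Proof. by rewrite /al aDl raddfD. Qed.

Lemma alDr (u v v' : V) : al u (v + v') = al u v + al u v'.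
Proof. by rewrite /al aDr raddfD. Qed.

Lemma alZl (c : R) (u v : V) : al (c *r u) v = c * al u v.
Proof. by rewrite /al aZl; case: (a u v) => ? ? /=; rewrite mul0r subr0. Qed.

Lemma alZr (c : R) (u v : V) : al u (c *r v) = c * al u v.
Proof. by rewrite /al aZr conjcE conjc_real; case: (a u v) => ? ? /=; rewrite mul0r subr0. Qed.

Lemma alNl (u v : V) : al (- u) v = - al u v.
Proof. by rewrite rN1 alZl mulN1r. Qed.

Lemma alNr (u v : V) : al u (- v) = - al u v.
Proof. by rewrite rN1 alZr mulN1r. Qed.

Lemma al_i (u v : V) : al ('i%C *: u) v = - al u ('i%C *: v).
Proof. by rewrite /al aZl aZr conjcE; case: (a u v) => ? ? /=; ring. Qed.

Lemma al_Im (u v : V) : complex.Im (a u v) = al u ('i%C *: v).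
Proof. by rewrite /al aZr conjcE; case: (a u v) => ? ? /=; ring. Qed.

Definition alE := (alDl, alDr, alNl, alNr, alZl, alZr).

(** Testing with ['i *: v] recovers the imaginary parts, so the operator of [a] is determined by
    [al]. *)
Lemma al_inner (u : V) (y : H) :
  (forall v, al u v = ip y (j v)) <-> (forall v, a u v = inner y (j v)).
Proof.
split=> h v; last by rewrite /al h.
apply/eqP; rewrite eq_complex -/(al u v) h eqxx al_Im Im_inner/=.
by rewrite h linearZ.
Qed.

Let be (s : R) (u v : V) : R := s * ip (j u) (j v) + al u v.

Let be_ge s u : w <= s -> (s - w) * nr (j u) ^+ 2 + d * nr u ^+ 2 <= be s u u.
Proof. by move=> ws; rewrite /be ip_nr; have := al_ge u; lra. Qed.

(** The form [be s] is coercive on [V] once [w <= s], so the real Lax-Milgram theorem applies.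
    Uniqueness makes the solution complex linear, since ['i] crosses both parts of [be s] with a
    change of sign. *)
Lemma resolvent_exists s : w <= s -> exists Rs : {linear H -> V},
  forall x v, s * ip (j (Rs x)) (j v) + al (Rs x) v = ip x (j v).
Proof.
move=> ws.
have s0 : 0 <= s by exact: le_trans w0 ws.
have bDl u u' v : be s (u + u') v = be s u v + be s u' v.
  by rewrite /be linearD !ipE alDl; ring.
have bDr u u' v : be s v (u + u') = be s v u + be s v u'.
  by rewrite /be linearD !ipE alDr; ring.
have bZl c u v : be s (c *r u) v = c * be s u v.
  by rewrite /be linZ !ipE alZl; ring.
have bZr c u v : be s v (c *r u) = c * be s v u.
  by rewrite /be linZ !ipE alZr; ring.
have b_ge u : d * nr u ^+ 2 <= be s u u.
  have := be_ge u ws.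
  have : 0 <= (s - w) * nr (j u) ^+ 2 by rewrite mulr_ge0 ?subr_ge0 ?sqr_ge0.
  lra.
have b_le u v : be s u v <= (s * Mj ^+ 2 + M) * nr u * nr v.
  have h1 : ip (j u) (j v) <= Mj ^+ 2 * (nr u * nr v).
    apply: (le_trans (ip_le _ _)); rewrite expr2 mulrACA.
    by apply: ler_pM; rewrite ?nr_ge0.
  have := ler_wpM2l s0 h1; have := al_le u v; rewrite /be; lra.
have ex x : exists u, forall v, be s u v = ip x (j v).
  have [f hf] : exists f, forall v, ip x (j v) = ip f v.
    apply: (@riesz _ _ (fun v => ip x (j v)) (nr x * Mj)).
    - by rewrite mulr_ge0 ?nr_ge0.
    - by move=> u v; rewrite linearD ipDr.
    - by move=> c v; rewrite linZ ipZr.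
    - move=> v; apply: (le_trans (ip_le _ _)).
      by rewrite -mulrA ler_wpM2l ?nr_ge0.
  have [u hu] := lax_milgram (addr_ge0 (mulr_ge0 s0 (sqr_ge0 Mj)) M0) bDl bZl bDr bZr
     b_le d0 b_ge f.
  by exists u => v; rewrite hu hf.
have [f hf] := choice ex.
have uniq u u' : (forall v, be s u v = be s u' v) -> u = u'.
  exact: (lax_milgram_unique bDl bZl d0 b_ge).
have [F hF] : exists F : {linear H -> V}, F =1 f.
  apply: complex_linear => [x y|c x|x]; apply: uniq => v.
  - by rewrite bDl !hf ipDl.
  - by rewrite bZl !hf ipZl.
  - by rewrite hf ip_iN -linZ -hf /be !(linZ j) al_i ip_iN; ring.
by exists F => x v; rewrite hF; exact: hf.
Qed.

Section resolvent.
Variable Rs : R -> {linear H -> V}.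
Hypothesis RsP : forall s, w <= s ->
  forall x v, s * ip (j (Rs s x)) (j v) + al (Rs s x) v = ip x (j v).

(** The equation tested with its own solution. This is the source of the decay of [j (Rs s x)] like
    [1 / s] in [H], and of [Rs s x] like [s^(-1/2)] in [V]. *)
Lemma res_energy s x : w <= s ->
  (s - w) * nr (j (Rs s x)) ^+ 2 + d * nr (Rs s x) ^+ 2 <= ip x (j (Rs s x)).
Proof. by move=> ws; rewrite -(RsP ws); exact: be_ge. Qed.

Lemma res_uniq s u x : w <= s ->
  (forall v, s * ip (j u) (j v) + al u v = ip x (j v)) -> u = Rs s x.
Proof.
move=> ws hu; apply/eqP; rewrite -subr_eq0; apply/eqP/nr0_eq0.
set e := u - Rs s x.
have : be s e e = 0.
  have E v : s * ip (j e) (j v) + al e v = 0.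
    by rewrite /e linearB !ipE !alE; have := RsP ws x v; have := hu v; lra.
  exact: E.
have := be_ge e ws; have := d0; have := sqr_ge0 (nr e); have := sqr_ge0 (nr (j e)).
move=> h1 h2 h3 h4 h5; apply/eqP; rewrite -sqrf_eq0 eq_le h2 andbT.
rewrite -(pmulr_rle0 _ h3); have : 0 <= (s - w) * nr (j e) ^+ 2.
  by rewrite mulr_ge0 ?subr_ge0.
lra.
Qed.

Lemma res_le s x : w <= s -> (s - w) * nr (j (Rs s x)) <= nr x.
Proof.
move=> ws; have [e0|] := eqVneq (nr (j (Rs s x))) 0.
  by rewrite e0 mulr0 nr_ge0.
rewrite neq_lt ltNge nr_ge0/= => n0; rewrite -(ler_pM2r n0).
have := res_energy x ws; have := ip_le x (j (Rs s x)).
have : 0 <= d * nr (Rs s x) ^+ 2 by rewrite mulr_ge0 ?sqr_ge0// ltW// d0.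
by rewrite -mulrA -expr2; lra.
Qed.

Lemma res_opP s u x : w <= s ->
  (forall v, al u v = ip x (j v)) -> u = Rs s (x + s *r j u).
Proof. by move=> ws h; apply: res_uniq => // v; rewrite h !ipE; ring. Qed.

Lemma al_res s x v : w <= s ->
  al (Rs s x) v = ip (x - s *r j (Rs s x)) (j v).
Proof. by move=> ws; rewrite !ipE -(RsP ws); ring. Qed.

Lemma res_id s t x : w <= s -> w <= t ->
  Rs t x = Rs s (x + (s - t) *r j (Rs t x)).
Proof.
move=> ws wt; apply: res_uniq => // v.
by rewrite !ipE -(RsP wt x v); ring.
Qed.

Lemma res_comm s t x : w <= s -> w <= t ->
  j (Rs s (j (Rs t x))) = j (Rs t (j (Rs s x))).
Proof.
move=> ws wt; have [->//|st] := eqVneq s t.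
have h1 := res_id x ws wt; have h2 := res_id x wt ws.
rewrite linearD linZ in h1; rewrite linearD linZ in h2.
have /(congr1 (fun x => (s - t)^-1 *r j x)) :
    (s - t) *r Rs s (j (Rs t x)) = (s - t) *r Rs t (j (Rs s x)).
  apply: ip_ext => z; move: (congr1 (ip ^~ z) h1) (congr1 (ip ^~ z) h2).
  by rewrite !ipE; lra.
by rewrite !(linZ j) !rsA mulVf ?subr_eq0// !rs1.
Qed.

Hypothesis j_dense : dense (range j).

(** On the dense range of [j], the error [u = v - s R_s (j v)] solves the resolvent equation with
    right-hand side [al v], so its energy keeps [nr (j u) ^+ 2] of order [1 / s]. The uniform bound
    [bd] transfers this to all [x]. *)
Lemma res_cvg x (e : R) : 0 < e ->
  exists2 S, w < S & forall s, S <= s -> nr (x - s *r j (Rs s x)) < e.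
Proof.
move=> e0; have e80 : 0 < e / 8 by lra.
have [_ [v _ <-] xv] := dense_nr j_dense x e80.
pose K := (M * nr v) ^+ 2 / (4 * d).
have K0 : 0 <= K by rewrite divr_ge0 ?sqr_ge0// mulr_ge0// ltW// d0.
(* The part [2 * w + 1] gives [s <= 2 * (s - w)], hence [bd]; the last term makes [K / (s - w)]
   smaller than [(e / 8) ^+ 2]. *)
pose S : R := 2 * w + 1 + K / (e / 8) ^+ 2.
have S1 : 0 <= K / (e / 8) ^+ 2 by rewrite divr_ge0 ?sqr_ge0.
have w0' := w0; have d0' := d0.
exists S; first by rewrite /S; lra.
move=> s Ss; have ws : w < s by move: Ss; rewrite /S; lra.
have ws' := ltW ws.
have bd y : nr (s *r j (Rs s y)) <= 2 * nr y.
  rewrite nrZr ger0_norm; last lra.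
  have := res_le y ws'; have : s <= 2 * (s - w) by move: Ss; rewrite /S; lra.
  by move/(ler_wpM2r (nr_ge0 (j (Rs s y)))); lra.
pose u := v - s *r Rs s (j v).
have hu : be s u u = al v u.
  suff E y : s * ip (j u) (j y) + al u y = al v y by exact: E.
  by rewrite /u linearB (linZ j) !ipE !alE -(RsP ws' (j v) y); ring.
have ju : nr (j u) < e / 8.
  rewrite -ltr_sqr ?nnegrE ?nr_ge0 ?ltW//.
  have h1 := be_ge u ws'; rewrite hu in h1.
  have h2 := al_le v u.
  have h3 : M * nr v * nr u <= d * nr u ^+ 2 + K.
    have := sqr_ge0 (2 * d * nr u - M * nr v).
    have -> : d * nr u ^+ 2 + K = M * nr v * nr u + (2 * d * nr u - M * nr v) ^+ 2 / (4 * d).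
      by rewrite /K; field; rewrite gt_eqF.
    by move=> h; rewrite lerDl divr_ge0// mulr_ge0// ltW.
  have h4 : (s - w) * nr (j u) ^+ 2 <= K by lra.
  have h5 : K / (e / 8) ^+ 2 < s - w by move: Ss; rewrite /S; lra.
  rewrite ltr_pdivrMr ?exprn_gt0// in h5.
  have h6 : 0 < s - w by lra.
  by rewrite -(ltr_pM2l h6); apply: le_lt_trans h4 h5.
have -> : x - s *r j (Rs s x) = (x - j v) + j u - s *r j (Rs s (x - j v)).
  by rewrite /u linearB (linZ j) !linearB; apply: ip_ext => z; rewrite !ipE; ring.
have := bd (x - j v); have := ler_nrBD ((x - j v) + j u) (s *r j (Rs s (x - j v))).
have := ler_nrD (x - j v) (j u); lra.
Qed.

End resolvent.
End form.

(** * Chebyshev operators of a bounded operator *)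

Section chebyshev.
Context {R : realType} {H : hilbertType R}.
Implicit Types (B : {linear H -> H}) (x y : H).

(* Chebyshev polynomials of the first and second kind, evaluated at [B]. *)
Fixpoint chT B n x : H :=
  if n is m.+1 then
    if m is k.+1 then 2 *r B (chT B m x) - chT B k x else B x
  else x.

Fixpoint chU B n x : H :=
  if n is m.+1 then
    if m is k.+1 then 2 *r B (chU B m x) - chU B k x else 2 *r B x
  else x.

Lemma chTSS B n x : chT B n.+2 x = 2 *r B (chT B n.+1 x) - chT B n x.
Proof. by []. Qed.

Lemma chUSS B n x : chU B n.+2 x = 2 *r B (chU B n.+1 x) - chU B n x.
Proof. by []. Qed.

Lemma nat_ind2 (P : nat -> Prop) : P 0%N -> P 1%N ->
  (forall n, P n -> P n.+1 -> P n.+2) -> forall n, P n.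
Proof.
move=> P0 P1 PS n; suff: P n /\ P n.+1 by case.
by elim: n => [//|n [? ?]]; split=> //; exact: PS.
Qed.

Lemma chT_linear B n : linear (chT B n).
Proof.
move=> c x y; elim/nat_ind2: n => [//|/=|n IH0 IH1]; first exact: linearP.
rewrite !chTSS IH0 IH1 linearP scalerDr opprD addrACA scalerBr.
by congr (_ - _ + _); rewrite !scalerA mulrC.
Qed.

HB.instance Definition _ B n :=
  GRing.isLinear.Build R[i] H H _ (chT B n) (chT_linear B n).

Lemma chU_linear B n : linear (chU B n).
Proof.
move=> c x y; elim/nat_ind2: n => [//|/=|n IH0 IH1].
  by rewrite linearP scalerDr !scalerA mulrC.
rewrite !chUSS IH0 IH1 linearP scalerDr opprD addrACA scalerBr.
by congr (_ - _ + _); rewrite !scalerA mulrC.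
Qed.

HB.instance Definition _ B n :=
  GRing.isLinear.Build R[i] H H _ (chU B n) (chU_linear B n).

Lemma chT_comm B (F : {linear H -> H}) n x :
  (forall y, B (F y) = F (B y)) -> chT B n (F x) = F (chT B n x).
Proof.
move=> BF; elim/nat_ind2: n => [//|/=|n IH0 IH1]; first exact: BF.
by rewrite !chTSS IH0 IH1 BF linearB (linZ F).
Qed.

Lemma chT_commB B n x : chT B n (B x) = B (chT B n x).
Proof. exact: chT_comm. Qed.

Lemma chTM B m n x : (n <= m)%N ->
  2 *r chT B m (chT B n x) = chT B (m + n) x + chT B (m - n) x.
Proof.
elim/nat_ind2: n m x => [m x _|[//|m] x _|n IH0 IH1 m' x nm].
- by rewrite addn0 subn0 -[in RHS](rs1 (chT B _ _)) -rsD.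
- by rewrite subn1 addn1 chTSS [chT B 1 x]/(B x) chT_commB subrK.
have [k mE] : exists k, m' = (k + n.+2)%N by exists (m' - n.+2)%N; rewrite subnK.
have h0 := IH0 m' x (ltnW (ltnW nm)); have h1 := IH1 m' (x) (ltnW nm).
have -> : chT B m' (chT B n.+2 x) =
    2 *r B (chT B m' (chT B n.+1 x)) - chT B m' (chT B n x).
  by rewrite [chT B n.+2 x]chTSS linearB (linZ (chT B m'))/= chT_commB.
rewrite scalerBr h0 -(linZ B) h1.
rewrite mE !addnK.
rewrite (_ : k + n.+2 - n = k.+2)%N; last lia.
rewrite (_ : k + n.+2 - n.+1 = k.+1)%N; last lia.
rewrite (_ : k + n.+2 + n.+2 = (k + n.+2 + n).+2)%N; last lia.
rewrite (_ : k + n.+2 + n.+1 = (k + n.+2 + n).+1)%N; last lia.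
rewrite !chTSS linearD.
by apply: ip_ext => z; rewrite !ipE; ring.
Qed.

(** The operator form of [cos (n (2 t)) = cos (2 n t)]: it relates [n] steps of one mesh to [2 n]
    steps of the next finer one. *)
Lemma chT_comp B (B2 : {linear H -> H}) n x : (forall y, B2 y = chT B 2 y) ->
  chT B2 n x = chT B n.*2 x.
Proof.
move=> B2E; elim/nat_ind2: n => [//|/=|n IH0 IH1]; first exact: B2E.
rewrite chTSS IH0 IH1 B2E doubleS.
have -> : chT B 2 (chT B n.+1.*2 x) = chT B n.+1.*2 (chT B 2 x).
  by apply: chT_comm => y; rewrite -chT_commB.
rewrite chTM ?doubleS// addn2 subn2 /=.
by apply: ip_ext => z; rewrite !ipE; ring.
Qed.

(** The operator form of [sin ((n + 3) t) - sin ((n + 1) t) = 2 cos ((n + 2) t) sin t]. Bounds on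
    [chU] are obtained by summing those on [chT]. *)
Lemma chUT B n x : chU B n.+2 x = chU B n x + 2 *r chT B n.+2 x.
Proof.
elim/nat_ind2: n => [||n IH0 IH1].
- by rewrite /= (linZ B); apply: ip_ext => z; rewrite !ipE; ring.
- by rewrite /= !(linZ B) linearB (linZ B) ?linearB ?(linZ B); apply: ip_ext => z; rewrite !ipE; ring.
rewrite [chU B n.+4 x]chUSS IH1 linearD (linZ B) [chT B n.+4 x]chTSS.
apply: ip_ext => z; move: (congr1 (ip ^~ z) IH0) (congr1 (ip ^~ z) (chUSS B n x)).
by rewrite !ipE; lra.
Qed.

Lemma chU_le B n x (K : R) : 0 <= K ->
  (forall k, (k <= n)%N -> nr (chT B k x) <= K) ->
  nr (chU B n x) <= n.+1%:R * K.
Proof.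
move=> K0; elim/nat_ind2: n => [|/=|n IH0 IH1] h.
- by rewrite mul1r (h 0%N).
- by rewrite nrZr ger0_norm// ler_wpM2l// (h 1%N).
rewrite chUT; apply: (le_trans (ler_nrD _ _)).
have -> : n.+3%:R = n.+1%:R + 2%:R :> R by rewrite -natrD addn2.
rewrite nrZr ger0_norm// [leRHS]mulrDl; apply: lerD.
  by apply: IH0 => k kn; apply: h; rewrite (leq_trans kn)// leqW.
by rewrite ler_wpM2l// h.
Qed.

End chebyshev.

(** * Discrete Parseval identity over dyadic roots of unity *)

Section parseval.
Context {R : realType} {H : hilbertType R}.

(** Iterated square roots of -1. An order [2 ^ i] with [i < k] would force the power [2 ^ k.-1],
    which is -1, to be 1. *)
Lemma dyadic_root k : exists z : R[i], (2 ^ k).-primitive_root z.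
Proof.
suff [z zk] : exists z : R[i], z ^+ (2 ^ k) = 1 /\ ((0 < k)%N -> z ^+ (2 ^ k.-1) = -1).
  have [m pz] := prim_order_exists (expn_gt0 2 k) zk.1.
  case/dvdn_pfactor => // i ik mE; exists z.
  have [<-|ki] := eqVneq i k; first by rewrite -mE.
  have {ki ik}ik : (i < k)%N by rewrite ltn_neqAle ki.
  have : z ^+ (2 ^ k.-1) = 1.
    have -> : (2 ^ k.-1 = m * 2 ^ (k.-1 - i))%N.
      by rewrite mE -expnD subnKC// -ltnS prednK// (leq_trans _ ik).
    by rewrite exprM (prim_expr_order pz) expr1n.
  rewrite zk.2 ?(leq_trans _ ik)// => /eqP; rewrite eq_sym -subr_eq0 opprK.
  by rewrite (_ : 1 + 1 = 2%:R)// pnatr_eq0.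
case: k => [|k]; first by exists 1; rewrite expr1.
suff [z zk] : exists z : R[i], z ^+ (2 ^ k) = -1.
  by exists z; split=> //; rewrite expnS mulnC exprM zk sqrrN expr1n.
elim: k => [|k [z zk]]; first by exists (-1).
by exists (sqrtC z); rewrite expnS exprM sqrtCK.
Qed.

Lemma sum_unity_root N (z : R[i]) : z ^+ N = 1 -> z != 1 ->
  \sum_(k < N) z ^+ k = 0.
Proof.
move=> zN z1; have := subrX1 z N; rewrite zN subrr => /eqP.
by rewrite eq_sym mulf_eq0 subr_eq0 (negbTE z1)/= => /eqP.
Qed.

Definition hpoly N (x : nat -> H) (z : R[i]) : H := \sum_(n < N) z ^+ n *: x n.

Lemma inner_suml N (F : 'I_N -> H) y :
  inner (\sum_(i < N) F i) y = \sum_(i < N) inner (F i) y.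
Proof.
elim/big_ind2: _ => [|a b c d <- <-|//]; first exact: inner0l.
exact: innerDl.
Qed.

Lemma inner_sumr N (F : 'I_N -> H) y :
  inner y (\sum_(i < N) F i) = \sum_(i < N) inner y (F i).
Proof.
rewrite inner_conj inner_suml rmorph_sum/=; apply: eq_bigr => i _.
by rewrite -inner_conj.
Qed.

(** Averages over finitely many points replace integrals over the circle of radius [rho]. As
    [N <= 2 ^ k], distinct exponents stay distinct modulo the order, and the mixed terms cancel by
    [sum_unity_root]. *)
Lemma parseval k N (x y : nat -> H) (rho : R) (ze : R[i]) : (N <= 2 ^ k)%N ->
  (2 ^ k).-primitive_root ze ->
  \sum_(i < 2 ^ k) ip (hpoly N x (rho%:C%C * ze ^+ i)) (hpoly N y (rho%:C%C * ze ^+ i))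
  = (2 ^ k)%:R * \sum_(n < N) rho ^+ n.*2 * ip (x n) (y n).
Proof.
move=> Nk pz; set M := (2 ^ k)%N.
have M0 : (0 < M)%N by rewrite expn_gt0.
have zM : ze ^+ M = 1 by exact: prim_expr_order pz.
have z0 : ze != 0.
  by apply/eqP => z0; move: zM; rewrite z0 expr0n gtn_eqF// => /eqP; rewrite eq_sym oner_eq0.
have zz : ze * ze^*%R = 1.
  rewrite -normCK; have : `|ze| ^+ M = 1 by rewrite -normrX zM normr1.
  by move/eqP; rewrite pexpr_eq1// => /eqP ->; rewrite expr1n.
have zzC : ze^*%R = ze^-1 by apply: (mulfI z0); rewrite zz mulfV.
apply: complexI.
have innE i : inner (hpoly N x (rho%:C%C * ze ^+ i)) (hpoly N y (rho%:C%C * ze ^+ i))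
   = \sum_(n < N) \sum_(m < N) (rho ^+ (n + m))%:C%C * (ze ^+ n / ze ^+ m) ^+ i * inner (x n) (y m).
  rewrite /hpoly inner_suml; apply: eq_bigr => n _; rewrite inner_sumr.
  apply: eq_bigr => m _; rewrite innerZl innerZr mulrA; congr (_ * _).
  rewrite rmorphXn rmorphM/= rmorphXn/= zzC conjcE conjc_real.
  rewrite !exprMn exprVn exprVn rmorphXn/= exprD -!exprM (mulnC i) (mulnC i).
  by rewrite exprVn -exprM mulrACA.
have tot : \sum_(i < M) inner (hpoly N x (rho%:C%C * ze ^+ i)) (hpoly N y (rho%:C%C * ze ^+ i))
  = \sum_(n < N) (M%:R * (rho ^+ n.*2)%:C%C) * inner (x n) (y n).
  under eq_bigr do rewrite innE.
  rewrite exchange_big; apply: eq_bigr => n _; rewrite exchange_big/=.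
  rewrite (bigD1 n)//= [X in _ + X]big1 ?addr0 => [|m mn].
    rewrite -big_distrl/=; congr (_ * _); rewrite addnn divff ?expf_neq0//.
    under eq_bigr do rewrite expr1n mulr1.
    by rewrite sumr_const card_ord mulr_natl.
  rewrite -big_distrl -big_distrr/= sum_unity_root ?mulr0 ?mul0r//.
    by rewrite exprMn exprVn -!exprM !(mulnC _ M) !exprM zM !expr1n divr1.
  rewrite -(inj_eq (mulIf (expf_neq0 m z0))) divfK ?expf_neq0// mul1r.
  rewrite (eq_prim_root_expr pz) !modn_small ?(leq_trans (ltn_ord _))//.
  by rewrite eq_sym.
rewrite /ip -raddf_sum tot raddf_sum/= mulr_sumr; congr (_ %:C)%C.
apply: eq_bigr => n _; rewrite -/(ip _ _) mulrA.
have -> : M%:R * (rho ^+ n.*2)%:C%C = (M%:R * rho ^+ n.*2)%:C%C :> R[i].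
  by rewrite rmorphM/= rmorph_nat.
by rewrite /ip; case: (inner _ _) => ? ? /=; rewrite mul0r subr0.
Qed.

End parseval.

(** * A positivity condition on a disc, read on coefficients *)

Section positivity.
Context {R : realType} {H : hilbertType R}.

(** Shifting the coefficients multiplies the polynomial [hpoly] by [z], provided that no nonzero
    coefficient is pushed past the truncation; this is the side condition of [hpoly_sh]. *)
Definition sh (x : nat -> H) n : H := if n is m.+1 then x m else 0.

Lemma hpoly_sh N (x : nat -> H) z : (forall n, (N.-1 <= n)%N -> x n = 0) ->
  hpoly N (sh x) z = z *: hpoly N x z.
Proof.
case: N => [|N] x0; first by rewrite /hpoly !big_ord0 scaler0.
rewrite /hpoly big_ord_recl scaler0 add0r big_ord_recr/= x0// scaler0 addr0.
rewrite scaler_sumr; apply: eq_bigr => i _.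
by rewrite scalerA -exprS.
Qed.

Variables (B : {linear H -> H}) (r eta : R).
Hypothesis posB : forall (z : R[i]) (x : H),
  complex.Re z ^+ 2 + complex.Im z ^+ 2 <= r ^+ 2 ->
  eta * nr x ^+ 2 <= ip ((1 - z ^+ 2) *: x) ((1 + z ^+ 2) *: x - (2 * z) *: B x).

(* The mean over the circle of radius [rho] of the hypothesis on [B]. *)
Lemma positive_sum (x : nat -> H) N (rho : R) : 0 <= rho -> rho <= r ->
  (forall n, (N <= n)%N -> x n = 0) ->
  eta * \sum_(n < N) rho ^+ n.*2 * nr (x n) ^+ 2 <=
  \sum_(n < N.+2) rho ^+ n.*2 *
    ip (x n - sh (sh x) n) (x n - 2 *r B (sh x n) + sh (sh x) n).
Proof.
move=> rho0 rhor x0.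
(* Two shifts lengthen the polynomial to [N.+2] coefficients, which must fit below the order of the
   root of unity. *)
have [k Nk] : exists k, (N.+2 <= 2 ^ k)%N by exists N.+2; rewrite ltnW// ltn_expl.
have [ze pz] := @dyadic_root R k.
have k0 : 0 < (2 ^ k)%:R :> R by rewrite ltr0n expn_gt0.
have -> : \sum_(n < N) rho ^+ n.*2 * nr (x n) ^+ 2 =
    \sum_(n < N.+2) rho ^+ n.*2 * ip (x n) (x n).
  rewrite !big_ord_recr/= !(x0 _) ?leqW// !ip0l !mulr0 !addr0.
  by apply: eq_bigr => i _; rewrite ip_nr.
rewrite -(ler_pM2l k0) mulrCA -(parseval x x rho Nk pz).
rewrite -(parseval (fun n => x n - sh (sh x) n)
  (fun n => x n - 2 *r B (sh x n) + sh (sh x) n) rho Nk pz) mulr_sumr.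
apply: ler_sum => i _; set z := _%:C%C * _.
have z2 : complex.Re z ^+ 2 + complex.Im z ^+ 2 <= r ^+ 2.
  rewrite -lecR add_Re2_Im2 /z normrM.
  have -> : `|ze ^+ i| = 1.
    have : `|ze ^+ i| ^+ (2 ^ k) = 1.
      by rewrite -normrX -exprM mulnC exprM (prim_expr_order pz) expr1n normr1.
    by move/eqP; rewrite pexpr_eq1 ?expn_gt0// => /eqP.
  by rewrite mulr1 ger0_norm ?ler0c// -rmorphXn lecR lerXn2r// nnegrE ?(le_trans rho0).
have sh1 : hpoly N.+2 (sh x) z = z *: hpoly N.+2 x z.
  by apply: hpoly_sh => n /= Nn; apply: x0; exact: ltnW.
have sh2 : hpoly N.+2 (sh (sh x)) z = z ^+ 2 *: hpoly N.+2 x z.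
  rewrite hpoly_sh ?sh1 ?scalerA// => -[//|n] /= Nn; exact: x0.
rewrite ip_nr; apply: le_trans (posB _ z2) _.
rewrite le_eqVlt; apply/orP; left; apply/eqP; congr (ip _ _).
  rewrite scalerBl scale1r -sh2 /hpoly -sumrB; apply: eq_bigr => n _.
  by rewrite scalerBr.
rewrite scalerDl scale1r -sh2 -scalerA -(linZ B) -sh1 /hpoly.
rewrite linear_sum scaler_sumr -addrAC -sumrB -big_split/=; apply: eq_bigr => n _.
rewrite (linZ B) scalerA mulrC -scalerA !scalerDr scalerN addrAC.
by rewrite rmorph_nat addrAC.
Qed.

(* Truncating a solution [y] of the recurrence with forcing [y - 2 B sh y + sh^2 y]
   adds two boundary terms. *)
Lemma positive_sum_trunc (y g : nat -> H) N (rho : R) : 0 <= rho -> rho <= r ->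
  (forall n, g n = y n - 2 *r B (sh y n) + sh (sh y) n) ->
  eta * \sum_(n < N.+1) rho ^+ n.*2 * nr (y n) ^+ 2 <=
  \sum_(n < N.+1) rho ^+ n.*2 * ip (y n - sh (sh y) n) (g n)
  + rho ^+ N.+1.*2 * ip (sh y N) (y N.+1 - g N.+1) - rho ^+ N.+2.*2 * nr (y N) ^+ 2.
Proof.
move=> rho0 rhor gE.
pose x n := if (n <= N)%N then y n else 0.
have xE n : (n <= N)%N -> x n = y n by rewrite /x => ->.
have x0 n : (N.+1 <= n)%N -> x n = 0 by rewrite /x => Nn; rewrite leqNgt Nn.
have shE n : (n <= N.+1)%N -> sh x n = sh y n.
  by case: n => [//|n] /=; rewrite ltnS => /xE.
have shE2 n : (n <= N.+2)%N -> sh (sh x) n = sh (sh y) n.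
  by case: n => [//|n] /=; rewrite ltnS => /shE.
have := positive_sum rho0 rhor x0.
rewrite (eq_bigr (fun n : 'I_N.+1 => rho ^+ n.*2 * nr (y n) ^+ 2)) => [|i _]; last first.
  by rewrite xE// -ltnS.
move/le_trans; apply; rewrite big_ord_recr/= big_ord_recr/=.
rewrite (eq_bigr (fun n : 'I_N.+1 => rho ^+ n.*2 * ip (y n - sh (sh y) n) (g n))).
  rewrite (x0 N.+1)// (x0 N.+2)//= !shE//= xE// linear0 scaler0 ?subr0 ?sub0r ?add0r gE/= !ipE -!ip_nr.
  by rewrite le_eqVlt; apply/orP; left; apply/eqP; ring.
move=> i _; have iN : (i <= N)%N by rewrite -ltnS.
by rewrite gE xE// shE ?(leq_trans iN)// shE2 ?(leq_trans iN)// leqW.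
Qed.

End positivity.

Section growth.
Context {R : realType}.

Lemma expr_small (q c : R) : 0 <= q -> q < 1 -> 0 < c -> exists n, q ^+ n < c.
Proof.
move=> q0 q1 c0; have : (fun n => q ^+ n) @ \oo --> (0 : R).
  by apply: cvg_expr; rewrite ger0_norm.
move/cvgrPdist_lt => /(_ c c0)[n _ /(_ n (leqnn n))] /=.
by rewrite sub0r normrN ger0_norm ?exprn_ge0//; exists n.
Qed.

(** A positive excess [S n - k] would be multiplied by at least [ka] at each step, and would outgrow
    [C * t ^+ n]. *)
Lemma growth_dichotomy (S : nat -> R) (ka k t C : R) :
  0 <= t -> t < ka -> 
  (forall n, ka * (S n - k) <= S n.+1 - k) ->
  (forall n, S n - k <= C * t ^+ n) -> forall n, S n <= k.
Proof.
move=> t0 tka hS hC n; rewrite -subr_le0 leNgt; apply/negP => D0.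
have ka0 : 0 < ka by exact: le_lt_trans t0 tka.
have up m : ka ^+ m * (S n - k) <= S (n + m)%N - k.
  elim: m => [|m IH]; first by rewrite mul1r addn0.
  rewrite addnS exprS -mulrA; apply: le_trans (hS _).
  by rewrite ler_pM2l.
have C0 : 0 < C * t ^+ n by exact: lt_le_trans D0 (hC n).
have [|||m] := @expr_small (t / ka) ((S n - k) / (C * t ^+ n)).
- by rewrite divr_ge0// ltW.
- by rewrite ltr_pdivrMr// mul1r.
- by rewrite divr_gt0.
rewrite ltr_pdivlMr// expr_div_n mulrAC ltr_pdivrMr ?exprn_gt0// => h.
have := le_trans (up m) (hC (n + m)%N).
rewrite exprD mulrA leNgt => /negP; apply.
by rewrite mulrC [ltRHS]mulrC.
Qed.

Lemma bounded_sum_small (tau : nat -> R) K n0 (e : R) : 0 < e ->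
  (forall n, 0 <= tau n) -> (forall n, \sum_(i < n) tau i <= K) ->
  exists2 n, (n0 <= n)%N & tau n < e.
Proof.
move=> e0 t0 tK; apply: contrapT => h.
have he n : (n0 <= n)%N -> e <= tau n.
  by move=> nsteps; rewrite leNgt; apply/negP => te; apply: h; exists n.
have low m : m%:R * e <= \sum_(i < n0 + m) tau i.
  elim: m => [|m IH]; first by rewrite mul0r sumr_ge0.
  by rewrite addnS big_ord_recr/= -natr1 mulrDl mul1r lerD// he// leq_addr.
have [M hm] : exists M : nat, K / e < M%:R.
  by exists (Num.truncn (K / e)).+1; rewrite truncnS_gt.
have := le_trans (low M) (tK _); rewrite leNgt => /negP; apply.
by move: hm; rewrite ltr_pdivrMr.
Qed.

End growth.

(** * Caratheodory's inequality for Chebyshev operators *)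

Section caratheodory.
Context {R : realType} {H : hilbertType R}.
Variables (B : {linear H -> H}) (r eta b : R).
Hypothesis r0 : 0 < r.
Hypothesis r1 : r <= 1.
Hypothesis eta0 : 0 < eta.
Hypothesis b0 : 0 <= b.
Hypothesis B_le : forall x, nr (B x) <= b * nr x.
Hypothesis posB : forall (z : R[i]) (x : H),
  complex.Re z ^+ 2 + complex.Im z ^+ 2 <= r ^+ 2 ->
  eta * nr x ^+ 2 <= ip ((1 - z ^+ 2) *: x) ((1 + z ^+ 2) *: x - (2 * z) *: B x).

(** The [chU B n x] are the Taylor coefficients of [(1 - 2 z B + z^2)^-1 x]. Bounding these square
    sums up to [rho = r] plays the part of the analyticity of this inverse on the disc. *)
Let S x (rho : R) N := \sum_(n < N) rho ^+ n.*2 * nr (chU B n x) ^+ 2.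

Let chUg x n : chU B n x - 2 *r B (sh (chU B ^~ x) n) + sh (sh (chU B ^~ x)) n
  = if n is 0 then x else 0.
Proof.
case: n => [|[|n]].
- by rewrite /= linear0 scaler0 subr0 addr0.
- by rewrite /= subrr addr0.
- by apply: ip_ext => z; rewrite chUSS /= !ipE; ring.
Qed.

(** The boundary term of [positive_sum_trunc] is absorbed by the next summand [v ^+ 2]. Hence
    whatever exceeds [2 * nr x ^+ 2 / eta] has to grow by the factor [1 + eta ^+ 2] at each step. *)
Let S_rec x rho N : 0 <= rho -> rho <= r ->
  (1 + eta ^+ 2) * (S x rho N.+1 - 2 * nr x ^+ 2 / eta) <= S x rho N.+2 - 2 * nr x ^+ 2 / eta.
Proof.
move=> rho0 rhor; have rho1 : rho <= 1 by exact: le_trans rhor r1.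
have et := eta0.
have := positive_sum_trunc posB (y := chU B ^~ x) N rho0 rhor (fun n => esym (chUg x n)).
rewrite subr0 -/(S x rho N.+1).
rewrite big_ord_recl/= big1 ?addr0 => [|i _]; last by rewrite ip0r mulr0.
rewrite subr0 mul1r ip_nr => h.
set K := nr x ^+ 2 in h *.
have SS : S x rho N.+2 = S x rho N.+1 + (rho ^+ N.+1 * nr (chU B N.+1 x)) ^+ 2.
  by rewrite /S big_ord_recr/= exprMn -exprM muln2.
rewrite SS; set v := rho ^+ N.+1 * _; set s := S x rho N.+1 in h *.
have cross : rho ^+ N.+1.*2 * ip (sh (chU B ^~ x) N) (chU B N.+1 x) <=
    eta / 2 * s + v ^+ 2 / (2 * eta).
  case: N @s @v h SS => [|N] s v h SS.
    by rewrite ip0l mulr0 /s /S; pos.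
  pose u := rho ^+ N * nr (chU B N x).
  have us : u ^+ 2 <= s.
    rewrite /s /S big_ord_recr big_ord_recr/= /u exprMn -exprM muln2.
    rewrite addrAC lerDr; pos.
  have : rho ^+ N.+2.*2 * ip (chU B N x) (chU B N.+2 x) <= u * v.
    apply: (@le_trans _ _ (rho ^+ N.+2.*2 * (nr (chU B N x) * nr (chU B N.+2 x)))).
      by rewrite ler_wpM2l ?exprn_ge0 ?ip_le.
    rewrite /u /v [leRHS]mulrACA ler_wpM2r ?mulr_ge0 ?nr_ge0// -exprD.
    by apply: ler_wiXn2l => //; clear; lia.
  move/le_trans; apply.
  have : u * v <= eta / 2 * u ^+ 2 + v ^+ 2 / (2 * eta).
    rewrite -subr_ge0; have -> : eta / 2 * u ^+ 2 + v ^+ 2 / (2 * eta) - u * v =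
      (eta * u - v) ^+ 2 / (2 * eta) by field; rewrite gt_eqF.
    by rewrite divr_ge0 ?sqr_ge0// mulr_ge0// ltW.
  have : eta / 2 * u ^+ 2 <= eta / 2 * s by rewrite ler_wpM2l// divr_ge0// ltW.
  lra.
have h2 : eta * s <= K + (eta / 2 * s + v ^+ 2 / (2 * eta)).
  apply: le_trans h _; rewrite -addrA lerD2l lerBlDr (le_trans cross)// lerDl.
  pos.
have h3 : eta ^+ 2 * s <= 2 * eta * K + v ^+ 2.
  have e2 : 0 <= 2 * eta by rewrite mulr_ge0// ltW.
  have := ler_wpM2l e2 h2.
  have -> : 2 * eta * (K + (eta / 2 * s + v ^+ 2 / (2 * eta))) = 2 * eta * K + eta ^+ 2 * s + v ^+ 2.
    by field; rewrite gt_eqF.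
  lra.
have -> : (1 + eta ^+ 2) * (s - 2 * K / eta) = s + eta ^+ 2 * s - 2 * K / eta - 2 * eta * K.
  by field; rewrite gt_eqF.
lra.
Qed.

Let bounded_at x rho := exists C, forall n, rho ^+ n * nr (chU B n x) <= C.

(** One step of continuation in the radius: boundedness at [rho0] limits the growth at [rho] to the
    rate [1 + eta ^+ 2 / 2], below the rate that [S_rec] forces on any excess. *)
Let S_le x rho0 rho N : 0 < rho0 -> 0 <= rho -> rho <= r ->
  rho ^+ 2 <= (1 + eta ^+ 2 / 2) * rho0 ^+ 2 ->
  bounded_at x rho0 -> S x rho N <= 2 * nr x ^+ 2 / eta.
Proof.
move=> r00 rh0 rhr rhq [C hC].
have et := eta0; pose t := 1 + eta ^+ 2 / 2.
have e2 : 0 < eta ^+ 2 by rewrite exprn_gt0.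
have t1 : 1 < t by rewrite /t; lra.
have Sb n : S x rho n <= C ^+ 2 / (t - 1) * t ^+ n.
  have : S x rho n <= C ^+ 2 * \sum_(i < n) t ^+ i.
    rewrite /S mulr_sumr; apply: ler_sum => i _.
    have C0 : 0 <= C by apply: le_trans (hC 0%N); rewrite mulr_ge0 ?exprn_ge0 ?nr_ge0// ltW.
    have h1 : (rho0 ^+ i * nr (chU B i x)) ^+ 2 <= C ^+ 2.
      by apply: lerXn2r; rewrite ?nnegrE// mulr_ge0 ?exprn_ge0 ?nr_ge0// ltW.
    have : rho ^+ i.*2 <= t ^+ i * rho0 ^+ i.*2.
      rewrite -!muln2 mulnC !exprM -exprMn; apply: lerXn2r => //; rewrite nnegrE ?sqr_ge0//.
      by rewrite mulr_ge0 ?sqr_ge0// ltW// (lt_trans ltr01).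
    move/(ler_wpM2r (sqr_ge0 (nr (chU B i x))))/le_trans; apply.
    rewrite -mulrA [leRHS]mulrC ler_wpM2l ?exprn_ge0 ?(le_trans ler01 (ltW t1))//.
    by move: h1; rewrite exprMn -exprM muln2.
  move/le_trans; apply; rewrite [leRHS]mulrAC -[leRHS]mulrA ler_wpM2l ?sqr_ge0//.
  rewrite ler_pdivlMr ?subr_gt0// mulrC -subrX1; lra.
case: N => [|N].
  by rewrite /S big_ord0; pos.
pose C2 := C ^+ 2 / (t - 1) * t.
apply: (@growth_dichotomy _ (fun n => S x rho n.+1) (1 + eta ^+ 2) _ t C2) => //.
- by rewrite ltW// (lt_trans ltr01).
- by rewrite /t; lra.
- by move=> n; exact: S_rec.
- move=> n; apply: (@le_trans _ _ (S x rho n.+1)).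
    by rewrite gerBl; pos.
  by apply: (le_trans (Sb _)); rewrite /C2 [t ^+ _.+1]exprS !mulrA.
Qed.

Let S_bounded_at x rho : 0 <= rho ->
  (forall N, S x rho N <= 2 * nr x ^+ 2 / eta) -> bounded_at x rho.
Proof.
move=> rh0 h; exists (1 + 2 * nr x ^+ 2 / eta) => n.
set p := rho ^+ n * _; suff : p ^+ 2 <= 2 * nr x ^+ 2 / eta.
  by have := sqr_ge0 (p - 1); nra.
apply: le_trans (h n.+1); rewrite /S /p big_ord_recr/= exprMn -exprM muln2 lerDr.
pos.
Qed.

(** The crude bound [nr (chU B n x) <= c ^+ n * nr x] starts the continuation at radius [c^-1]. Each
    step enlarges the squared radius by the factor [t], and [k] steps reach [r]. *)
Let S_r_le x N : S x r N <= 2 * nr x ^+ 2 / eta.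
Proof.
have et := eta0; have bb := b0; have rr := r0.
pose c := 2 * b + 1; have c1 : 1 <= c by rewrite /c; lra.
have c0 : 0 < c by lra.
have base : bounded_at x c^-1.
  exists (nr x) => n; rewrite exprVn ler_pdivrMl ?exprn_gt0//.
  elim/nat_ind2: n => [||n IH0 IH1]; first by rewrite mul1r.
    rewrite /= nrZr ger0_norm// expr1; have := B_le x; have := nr_ge0 x; rewrite /c; lra.
  rewrite chUSS; apply: (le_trans (ler_nrBD _ _)); rewrite nrZr ger0_norm//.
  have h1 : 2 * nr (B (chU B n.+1 x)) <= 2 * b * (c ^+ n.+1 * nr x).
    rewrite -mulrA ler_pM2l//; apply: le_trans (B_le _) _.
    by rewrite ler_wpM2l.
  have h2 : c ^+ n * nr x <= c ^+ n.+1 * nr x.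
    by rewrite ler_wpM2r ?nr_ge0// ler_weXn2l.
  have -> : c ^+ n.+2 * nr x = 2 * b * (c ^+ n.+1 * nr x) + c ^+ n.+1 * nr x.
    by rewrite [c ^+ n.+2]exprS /c; ring.
  lra.
have e2 : 0 < eta ^+ 2 by rewrite exprn_gt0.
pose t := 1 + eta ^+ 2 / 2; have t1 : 1 < t by rewrite /t; lra.
have [k hk] : exists k, r ^+ 2 <= t ^+ k * (c^-1) ^+ 2.
  have [|||k hk] := @expr_small _ t^-1 (c^-1 ^+ 2).
  - by rewrite invr_ge0; lra.
  - by rewrite invf_lt1//; lra.
  - by rewrite exprn_gt0 ?invr_gt0.
  exists k; apply: (@le_trans _ _ 1); first by apply: exprn_ile1 => //; exact: ltW.
  rewrite mulrC -ler_pdivrMr ?exprn_gt0//; last lra.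
  by rewrite mul1r -exprVn ltW.
suff bd rho : 0 < rho -> rho <= r -> rho ^+ 2 <= t ^+ k * c^-1 ^+ 2 ->
    forall N, S x rho N <= 2 * nr x ^+ 2 / eta by exact: bd.
elim: k rho {hk} => [|k IH] rho rh0 rhr hk {}N.
  apply: (@S_le x c^-1 rho) => //; rewrite ?invr_gt0 ?ltW//.
  apply: le_lt_trans hk _; rewrite mul1r -/t ltr_pMl// exprn_gt0// invr_gt0//.
pose q := Num.sqrt t; have qt : q ^+ 2 = t by rewrite sqr_sqrtr; lra.
have q0 : 0 < q by rewrite sqrtr_gt0; lra.
have q1 : 1 <= q.
  by rewrite -ler_sqr ?nnegrE ?(ltW q0)// expr1n qt; exact: ltW.
apply: (@S_le x (rho / q) rho) => //; first exact: divr_gt0; first exact: ltW.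
  by rewrite expr_div_n qt -/t mulrCA divff ?mulr1//; lra.
apply: S_bounded_at; first by rewrite ltW// divr_gt0.
apply: IH; first exact: divr_gt0.
  by apply: le_trans rhr; rewrite ler_pdivrMr// ler_peMr// ltW.
rewrite expr_div_n qt ler_pdivrMr; last lra.
by apply: le_trans hk _; rewrite exprS -mulrA mulrC.
Qed.

(* Caratheodory's inequality for the positive function
   [(1 - z^2) (1 - 2 z B + z^2)^-1 = 1 + 2 \sum_n z^n T_n(B)]. *)
Lemma chebyshev_le n x : r ^+ n * nr (chT B n x) <= nr x.
Proof.
case: n => [|n]; first by rewrite mul1r.
(* The sequence [y] superposes the solution started by [x] at index 0 and the one started by
   [e = - T_m x] at index [m]. The forcing has only these two terms, paired with [y_0 = x] and
   [y_m - y_(m-2) = T_m x]. So the sum bounded below by positivity is [|x|^2 - r^(2 m) |T_m x|^2]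
   plus boundary terms. *)
set m := n.+1; set e := - chT B m x.
have et := eta0.
pose V k := if (m <= k)%N then chU B (k - m) e else 0.
pose y k := chU B k x + V k.
have shD (u v : nat -> H) k : sh (fun k => u k + v k) k = sh u k + sh v k.
  by case: k => [|k] //=; rewrite addr0.
have shD2 (u v : nat -> H) k : sh (sh (fun k => u k + v k)) k = sh (sh u) k + sh (sh v) k.
  by case: k => [|[|k]] //=; rewrite addr0.
have shS (u v : nat -> H) : (forall i, u (m + i)%N = v i) -> (forall k, (k < m)%N -> u k = 0) ->
    (forall i, sh u (m + i)%N = sh v i) /\ (forall k, (k < m)%N -> sh u k = 0).
  move=> uv u0; split=> [[|i]|[|k] km] //=; first by rewrite addn0 u0.
    by rewrite -uv addSnnS.
  by rewrite u0// ltnW.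
have VU i : V (m + i)%N = chU B i e by rewrite /V leq_addr addKn.
have V0 k : (k < m)%N -> V k = 0 by rewrite /V => km; rewrite leqNgt km.
have [V1 V10] := shS _ (chU B ^~ e) VU V0.
have [V2 V20] := shS _ _ V1 V10.
have Vg k : V k - 2 *r B (sh V k) + sh (sh V) k = if k == m then e else 0.
  have [km|mk] := ltnP k m.
    by rewrite ltn_eqF// V0// V10// V20// linear0 scaler0 subr0 addr0.
  rewrite -(subnKC mk) VU V1 V2 chUg -[X in _ == X]addn0 eqn_add2l.
  by case: (k - m)%N.
have yg k : y k - 2 *r B (sh y k) + sh (sh y) k = (if k is 0 then x else 0) + (if k == m then e else 0).
  rewrite -chUg -Vg /y shD shD2 linearD scalerDr.
  by apply: ip_ext => z; rewrite !ipE; ring.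
have yp : y m - sh (sh y) m = 2 *r chT B m x + e.
  have := VU 0%N; have := V2 0%N; rewrite addn0 shD2 /y => -> ->; rewrite addr0 addrAC.
  rewrite /m; congr (_ + _); case: (n) => [|k]; first by rewrite /= subr0.
  by rewrite chUT [sh _ _]/= addrC addKr.
have tot N : (m <= N)%N ->
    \sum_(k < N.+1) r ^+ k.*2 * ip (y k - sh (sh y) k)
      ((if (k : nat) is 0 then x else 0) + (if k == m :> nat then e else 0))
    = nr x ^+ 2 - (r ^+ m * nr (chT B m x)) ^+ 2.
  move=> mN; under eq_bigr do rewrite ipDr mulrDr; rewrite big_split/=; congr (_ + _).
    rewrite big_ord_recl/= big1 ?addr0 => [|i _]; last by rewrite ip0r mulr0.
    by rewrite mul1r subr0 /y V0// addr0 ip_nr.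
  have mN' : (m < N.+1)%N by [].
  rewrite (bigD1 (Ordinal mN'))//= eqxx big1 ?addr0 => [|i im]; last first.
    rewrite ifF ?ip0r ?mulr0//; apply/negbTE; apply: contra im => /eqP im.
    by apply/eqP/val_inj.
  by rewrite yp /e !ipE ip_nr exprMn -exprM muln2; ring.
pose a k := r ^+ k * nr (y k).
have a0 k : 0 <= a k by rewrite mulr_ge0 ?exprn_ge0 ?nr_ge0// ltW.
have a_sum k : \sum_(i < k) a i ^+ 2 <= 2 * (2 * nr x ^+ 2 / eta) + 2 * (2 * nr e ^+ 2 / eta).
  have ai i : a i ^+ 2 <= 2 * (r ^+ i.*2 * nr (chU B i x) ^+ 2) + 2 * (r ^+ i.*2 * nr (V i) ^+ 2).
    have h : nr (y i) ^+ 2 <= 2 * nr (chU B i x) ^+ 2 + 2 * nr (V i) ^+ 2.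
      have : nr (y i) ^+ 2 <= (nr (chU B i x) + nr (V i)) ^+ 2.
        by apply: lerXn2r; rewrite ?nnegrE ?addr_ge0 ?nr_ge0// ler_nrD.
      by have := sqr_ge0 (nr (chU B i x) - nr (V i)); lra.
    have ri : 0 <= r ^+ i.*2 by pos.
    by have := ler_wpM2l ri h; rewrite /a exprMn -exprM muln2; lra.
  have : \sum_(i < k) a i ^+ 2 <= \sum_(i < k)
      (2 * (r ^+ i.*2 * nr (chU B i x) ^+ 2) + 2 * (r ^+ i.*2 * nr (V i) ^+ 2)).
    by apply: ler_sum.
  move/le_trans; apply.
  rewrite big_split/= -!mulr_sumr lerD// ler_pM2l//; first exact: S_r_le.
  apply: le_trans (S_r_le e k).
  apply: (@le_trans _ _ (\sum_(i < m + k) r ^+ i.*2 * nr (V i) ^+ 2)).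
    rewrite addnC big_split_ord/= lerDl; apply: sumr_ge0 => i _.
    by rewrite mulr_ge0 ?sqr_ge0 ?exprn_ge0// ltW.
  rewrite big_split_ord/= big1 ?add0r => [|i _]; last by rewrite V0 ?nr0 ?expr0n ?mulr0.
  apply: ler_sum => i _; rewrite VU ler_wpM2r ?sqr_ge0//.
  by apply: ler_wiXn2l; rewrite ?r1 ?ltW//; clear; lia.
(* A bound for the boundary term; as [a] is square summable, it is small at some late index. *)
pose tau k := a k ^+ 2 + a k.+2 ^+ 2.
have rm0 : 0 <= r ^+ m * nr (chT B m x) by rewrite mulr_ge0 ?exprn_ge0 ?nr_ge0// ltW.
rewrite -ler_sqr ?nnegrE ?nr_ge0//; apply/ler_addgt0Pr => d d0.
set C := 2 * _ + _ in a_sum.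
have [N mN tN] : exists2 N, (m <= N)%N & tau N < d.
  apply: (@bounded_sum_small _ tau (C + C)) => // k.
    by rewrite addr_ge0 ?sqr_ge0.
  rewrite big_split/=; apply: lerD; first exact: a_sum.
  apply: le_trans (a_sum k.+2); rewrite 2!big_ord_recl/= addrA lerDr.
  by rewrite addr_ge0 ?sqr_ge0.
set T := r ^+ m * _ in tot rm0 *.
have := positive_sum_trunc posB (y := y) N.+1 (ltW r0) (lexx r) (fun k => esym (yg k)).
rewrite tot ?(leq_trans mN)// /= ifF; last by apply/negbTE; rewrite gtn_eqF//; lia.
rewrite addr0 subr0.
have h0 : 0 <= eta * \sum_(n < N.+2) r ^+ n.*2 * nr (y n) ^+ 2.
  pos.
have h1 : 0 <= r ^+ N.+3.*2 * nr (y N.+1) ^+ 2.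
  pos.
have h2 : r ^+ N.+2.*2 * ip (y N) (y N.+2) <= a N * a N.+2.
  apply: (@le_trans _ _ (r ^+ N.+2.*2 * (nr (y N) * nr (y N.+2)))).
    by rewrite ler_wpM2l ?exprn_ge0 ?ip_le// ltW.
  rewrite /a [leRHS]mulrACA ler_wpM2r ?mulr_ge0 ?nr_ge0// -exprD.
  by apply: ler_wiXn2l; rewrite ?r1 ?ltW//; clear; lia.
move: tN; rewrite /tau; have := sqr_ge0 (a N - a N.+2); have := sqr_ge0 (a N).
have := sqr_ge0 (a N.+2); move: h0 h1 h2; rewrite -!muln2.
move: (\sum_(n < _) _) (r ^+ _ * ip _ _) (r ^+ _ * nr _ ^+ 2) => s1 s2 s3; nra.
Qed.

End caratheodory.

(** * Scalar inequalities behind the stability estimate *)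

Section real_inequalities.
Context {R : realType}.
Implicit Types p q n : R.

(** For [z = p + i q], [|1 - z| >= 1 - |z| >= (1 - |z|^2) / 2]. In place of the square root
    [|z| = sqrt (1 - a)], the proof uses its Taylor upper bound [c = 1 - a / 2 - a^2 / 8], which
    dominates [p]. *)
Lemma sqr_dist_ge p q n : n = p ^+ 2 + q ^+ 2 -> n <= 1 ->
  (1 - n) ^+ 2 / 4 <= (1 - p) ^+ 2 + q ^+ 2.
Proof.
move=> nE n1; have n0 : 0 <= n by rewrite nE; pos.
have pn : p ^+ 2 <= n by rewrite nE lerDl sqr_ge0.
pose a := 1 - n; pose c := 1 - a / 2 - a ^+ 2 / 8.
have a0 : 0 <= a by rewrite /a; lra.
have a1 : a <= 1 by rewrite /a; lra.
have c0 : 0 <= c by rewrite /c; nra.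
have : p ^+ 2 <= c ^+ 2.
  apply: le_trans pn _; have -> : c ^+ 2 = n + a ^+ 3 / 8 + a ^+ 4 / 64 by rewrite /c /a; field.
  by rewrite -addrA lerDl; pos.
move=> pc; have : p <= c.
  by rewrite leNgt; apply/negP => cp; move: pc; rewrite leNgt => /negP; apply; nra.
by rewrite /c /a nE; lra.
Qed.

Lemma amgm (t x y : R) : 0 <= x -> 0 <= y -> t ^+ 2 <= x * y -> t <= (x + y) / 2.
Proof.
move=> x0 y0 h; rewrite leNgt; apply/negP => h2; have := sqr_ge0 (x - y); nra.
Qed.

(* With [z = p + i q], [n = |z|^2], [x = X + W], [B x = X - W] and
   [<W, X> = kr + i ki], the right-hand side is the real part of
   [<(1 - z^2) x, (1 + z^2) x - 2 z B x>]. *)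
Lemma parabola_ge (p q n h de w Mb om X W v kr ki : R) :
  n = p ^+ 2 + q ^+ 2 -> n <= 1 -> 0 < h -> 0 < de -> 0 <= w -> 0 <= Mb ->
  2 * Mb <= om -> Mb <= om * de -> 16 * w <= om ^+ 2 -> 0 < om ->
  om * h * (1 + n) <= 1 - n -> 0 <= X -> 0 <= v ->
  h ^+ 2 / 4 * (de * v ^+ 2 - w * X ^+ 2) <= kr ->
  ki ^+ 2 <= (h ^+ 2 / 4 * (Mb * X * v)) ^+ 2 ->
  (1 - n) ^+ 3 / 8 * (X ^+ 2 + W ^+ 2) <=
  (1 - n) * (((1 - p) ^+ 2 + q ^+ 2) * X ^+ 2 + ((1 + p) ^+ 2 + q ^+ 2) * W ^+ 2 +
    2 * (1 + n) * kr) - 4 * (1 + n) * (q * ki).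
Proof.
move=> nE n1 h0 de0 w0 Mb0 om1 om2 om3 om0 hn X0 v0 krP kiP.
set c := (1 - p) ^+ 2 + q ^+ 2; set d := (1 + p) ^+ 2 + q ^+ 2.
have n0 : 0 <= n by rewrite nE; pos.
have cn : (1 - n) ^+ 2 / 4 <= c by exact: sqr_dist_ge.
have dn : (1 - n) ^+ 2 / 4 <= d.
  have -> : d = (1 - - p) ^+ 2 + q ^+ 2 by rewrite /d opprK.
  by apply: sqr_dist_ge => //; rewrite sqrrN.
have c0 : 0 <= c by rewrite /c; pos.
have d0 : 0 <= d by rewrite /d; pos.
have cd : c + d = 2 * (1 + n) by rewrite /c /d nE; ring.
have cdq : 4 * q ^+ 2 <= c * d.
  have -> : c * d = (1 - n) ^+ 2 + 4 * q ^+ 2 by rewrite /c /d nE; ring.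
  by rewrite lerDr sqr_ge0.
pose k := h ^+ 2 / 4; have k0 : 0 <= k by rewrite /k; pos.
have n1' : 0 <= 1 - n by lra.
have omh : om * h <= 1 - n.
  apply: le_trans hn; rewrite ler_peMr//; first by pos.
  by lra.
have cw : 16 * k * w <= c.
  apply: le_trans cn; rewrite /k.
  have : (om * h) ^+ 2 <= (1 - n) ^+ 2 by apply: lerXn2r; rewrite ?nnegrE//; pos.
  have := ler_wpM2r (sqr_ge0 h) om3; rewrite exprMn; lra.
(* The imaginary part is the dangerous term. AM-GM splits it into a multiple of [c * X ^+ 2], paid
   for by the term in [X], and one of [d * v ^+ 2], paid for by the ellipticity contained in
   [krP]. *)
have qki : q * ki * (4 * h) <= Mb * h ^+ 2 * (c * X ^+ 2 + k * d * v ^+ 2) / 2.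
  have : (q * ki * (4 * h)) ^+ 2 <= (Mb * h ^+ 2 * (c * X ^+ 2)) * (Mb * h ^+ 2 * (k * d * v ^+ 2)).
    have := ler_wpM2l (sqr_ge0 (q * 4 * h)) kiP.
    have : 0 <= Mb ^+ 2 * h ^+ 6 * X ^+ 2 * v ^+ 2 / 4 by pos.
    move/(ler_wpM2l)/(_ _ _ cdq); rewrite /k.
    have -> : (q * 4 * h) ^+ 2 * ki ^+ 2 = (q * ki * (4 * h)) ^+ 2 by ring.
    have -> : (q * 4 * h) ^+ 2 * (h ^+ 2 / 4 * (Mb * X * v)) ^+ 2 =
      Mb ^+ 2 * h ^+ 6 * X ^+ 2 * v ^+ 2 / 4 * (4 * q ^+ 2) by field.
    have -> : Mb ^+ 2 * h ^+ 6 * X ^+ 2 * v ^+ 2 / 4 * (c * d) =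
      (Mb * h ^+ 2 * (c * X ^+ 2)) * (Mb * h ^+ 2 * (h ^+ 2 / 4 * d * v ^+ 2)) by field.
    by move=> ? /le_trans; apply.
  by move/amgm => /(_ _ _); rewrite -mulrDr; apply; pos.
have qki' : 4 * (1 + n) * (q * ki) <= (1 - n) * (c * X ^+ 2 / 4 + de * k * d * v ^+ 2 / 2).
  have h1 : 4 * (1 + n) * (q * ki) <= (1 + n) * h * Mb * (c * X ^+ 2 + k * d * v ^+ 2) / 2.
    rewrite -(ler_pM2r h0).
    have n10 : 0 <= 1 + n by lra.
    by have := ler_wpM2l n10 qki; lra.
  apply: le_trans h1 _.
  have cX : 0 <= c * X ^+ 2 by pos.
  have dv : 0 <= k * d * v ^+ 2 by pos.
  have nh : 0 <= (1 + n) * h by pos.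
  have m1 : (1 + n) * h * Mb <= (1 - n) / 2 by have := ler_wpM2l nh om1; lra.
  have m2 : (1 + n) * h * Mb <= (1 - n) * de.
    by have := ler_wpM2l nh om2; have := ler_wpM2r (ltW de0) hn; lra.
  have := ler_wpM2r cX m1; have := ler_wpM2r dv m2.
  lra.
have main : c * X ^+ 2 / 2 + d * W ^+ 2 <=
    c * X ^+ 2 + d * W ^+ 2 + 2 * (1 + n) * kr - (c * X ^+ 2 / 4 + de * k * d * v ^+ 2 / 2).
  have h1 : 2 * (1 + n) * (k * (de * v ^+ 2 - w * X ^+ 2)) <= 2 * (1 + n) * kr.
    by apply: ler_wpM2l => //; lra.
  have h2 : 2 * (1 + n) * (k * w * X ^+ 2) <= c * X ^+ 2 / 4.
    have : 0 <= k * w * X ^+ 2 by pos.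
    have := ler_wpM2r (sqr_ge0 X) cw; nra.
  have h3 : de * k * d * v ^+ 2 <= 2 * (1 + n) * (k * de * v ^+ 2).
    have : 0 <= c * (k * de * v ^+ 2) by pos.
    by rewrite -cd; lra.
  have : 0 <= de * k * d * v ^+ 2 by pos.
  lra.
have h1 := ler_wpM2l n1' main.
have h2 : (1 - n) ^+ 3 / 8 * (X ^+ 2 + W ^+ 2) <= (1 - n) * (c * X ^+ 2 / 2 + d * W ^+ 2).
  have -> : (1 - n) ^+ 3 / 8 * (X ^+ 2 + W ^+ 2) =
    (1 - n) * ((1 - n) ^+ 2 / 4 * X ^+ 2 / 2 + (1 - n) ^+ 2 / 4 * W ^+ 2 / 2) by field.
  apply: ler_wpM2l => //.
  have := ler_wpM2r (sqr_ge0 X) cn; have := ler_wpM2r (sqr_ge0 W) dn.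
  have : 0 <= d * W ^+ 2 by pos.
  lra.
lra.
Qed.

(** Because [(1 - t) * (1 + 2 * t) = 1 + t * (1 - 2 * t)]. It converts a radius [1 - t] in
    Caratheodory's inequality into an exponential rate. *)
Lemma expR_ge_inv (t : R) (n : nat) : 0 <= t -> t <= 2^-1 ->
  1 <= (1 - t) ^+ n * expR (2 * t * n%:R).
Proof.
move=> t0 t1; have h : 1 <= (1 - t) * expR (2 * t).
  have := expR_ge1Dx (2 * t); have : 0 <= 1 - t by lra.
  move=> h1 h2; apply: le_trans (ler_wpM2l h1 h2); nra.
by rewrite expRM_natr -exprMn exprn_ege1.
Qed.

End real_inequalities.

(** * The cosine function of an elliptic form *)

Section discrete_bound.
Context {R : realType} {V H : hilbertType R} {j : {linear V -> H}}.
Variables (a : V -> V -> R[i]) (d w Mb : R).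
Hypothesis aDl : forall u u' v : V, a (u + u') v = a u v + a u' v.
Hypothesis aZl : forall (c : R[i]) (u v : V), a (c *: u) v = c * a u v.
Hypothesis aDr : forall u v v' : V, a u (v + v') = a u v + a u v'.
Hypothesis aZr : forall (c : R[i]) (u v : V), a u (c *: v) = c^*%R * a u v.
Hypothesis d0 : 0 < d.
Hypothesis w0 : 0 <= w.
Hypothesis al_ge : forall u : V, d * nr u ^+ 2 <= al a u u + w * nr (j u) ^+ 2.
Hypothesis Mb0 : 0 <= Mb.
Hypothesis Im_le : forall u : V, complex.Im (a u u) ^+ 2 <= (Mb * nr (j u) * nr u) ^+ 2.
Variable Rs : R -> {linear H -> V}.
Hypothesis RsP : forall s, w <= s ->
  forall x v, s * ip (j (Rs s x)) (j v) + al a (Rs s x) v = ip x (j v).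

(* [J s = (1 + s^-1 A)^-1] *)
Definition Jop (s : R) (x : H) : H := s *r j (Rs s x).

Lemma Jop_linear s : linear (Jop s).
Proof.
move=> c x y; rewrite /Jop (linearP (Rs s)) (linearP j) scalerDr.
by congr (_ + _); rewrite !scalerA mulrC.
Qed.

HB.instance Definition _ s :=
  GRing.isLinear.Build R[i] H H _ (Jop s) (Jop_linear s).

(** Formally [(1 - A / s) (1 + A / s)^-1]; with [s = 4 / h ^+ 2] it agrees with [cos (h sqrt A)] up
    to order [h^4]. *)
Definition Bop (s : R) (x : H) : H := 2 *r Jop s x - x.

Lemma Bop_linear s : linear (Bop s).
Proof.
move=> c x y; rewrite /Bop (linearP (Jop s))/= scalerDr opprD addrACA scalerBr.
by rewrite scalerA mulrC -scalerA.
Qed.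

HB.instance Definition _ s :=
  GRing.isLinear.Build R[i] H H _ (Bop s) (Bop_linear s).

Lemma Jop_le s x : 2 * w <= s -> 0 < s -> nr (Jop s x) <= 2 * nr x.
Proof.
move=> ws s0; have w0' := w0; have ws' : w <= s by lra.
rewrite /Jop nrZr ger0_norm ?(ltW s0)//.
have h := res_le d0 al_ge RsP x ws'; have n0 := nr_ge0 (j (Rs s x)); nra.
Qed.

(** The sum meets every condition that [parabola_ge] puts on [om]. The final 1 yields
    [omega <= omega ^+ 2], hence [16 * w <= omega ^+ 2]. *)
Definition omega := 2 * Mb + Mb / d + 16 * w + 1.

Lemma omega_gt0 : 0 < omega.
Proof.
rewrite /omega; have w0' := w0; have Mb0' := Mb0.
have : 0 <= Mb / d by pos.
lra.
Qed.

(** With [X = J x = j y] and [W = x - X = s^-1 A X] one has [x = X + W] and [B x = X - W], while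
    [inner W X = s^-1 a(y, y)] lies in the parabola: this is the situation of [parabola_ge]. The
    constant 16 instead of 8 comes from [nr x ^+ 2 <= 2 * (nr X ^+ 2 + nr W ^+ 2)]. *)
Lemma Bop_positive (h : R) : 0 < h -> omega * h <= 4^-1 -> 
  forall (z : R[i]) (x : H),
  complex.Re z ^+ 2 + complex.Im z ^+ 2 <= (1 - 2 * omega * h) ^+ 2 ->
  (1 - (1 - 2 * omega * h) ^+ 2) ^+ 3 / 16 * nr x ^+ 2 <=
  ip ((1 - z ^+ 2) *: x) ((1 + z ^+ 2) *: x - (2 * z) *: Bop (4 / h ^+ 2) x).
Proof.
move=> h0 omh; set s := 4 / h ^+ 2; set r := 1 - 2 * omega * h => z x.
case: z => p q /= pq; set n := p ^+ 2 + q ^+ 2 in pq.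
have om0 := omega_gt0; have d0' := d0; have w0' := w0; have Mb0' := Mb0.
have r0 : 0 < r by rewrite /r; lra.
have omh0 : 0 < omega * h by rewrite mulr_gt0.
have r1 : r <= 1 by rewrite /r; lra.
have r21 : r ^+ 2 <= r by rewrite expr2 ler_piMr// ltW.
have n0 : 0 <= n by rewrite /n; pos.
have n1 : n <= 1 by lra.
have hn : omega * h * (1 + n) <= 1 - n.
  have : omega * h * (1 + n) <= omega * h * 2 by apply: ler_wpM2l; [exact: ltW|lra].
  by move: pq r21; rewrite /r; lra.
have Md : 0 <= Mb / d by pos.
have om1 : 2 * Mb <= omega by rewrite /omega; lra.
have om2 : Mb <= omega * d.
  have : Mb / d <= omega by rewrite /omega; lra.
  by rewrite ler_pdivrMr.
have om3 : 16 * w <= omega ^+ 2.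
  have : 16 * w <= omega by rewrite /omega; lra.
  move/le_trans; apply; rewrite expr2 ler_peMl ?(ltW om0)//.
  by rewrite /omega; lra.
have s0 : 0 < s by rewrite divr_gt0 ?exprn_gt0.
have ws : w <= s.
  rewrite /s ler_pdivlMr ?exprn_gt0//.
  have : 16 * (w * h ^+ 2) <= (omega * h) ^+ 2.
    by rewrite exprMn mulrA ler_wpM2r ?sqr_ge0.
  have : (omega * h) ^+ 2 <= 4^-1 ^+ 2 by apply: lerXn2r; rewrite ?nnegrE ?(ltW omh0).
  by lra.
pose y := s *r Rs s x; pose X := j y; pose W := x - X.
have XE : Jop s x = X by rewrite /X /y (linZ j).
have aW : inner W X = (s^-1)%:C%C * a y y.
  have ay v : a y v = inner (s *r W) (j v).
    move: v; apply/(al_inner aZr) => v.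
    by rewrite /y alZl// (al_res RsP)// ipZl /W /X /y (linZ j).
  by rewrite ay innerZl mulrA -rmorphM mulVf ?gt_eqF// rmorph1 mul1r.
have k4 : s^-1 = h ^+ 2 / 4 by rewrite /s invf_div.
have cZ (b c : R) (v : H) : (b +i* c)%C *: v = b *r v + c *r ('i%C *: v).
  by rewrite [in LHS](complexE (b +i* c)%C) scalerDl mulrC -scalerA.
pose kr := ip W X; pose ki := ip W ('i%C *: X).
have kE : (kr +i* ki)%C = (s^-1)%:C%C * a y y by rewrite -aW innerE.
have krE : kr = s^-1 * complex.Re (a y y).
  by have := congr1 (@complex.Re R) kE; case: (a y y) => ? ? /= ->; rewrite mul0r subr0.
have kiE : ki = s^-1 * complex.Im (a y y).
  by have := congr1 (@complex.Im R) kE; case: (a y y) => ? ? /= ->; rewrite mul0r addr0.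
have ipE : ip ((1 - (p +i* q)%C ^+ 2) *: x)
    ((1 + (p +i* q)%C ^+ 2) *: x - (2 * (p +i* q)%C) *: Bop s x) =
  (1 - n) * (((1 - p) ^+ 2 + q ^+ 2) * nr X ^+ 2 + ((1 + p) ^+ 2 + q ^+ 2) * nr W ^+ 2 +
    2 * (1 + n) * kr) - 4 * (1 + n) * (q * ki).
  have xE : x = X + W by rewrite /W addrC subrK.
  have BE : Bop s x = X - W.
    by rewrite /Bop XE /W; apply: ip_ext => t; rewrite !ipE; ring.
  have -> : 1 - (p +i* q)%C ^+ 2 = ((1 - p ^+ 2 + q ^+ 2) +i* (- (2 * p * q)))%C.
    by rewrite expr2; simpc; congr (_ +i* _)%C; ring.
  have -> : 1 + (p +i* q)%C ^+ 2 = ((1 + p ^+ 2 - q ^+ 2) +i* (2 * p * q))%C.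
    by rewrite expr2; simpc; congr (_ +i* _)%C; ring.
  have -> : 2 * (p +i* q)%C = ((2 * p) +i* (2 * q))%C.
    by rewrite mulr_natl mulr2n; simpc; congr (_ +i* _)%C; ring.
  have iWX : ip W ('i%C *: X) = ki by [].
  have krE' : ip W X = kr by [].
  rewrite BE xE /n; clearbody kr ki; clear -cZ iWX krE'; clearbody W X.
  have UU : ip (X + W) ('i%C *: (X + W)) = 0.
    by have := ip_iN (X + W) (X + W); rewrite ipC; lra.
  have UV : ip (X + W) (X - W) = nr X ^+ 2 - nr W ^+ 2.
    by rewrite -!ip_nr !ipE (ipC X W); ring.
  have UiV : ip (X + W) ('i%C *: (X - W)) = 2 * ki.
    have XX (v : H) : ip v ('i%C *: v) = 0 by have := ip_iN v v; rewrite ipC; lra.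
    have iXW : ip X ('i%C *: W) = - ki by rewrite -[LHS]opprK -ip_iN ipC iWX.
    by rewrite scalerBr !ipE !XX iXW iWX; ring.
  have gen (e f g b l m : R) : ip (e *r (X + W) + f *r ('i%C *: (X + W)))
      (g *r (X + W) + b *r ('i%C *: (X + W)) - (l *r (X - W) + m *r ('i%C *: (X - W)))) =
      (e * g + f * b) * (nr X ^+ 2 + 2 * kr + nr W ^+ 2)
      - (e * l + f * m) * (nr X ^+ 2 - nr W ^+ 2) - (e * m - f * l) * (2 * ki).
    have E : nr X ^+ 2 + 2 * kr + nr W ^+ 2 = ip (X + W) (X + W).
      by rewrite ip_nr nrD2 (ipC X W) krE'.
    move: UU UV UiV E; move: (X + W) (X - W) => U Z UU UV UiV ->.
    by rewrite !ipDl !ipDr !ipNr !ipDr !ipZl !ipZr ipii ipii !ip_iN UU UV UiV; ring.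
  rewrite (cZ (1 - p ^+ 2 + q ^+ 2)) (cZ (1 + p ^+ 2 - q ^+ 2)) (cZ (2 * p)).
  by rewrite gen; ring.
rewrite ipE.
have X0 := nr_ge0 X; have v0 := nr_ge0 y.
have kr_ge : h ^+ 2 / 4 * (d * nr y ^+ 2 - w * nr X ^+ 2) <= kr.
  rewrite krE k4 ler_wpM2l//; first by pos.
  by have := al_ge y; rewrite -/(al a y y) -/X; lra.
have ki_le : ki ^+ 2 <= (h ^+ 2 / 4 * (Mb * nr X * nr y)) ^+ 2.
  by rewrite kiE k4 !exprMn -!exprMn [leLHS]exprMn [leRHS]exprMn ler_wpM2l ?sqr_ge0 ?Im_le.
have := @parabola_ge _ p q n h d w Mb omega (nr X) (nr W) (nr y) kr ki (erefl n) n1 h0 d0 w0 Mb0 om1 om2 om3 om0 hn X0 v0 kr_ge ki_le.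
apply: le_trans.
have x2 : nr x ^+ 2 <= 2 * (nr X ^+ 2 + nr W ^+ 2).
  have -> : x = X + W by rewrite /W addrC subrK.
  have : nr (X + W) ^+ 2 <= (nr X + nr W) ^+ 2.
    by apply: lerXn2r; rewrite ?nnegrE ?addr_ge0 ?nr_ge0// ler_nrD.
  by have := sqr_ge0 (nr X - nr W); lra.
have nr3 : (1 - r ^+ 2) ^+ 3 <= (1 - n) ^+ 3.
  by apply: lerXn2r; rewrite ?nnegrE; lra.
have r3 : 0 <= (1 - r ^+ 2) ^+ 3 by apply: exprn_ge0; lra.
have XW : 0 <= nr X ^+ 2 + nr W ^+ 2 by pos.
have := ler_wpM2l r3 x2; have := ler_wpM2r XW nr3; lra.
Qed.

Lemma Bop_le (h : R) x : 0 < h -> omega * h <= 4^-1 -> nr (Bop (4 / h ^+ 2) x) <= 5 * nr x.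
Proof.
move=> h0 omh; have om0 := omega_gt0; have w0' := w0.
have s0 : 0 < 4 / h ^+ 2 by rewrite divr_gt0 ?exprn_gt0.
have ws : 2 * w <= 4 / h ^+ 2.
  rewrite ler_pdivlMr ?exprn_gt0//.
  have Md : 0 <= Mb / d by have d0' := d0; have Mb0' := Mb0; pos.
  have Mb0' := Mb0.
  have om1 : 16 * w <= omega ^+ 2.
    have : 16 * w <= omega by rewrite /omega; lra.
    move/le_trans; apply; rewrite expr2 ler_peMl ?(ltW om0)//.
    by rewrite /omega; lra.
  have : 16 * (w * h ^+ 2) <= (omega * h) ^+ 2.
    by rewrite exprMn mulrA ler_wpM2r ?sqr_ge0.
  have : (omega * h) ^+ 2 <= 4^-1 ^+ 2.
    by apply: lerXn2r; rewrite ?nnegrE ?invr_ge0//; pos.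
  by lra.
apply: (le_trans (ler_nrBD _ _)); rewrite nrZr ger0_norm//.
by have := Jop_le x ws s0; lra.
Qed.

(** The bound of [chebyshev_le] depends on the radius alone, neither on the norm bound 5 nor on the
    positivity constant, which is of order [h^3]. Since [(1 - 2 * omega * h) ^+ n] is at least
    [expR (- 4 * omega * h * n)], the estimate is uniform in the mesh at fixed time [h * n]. *)
Lemma chT_Bop_le (h : R) n x : 0 < h -> omega * h <= 4^-1 ->
  nr (chT (Bop (4 / h ^+ 2)) n x) <= expR (4 * omega * (h * n%:R)) * nr x.
Proof.
move=> h0 omh; have om0 := omega_gt0.
have omh0 : 0 < omega * h by rewrite mulr_gt0.
set r := 1 - 2 * omega * h.
have r0 : 0 < r by rewrite /r; lra.
have r1 : r <= 1 by rewrite /r; lra.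
have eta0 : 0 < (1 - r ^+ 2) ^+ 3 / 16.
  rewrite divr_gt0// exprn_gt0// subr_gt0 exprn_ilt1//; first exact: ltW.
  by rewrite /r; lra.
have := @chebyshev_le _ _ (Bop (4 / h ^+ 2)) r _ 5 r0 r1 eta0 (ler0n _ 5)
  (fun x => Bop_le x h0 omh) (Bop_positive h0 omh) n x.
have e0 := expR_ge0 (4 * omega * (h * n%:R)).
move/(ler_wpM2l e0); apply: le_trans.
have t0 : 0 <= 2 * omega * h by lra.
have t1 : 2 * omega * h <= 2^-1 by lra.
have := expR_ge_inv n t0 t1.
rewrite (_ : 2 * (2 * omega * h) * n%:R = 4 * omega * (h * n%:R)); last by ring.
by rewrite -/r => /(ler_wpM2r (nr_ge0 (chT (Bop (4 / h ^+ 2)) n x))); lra.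
Qed.

End discrete_bound.

(** Variation of constants for the Chebyshev recurrence, whose fundamental solution is [chU B]. *)
Lemma duhamel {R : realType} {H : hilbertType R} (B : {linear H -> H}) (D f : nat -> H) :
  D 0%N = 0 -> D 1%N = f 0%N ->
  (forall n, D n.+2 = 2 *r B (D n.+1) - D n + f n.+1) ->
  forall n, D n = \sum_(i < n) chU B (n - i.+1) (f i).
Proof.
move=> D0 D1 DS; elim/nat_ind2 => [||n IH0 IH1]; first by rewrite big_ord0.
  by rewrite big_ord_recl big_ord0 addr0.
rewrite DS IH1 IH0 big_ord_recr [in RHS]big_ord_recr [in RHS]big_ord_recr/=.
rewrite !subnn subSnn linearD scalerDr linear_sum scaler_sumr /= [X in X + _]addrAC -sumrB.
rewrite -!addrA; congr (_ + _); apply: eq_bigr => i _.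
have -> : (n.+1 - i.+1 = (n - i.+1).+1)%N by have := ltn_ord i; lia.
have -> : (n.+2 - i.+1 = (n - i.+1).+2)%N by have := ltn_ord i; lia.
by [].
Qed.

(** * Construction of a cosine function by halving the mesh *)

Section cosine.
Context {R : realType} {H : hilbertType R}.
Variables (A : set (H * H)) (J : R -> {linear H -> H}) (s0 c h0 : R).
Hypothesis s00 : 0 < s0.
Hypothesis J_le : forall s x, s0 <= s -> nr (J s x) <= 2 * nr x.
Hypothesis J_A : forall s x y, s0 <= s -> A (x, y) <-> x = J s (x + s^-1 *r y).
Hypothesis J_comm : forall s t x, s0 <= s -> s0 <= t -> J s (J t x) = J t (J s x).
Hypothesis J_cvg : forall x (e : R), 0 < e ->
  exists2 S, s0 <= S & forall s, S <= s -> nr (x - J s x) < e.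
Hypothesis c0 : 0 <= c.
Hypothesis h00 : 0 < h0.
Hypothesis h0s : s0 <= 4 / h0 ^+ 2.

Definition mesh m : R := h0 / 2 ^+ m.

Variable B : nat -> {linear H -> H}.
Hypothesis BE : forall m x, B m x = 2 *r J (4 / mesh m ^+ 2) x - x.

Notation K t := (expR (c * t)).

Hypothesis T_le : forall m n x, nr (chT (B m) n x) <= K (mesh m * n%:R) * nr x.

Lemma mesh_gt0 m : 0 < mesh m.
Proof. by rewrite divr_gt0// exprn_gt0. Qed.

Lemma meshS m : mesh m.+1 = mesh m / 2.
Proof. by rewrite /mesh exprS; field; rewrite expf_neq0. Qed.

Lemma mesh_le m : mesh m <= h0.
Proof.
rewrite /mesh ler_pdivrMr ?exprn_gt0// ler_peMr ?(ltW h00)//.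
by rewrite exprn_ege1// ler1n.
Qed.

Lemma s0_le m : s0 <= 4 / mesh m ^+ 2.
Proof.
apply: le_trans h0s _; rewrite ler_pM2l// lef_pV2 ?posrE ?exprn_gt0 ?mesh_gt0//.
by apply: lerXn2r; rewrite ?nnegrE ?mesh_le// ltW ?mesh_gt0.
Qed.

Lemma K_le (s t : R) : s <= t -> K s <= K t.
Proof. by move=> st; rewrite ler_expR ler_wpM2l. Qed.

Lemma K_ge1 (t : R) : 0 <= t -> 1 <= K t.
Proof. by move=> t0; rewrite -expR0 ler_expR mulr_ge0. Qed.

Lemma J_dom s x y : s0 <= s -> A (x, y) -> J s x = x - s^-1 *r J s y.
Proof.
move=> ss /(J_A _ _ ss) h; rewrite [in RHS]h linearD (linZ (J s)).
by rewrite addrK.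
Qed.

Lemma A_comm (F : {linear H -> H}) x y :
  (forall s z, s0 <= s -> F (J s z) = J s (F z)) -> A (x, y) -> A (F x, F y).
Proof.
move=> FJ /(J_A _ _ (lexx s0)) h; apply/(J_A _ _ (lexx s0)).
by rewrite {1}h FJ// linearD (linZ F).
Qed.

Lemma J_ran s x : s0 <= s -> A (J s x, s *r (x - J s x)).
Proof.
move=> ss; apply/(J_A _ _ ss); rewrite rsA mulVf ?gt_eqF ?(lt_le_trans s00 ss)//.
by rewrite rs1 addrC subrK.
Qed.

Lemma B_J m s z : s0 <= s -> B m (J s z) = J s (B m z).
Proof.
by move=> ss; rewrite !BE linearB (linZ (J s)) J_comm// s0_le.
Qed.

Lemma T_J m n s z : s0 <= s -> chT (B m) n (J s z) = J s (chT (B m) n z).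
Proof. by move=> ss; apply: chT_comm => y; exact: B_J. Qed.

Lemma B_B m m' z : B m (B m' z) = B m' (B m z).
Proof. by rewrite [B m' z]BE linearB (linZ (B m)) B_J ?s0_le// [RHS]BE. Qed.

Lemma T_T m m' n n' z : chT (B m) n (chT (B m') n' z) = chT (B m') n' (chT (B m) n z).
Proof. by apply: chT_comm => y /=; rewrite chT_comm// => ?; rewrite B_B. Qed.

Definition dom2 x := exists y z, A (x, y) /\ A (y, z).

Lemma dom2_dense x (e : R) : 0 < e -> exists2 x', dom2 x' & nr (x - x') < e.
Proof.
move=> e0; have [|S Ss hS] := @J_cvg x (e / 3); first by rewrite divr_gt0.
exists (J S (J S x)).
  exists (J S (S *r (x - J S x))), (S *r ((S *r (x - J S x)) - J S (S *r (x - J S x)))).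
  split; last exact: J_ran.
  by apply: A_comm => [s z ss|]; [rewrite J_comm|exact: J_ran].
have := ler_nr3 (J S x) x (J S (J S x)); rewrite -linearB.
have := J_le (x - J S x) Ss; have := hS S (lexx S); lra.
Qed.

Lemma step_consistent m x y z : A (x, y) -> A (y, z) ->
  nr (B m x - chT (B m.+1) 2 x) <= mesh m ^+ 4 / 2 * nr z.
Proof.
move=> xy yz; set k := mesh m ^+ 2 / 4.
have h0' := mesh_gt0 m.
have k0 : 0 <= k by rewrite /k; pos.
have sm := s0_le m; have sm1 := s0_le m.+1.
set s := 4 / mesh m ^+ 2 in sm; set s1 := 4 / mesh m.+1 ^+ 2 in sm1.
have sk : s^-1 = k by rewrite /s invf_div.
have s1k : s1^-1 = k / 4 by rewrite /s1 invf_div meshS /k; field.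
have E : B m x - chT (B m.+1) 2 x =
    (2 * k ^+ 2) *r (J s z - 4^-1 *r J s1 z - 4^-1 *r J s1 (J s1 z)).
  rewrite /= !BE -/s -/s1 !linearB !(linZ (J s1)).
  rewrite (J_dom sm xy) (J_dom sm yz) (J_dom sm1 xy) !linearB !(linZ (J s1)).
  rewrite (J_dom sm1 xy) (J_dom sm1 yz) !linearB !(linZ (J s1)) (J_dom sm1 yz) sk s1k.
  by apply: ip_ext => t; rewrite !ipE; field.
rewrite E nrZr ger0_norm; last by pos.
have h1 := J_le z sm; have h2 := J_le z sm1; have h3 := J_le (J s1 z) sm1.
have q0 : 0 <= 4^-1 :> R by [].
have h4 := ler_nrBD (J s z - 4^-1 *r J s1 z) (4^-1 *r J s1 (J s1 z)).
have h5 := ler_nrBD (J s z) (4^-1 *r J s1 z).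
rewrite !nrZr !ger0_norm// in h4 h5.
have -> : mesh m ^+ 4 / 2 * nr z = 2 * k ^+ 2 * (4 * nr z) by rewrite /k; field.
apply: ler_wpM2l; first by pos.
by have := nr_ge0 z; lra.
Qed.

(** Duhamel for the difference of the two iterations: [n] forcing terms of order [mesh ^+ 4], each
    amplified by a [chU] of order [n], add up to order [(n * mesh) ^+ 2 * mesh ^+ 2]. *)
Lemma step_le m n x y z (t : R) : A (x, y) -> A (y, z) -> mesh m * n%:R <= t ->
  nr (chT (B m) n x - chT (B m.+1) n.*2 x) <= K t ^+ 2 * t ^+ 2 * mesh m ^+ 2 * nr z.
Proof.
move=> xy yz nt; have t0 : 0 <= t by apply: le_trans nt; rewrite mulr_ge0// ltW ?mesh_gt0.
have KK := K_ge1 t0; set k := K t in KK *.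
pose B2 : {linear H -> H} := chT (B m.+1) 2.
have TB2 i u : chT B2 i u = chT (B m.+1) i.*2 u by exact: chT_comp.
pose g u := B m u - B2 u.
(* The first step of the recurrence is [T_1 = B], without the factor 2 of the later ones. *)
pose f i := (if i is 0 then 1 else 2) *r chT B2 i (g x).
have gT i : g (chT B2 i x) = chT B2 i (g x).
  have -> : chT B2 i (g x) = chT B2 i (B m x) - chT B2 i (B2 x) by rewrite -linearB.
  rewrite chT_commB; congr (_ - _); apply: esym.
  apply: chT_comm => u; change (chT (B m.+1) 2 (B m u) = B m (chT (B m.+1) 2 u)).
  by apply: chT_comm => v; exact: B_B.
have := @duhamel _ _ (B m) (fun i => chT (B m) i x - chT B2 i x) f _ _ _ n.
rewrite -TB2 => -> //; first last.
- move=> i; have -> : f i.+1 = 2 *r g (chT B2 i.+1 x) by rewrite gT.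
  rewrite !chTSS (linearB (B m)) /g; move: (chT B2 i.+1 x) (chT (B m) i.+1 x) => u v.
  by apply: ip_ext => p; rewrite !ipE; ring.
- by rewrite /f rs1.
- by rewrite subrr.
have gx : nr (g x) <= mesh m ^+ 4 / 2 * nr z by exact: step_consistent xy yz.
have fi i : (i < n)%N -> nr (chU (B m) (n - i.+1) (f i)) <= n%:R * (k ^+ 2 * (mesh m ^+ 4 * nr z)).
  move=> ni.
  have fb : nr (f i) <= k * (mesh m ^+ 4 * nr z).
    have : nr (f i) <= 2 * nr (chT B2 i (g x)).
      by rewrite /f nrZr; case: (i) => [|i']; rewrite ger0_norm// ler_wpM2r ?nr_ge0// ler1n.
    move/le_trans; apply; rewrite TB2.
    have : nr (chT (B m.+1) i.*2 (g x)) <= k * nr (g x).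
      apply: (le_trans (T_le _ _ _)); rewrite ler_wpM2r ?nr_ge0// K_le//.
      apply: le_trans nt; have -> : mesh m.+1 * i.*2%:R = mesh m * i%:R.
        by rewrite meshS -muln2 natrM; field.
      by rewrite ler_pM2l ?mesh_gt0// ler_nat ltnW.
    have : k * nr (g x) <= k * (mesh m ^+ 4 / 2 * nr z) by rewrite ler_wpM2l// ltW// (lt_le_trans ltr01).
    by lra.
  have := @chU_le _ _ (B m) (n - i.+1) (f i) (k * nr (f i)) _ _.
  rewrite mulr_ge0 ?nr_ge0 ?(le_trans ler01)// => /(_ isT) h.
  apply: le_trans (h _) _.
    move=> l li; apply: (le_trans (T_le _ _ _)); rewrite ler_wpM2r ?nr_ge0// K_le//.
    by apply: le_trans nt; rewrite ler_pM2l ?mesh_gt0// ler_nat; move: ni li; clear; lia.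
  apply: ler_pM => //; first by rewrite mulr_ge0 ?nr_ge0 ?(le_trans ler01).
    by rewrite ler_nat; move: ni; clear; lia.
  by rewrite expr2 -mulrA ler_wpM2l// (le_trans ler01).
have nrs : forall p (F : 'I_p -> H), nr (\sum_(i < p) F i) <= \sum_(i < p) nr (F i).
  move=> p F; elim/big_ind2: _ => [|a b a' b' h1 h2|//]; first by rewrite nr0.
  by apply: (le_trans (ler_nrD _ _)); exact: lerD.
apply: (le_trans (nrs _ _)).
apply: (@le_trans _ _ (\sum_(i < n) n%:R * (k ^+ 2 * (mesh m ^+ 4 * nr z)))).
  by apply: ler_sum => i _; apply: fi.
rewrite sumr_const card_ord -[leLHS]mulr_natl.
have -> : n%:R * (n%:R * (k ^+ 2 * (mesh m ^+ 4 * nr z))) =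
  (mesh m * n%:R) ^+ 2 * (k ^+ 2 * mesh m ^+ 2 * nr z) by ring.
have -> : k ^+ 2 * t ^+ 2 * mesh m ^+ 2 * nr z = t ^+ 2 * (k ^+ 2 * mesh m ^+ 2 * nr z) by ring.
have hm := mesh_gt0 m.
apply: ler_wpM2r; first by pos.
by apply: lerXn2r; rewrite ?nnegrE// mulr_ge0// ltW.
Qed.

(** Second differences of [T_n x] are [2 T_(n+1) (B - 1) x], of order [mesh ^+ 2]. They add up to a
    first difference of order [n * mesh ^+ 2], so [T_n x] is Lipschitz in the time [n * mesh]. *)
Lemma lip1 m n x y : A (x, y) ->
  nr (chT (B m) n.+1 x - chT (B m) n x) <=
  (2 * n%:R + 1) * mesh m ^+ 2 * K (mesh m * n%:R) * nr y.
Proof.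
move=> xy; have h0' := mesh_gt0 m; set k := mesh m ^+ 2 / 4.
have k0 : 0 <= k by rewrite /k; pos.
have B1 : nr (B m x - x) <= mesh m ^+ 2 * nr y.
  have -> : B m x - x = (- (2 * k)) *r J (4 / mesh m ^+ 2) y.
    rewrite BE (J_dom (s0_le m) xy) invf_div -/k.
    by apply: ip_ext => v; rewrite !ipE; ring.
  rewrite nrZr normrN ger0_norm; last by pos.
  by have := ler_wpM2l k0 (J_le y (s0_le m)); rewrite /k; lra.
elim: n => [|n IH].
  by rewrite /= mulr0 add0r mul1r mulr0 mulr0 expR0 mulr1.
have K1 := T_le m n.+1 (B m x - x).
have -> : chT (B m) n.+2 x - chT (B m) n.+1 x =
    (chT (B m) n.+1 x - chT (B m) n x) + 2 *r chT (B m) n.+1 (B m x - x).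
  have -> : chT (B m) n.+1 (B m x - x) = B m (chT (B m) n.+1 x) - chT (B m) n.+1 x.
    by rewrite -chT_commB -linearB.
  by rewrite chTSS; apply: ip_ext => v; rewrite !ipE; ring.
apply: (le_trans (ler_nrD _ _)); rewrite nrZr ger0_norm//.
have Kn : K (mesh m * n%:R) <= K (mesh m * n.+1%:R).
  by rewrite K_le// ler_pM2l// ler_nat.
set K' := K (mesh m * n.+1%:R) in K1 Kn *.
have K'0 : 0 <= K' by exact: expR_ge0.
have h1 : nr (chT (B m) n.+1 x - chT (B m) n x) <= (2 * n%:R + 1) * mesh m ^+ 2 * K' * nr y.
  apply: le_trans IH _; rewrite ler_wpM2r ?nr_ge0// ler_wpM2l//.
  by have : 0 <= n%:R :> R by []; move=> ?; pos.
have h2 := ler_wpM2l K'0 B1.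
by rewrite -natr1; lra.
Qed.

Lemma lip m n i x y (t : R) : A (x, y) -> mesh m * (n + i)%:R <= t ->
  nr (chT (B m) (n + i) x - chT (B m) n x) <=
  mesh m * i%:R * ((2 * t + h0) * K t * nr y).
Proof.
move=> xy; have h0' := mesh_gt0 m; elim: i => [|i IH] nt.
  by rewrite addn0 subrr nr0 !mulr0 mul0r.
have nt' : mesh m * (n + i)%:R <= t.
  by apply: le_trans nt; rewrite ler_pM2l// ler_nat addnS.
rewrite addnS; apply: (le_trans (ler_nr3 (chT (B m) (n + i) x) _ _)).
have h1 := lip1 m (n + i) xy; have h2 := IH nt'.
have h3 : (2 * (n + i)%:R + 1) * mesh m ^+ 2 * K (mesh m * (n + i)%:R) * nr y <=
    mesh m * ((2 * t + h0) * K t * nr y).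
  have -> : (2 * (n + i)%:R + 1) * mesh m ^+ 2 * K (mesh m * (n + i)%:R) * nr y =
    mesh m * ((2 * (mesh m * (n + i)%:R) + mesh m) * K (mesh m * (n + i)%:R) * nr y) by ring.
  rewrite ler_pM2l//; apply: ler_wpM2r; first exact: nr_ge0.
  have hn0 : 0 <= mesh m * (n + i)%:R by rewrite mulr_ge0// ltW.
  apply: ler_pM; rewrite ?expR_ge0 ?K_le//; first by pos.
  by have := mesh_le m; lra.
rewrite -[i.+1]addn1 natrD; lra.
Qed.

#[local] Hint Resolve mesh_gt0 mesh_le s0_le K_le K_ge1 : core.

Lemma meshE m : mesh m = h0 * 2^-1 ^+ m.
Proof. by rewrite /mesh exprVn. Qed.

Lemma mesh_small (e : R) : 0 < e -> exists M, forall m, (M <= m)%N -> mesh m < e.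
Proof.
move=> e0; have [|||M hM] := @expr_small _ 2^-1 (e / h0).
- by rewrite invr_ge0.
- by rewrite invf_lt1// ltr1n.
- exact: divr_gt0.
exists M => m Mm; rewrite meshE mulrC -ltr_pdivlMr//; apply: le_lt_trans hM.
by apply: ler_wiXn2l => //; rewrite ?invr_ge0// invf_le1// ler1n.
Qed.

Definition nsteps m (t : R) : nat := Num.truncn (t / mesh m).

Lemma nsteps_le m t : 0 <= t -> mesh m * (nsteps m t)%:R <= t.
Proof.
by move=> t0; rewrite mulrC -ler_pdivlMr// truncn_le divr_ge0// ltW.
Qed.

Lemma nsteps_gt m t : t < mesh m * (nsteps m t)%:R + mesh m.
Proof.
rewrite -{2}(mulr1 (mesh m)) -mulrDr natr1 mulrC -ltr_pdivrMr//.
exact: truncnS_gt.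
Qed.

Lemma nsteps0 m : nsteps m 0 = 0%N.
Proof. by rewrite /nsteps mul0r truncn0. Qed.

Lemma nstepsS m t : 0 <= t -> exists2 i, (i <= 1)%N & nsteps m.+1 t = ((nsteps m t).*2 + i)%N.
Proof.
move=> t0; have h0' := mesh_gt0 m.
have h1 := nsteps_le m t0; have h2 := nsteps_gt m t.
have h3 := nsteps_le m.+1 t0; have h4 := nsteps_gt m.+1 t.
have hS : mesh m = 2 * mesh m.+1 by rewrite meshS; field.
have hS0 := mesh_gt0 m.+1.
have le1 : ((nsteps m t).*2 <= nsteps m.+1 t)%N.
  rewrite -ltnS -(ltr_nat R) -natr1 -muln2 natrM -(ltr_pM2l hS0).
  by move: h1 h4; rewrite hS; move: (nsteps m t)%:R (nsteps m.+1 t)%:R => p q; lra.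
have le2 : (nsteps m.+1 t < (nsteps m t).*2.+2)%N.
  rewrite -(ltr_nat R) -2!natr1 -muln2 natrM -(ltr_pM2l hS0).
  by move: h2 h3; rewrite hS; move: (nsteps m t)%:R (nsteps m.+1 t)%:R => p q; lra.
exists (nsteps m.+1 t - (nsteps m t).*2)%N; move: le1 le2; clear;
  move: (nsteps m t) (nsteps m.+1 t) => p q; lia.
Qed.

Lemma nr_T m n x (t : R) : mesh m * n%:R <= t -> nr (chT (B m) n x) <= K t * nr x.
Proof.
by move=> nt; apply: (le_trans (T_le _ _ _)); rewrite ler_wpM2r ?nr_ge0// K_le.
Qed.

(** On [dom2], refining the mesh costs order [mesh ^+ 2] by [step_le], plus at most one extra step,
    of order [mesh] by [lip], because [nsteps] need not double exactly. Both are geometric in [m];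
    stability and density extend the limit to all [x]. *)
Lemma T_cvg t x : 0 <= t -> exists l, hcvg (fun m => chT (B m) (nsteps m t) x) l.
Proof.
move=> t0; have KK := K_ge1 t0.
have h0' := h00.
have d2 x' : dom2 x' -> exists l, hcvg (fun m => chT (B m) (nsteps m t) x') l.
  move=> [y [z [xy yz]]].
  pose C1 := (2 * t + h0) * K t * nr y; pose C2 := K t ^+ 2 * t ^+ 2 * nr z.
  have K0 : 0 <= K t by exact: expR_ge0.
  have C10 : 0 <= C1 by rewrite /C1; pos.
  have C20 : 0 <= C2 by rewrite /C2; pos.
  apply: (@geometric_hcvg _ _ _ (C1 * h0 + C2 * h0 ^+ 2) 2^-1).
  - by rewrite invr_ge0.
  - by rewrite invf_lt1// ltr1n.
  move=> m; have [i i1 nE] := nstepsS m t0.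
  have h1 : mesh m.+1 * ((nsteps m t).*2 + i)%:R <= t by rewrite -nE nsteps_le.
  have h2 := lip xy h1.
  have h3 := step_le xy yz (nsteps_le m t0).
  rewrite nE; apply: (le_trans (ler_nr3 (chT (B m.+1) (nsteps m t).*2 x') _ _)).
  rewrite (nrB (chT _ _ _) (chT (B m) _ _)).
  apply: (le_trans (lerD h2 h3)).
  have q0 : 0 < 2^-1 ^+ m :> R by rewrite exprn_gt0// invr_gt0.
  have q1 : 2^-1 ^+ m <= 1 :> R by rewrite exprn_ile1 ?invr_ge0// invf_le1// ler1n.
  rewrite [leRHS]mulrDl; apply: lerD.
    rewrite -/C1 -[leRHS]mulrA [leRHS]mulrC; apply: ler_wpM2r => //.
    rewrite meshS meshE; have : h0 * 2^-1 ^+ m / 2 * i%:R <= h0 * 2^-1 ^+ m / 2 * 1.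
      by rewrite ler_wpM2l ?lern1//; pos.
    have h5 : 0 <= h0 * 2^-1 ^+ m by pos.
    move=> h6; apply: (le_trans h6); move: h5; move: (h0 * _) => p; lra.
  have -> : K t ^+ 2 * t ^+ 2 * mesh m ^+ 2 * nr z = C2 * mesh m ^+ 2 by rewrite /C2; ring.
  rewrite -[leRHS]mulrA; apply: ler_wpM2l => //.
  by rewrite meshE exprMn ler_pM2l ?exprn_gt0// expr2 ler_piMr// ltW.
apply: cauchy_hcvg => e e0.
have K0 : 0 < K t by exact: expR_gt0.
have [|x' x'2 xx'] := @dom2_dense x (e / (4 * K t)); first by rewrite divr_gt0// mulr_gt0.
have [l hl] := d2 _ x'2.
have [|M hM] := hl (e / 4); first by rewrite divr_gt0.
have tail m : nr (chT (B m) (nsteps m t) x - chT (B m) (nsteps m t) x') < e / 4.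
  rewrite -linearB; apply: (le_lt_trans (nr_T _ (nsteps_le m t0))).
  move: xx'; rewrite ltr_pdivlMr ?mulr_gt0//; lra.
exists M => m n Mm Mn.
set a := chT _ _ x; set b := chT _ _ x.
have := ler_nr3 l a b; have := ler_nr3 (chT (B m) (nsteps m t) x') a l.
have := ler_nr3 (chT (B n) (nsteps n t) x') l b.
have := tail m; have := tail n; have := hM _ Mm; have := hM _ Mn.
rewrite -/a -/b (nrB l (chT (B n) _ _)) (nrB (chT (B n) _ _) b); lra.
Qed.

(** Step counts [nsteps] are not additive in [t]. Counts within a bounded distance of [t / mesh m]
    are stable under sums and differences, and lead to the same limit ([T_approx]). *)
Definition approx (t : R) (N : nat -> nat) := exists C : R, 0 <= C /\ forall m,
  mesh m * (N m)%:R <= t + C * mesh m /\ t <= mesh m * (N m)%:R + C * mesh m.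

Lemma approx_nsteps t : 0 <= t -> approx t (nsteps ^~ t).
Proof.
move=> t0; exists 1; split=> // m; rewrite mul1r; split.
  by apply: (le_trans (nsteps_le m t0)); rewrite lerDl ltW.
exact/ltW/nsteps_gt.
Qed.

Lemma T_approx t N x l : 0 <= t -> approx t N ->
  hcvg (fun m => chT (B m) (nsteps m t) x) l -> hcvg (fun m => chT (B m) (N m) x) l.
Proof.
move=> t0 [C [C0 hN]] hl; apply: (hcvg_dist hl) => e e0.
pose t' := t + C * h0; have t't : t <= t' by rewrite lerDl mulr_ge0// ltW.
have h0' := h00.
have Nt m : mesh m * (N m)%:R <= t'.
  by apply: le_trans (hN m).1 _; rewrite lerD2l ler_wpM2l.
have nt m : mesh m * (nsteps m t)%:R <= t' by apply: (le_trans (nsteps_le m t0)).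
have K0 : 0 < K t' by exact: expR_gt0.
have [|x' [y [z [xy yz]]] xx'] := @dom2_dense x (e / (4 * K t')).
  by rewrite divr_gt0// mulr_gt0.
pose D := (C + 1) * ((2 * t' + h0) * K t' * nr y) + 1.
have D0 : 0 < D.
  have : 0 <= (C + 1) * ((2 * t' + h0) * K t' * nr y).
    have : 0 <= t' by lra.
    by move=> ?; pos.
  rewrite /D; lra.
have [|M hM] := @mesh_small (e / 2 / D); first by rewrite !divr_gt0.
exists M => m /hM; rewrite ltr_pdivlMr// => hm.
have hm0 := mesh_gt0 m.
have tail n : mesh m * n%:R <= t' -> nr (chT (B m) n (x - x')) < e / 4.
  move=> hn; apply: (le_lt_trans (nr_T _ hn)).
  by move: xx'; rewrite ltr_pdivlMr ?mulr_gt0//; lra.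
have E0 : 0 <= (2 * t' + h0) * K t' * nr y.
  have : 0 <= t' by lra.
  by move=> ?; pos.
have mid : nr (chT (B m) (N m) x' - chT (B m) (nsteps m t) x') <= mesh m * (C + 1) * ((2 * t' + h0) * K t' * nr y).
  have [h1 h2] := hN m; have h3 := nsteps_le m t0; have h4 := nsteps_gt m t.
  have [le|/ltnW le] := leqP (nsteps m t) (N m).
    have [i iE] : exists i, N m = (nsteps m t + i)%N by exists (N m - nsteps m t)%N; rewrite subnKC.
    have := @lip m (nsteps m t) i x' y t' xy; rewrite -iE => /(_ (Nt m)) h.
    apply: (le_trans h); apply: ler_wpM2r => //.
    by move: h1; rewrite iE natrD; lra.
  have [i iE] : exists i, nsteps m t = (N m + i)%N by exists (nsteps m t - N m)%N; rewrite subnKC.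
  have := @lip m (N m) i x' y t' xy; rewrite -iE => /(_ (nt m)) h.
  rewrite nrB; apply: (le_trans h); apply: ler_wpM2r => //.
  by move: h3; rewrite iE natrD; lra.
have h1 := tail _ (Nt m); have h2 := tail _ (nt m).
rewrite linearB in h1; rewrite linearB in h2.
have := ler_nr3 (chT (B m) (N m) x') (chT (B m) (N m) x) (chT (B m) (nsteps m t) x).
have := ler_nr3 (chT (B m) (nsteps m t) x') (chT (B m) (N m) x') (chT (B m) (nsteps m t) x).
rewrite (nrB (chT (B m) (nsteps m t) x')).
move: hm; rewrite /D mulrDr mulr1 mulrA; lra.
Qed.

Lemma cosine_exists : exists C : R -> {linear H -> H},
  forall t x, hcvg (fun m => chT (B m) (nsteps m `|t|) x) (C t x).
Proof.
suff : forall t : R, exists Ct : {linear H -> H},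
    forall x, hcvg (fun m => chT (B m) (nsteps m `|t|) x) (Ct x).
  by move=> /choice[C hC]; exists C.
move=> t; have [f hf] := choice (fun x => T_cvg x (normr_ge0 t)).
have uq x l : hcvg (fun m => chT (B m) (nsteps m `|t|) x) l -> f x = l.
  exact: hcvg_unique (hf x).
have [F hF] : exists F : {linear H -> H}, F =1 f.
  apply: complex_linear => [x y|b x|x]; apply: uq.
  - by apply: eq_hcvg (hcvgD (hf x) (hf y)) => m; rewrite linearD.
  - by apply: eq_hcvg (hcvgZ _ (hf x)) => m; rewrite linearZ.
  - by apply: eq_hcvg (hcvgZ _ (hf x)) => m; rewrite linearZ.
by exists F => x; rewrite hF.
Qed.

Variable C : R -> {linear H -> H}.
Hypothesis hC : forall t x, hcvg (fun m => chT (B m) (nsteps m `|t|) x) (C t x).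

Lemma C_approx t N x : 0 <= t -> approx t N ->
  hcvg (fun m => chT (B m) (N m) x) (C t x).
Proof. by move=> t0 tN; apply: (T_approx t0 tN); have := hC t x; rewrite ger0_norm. Qed.

Lemma C_abs t x : C `|t| x = C t x.
Proof. by apply: hcvg_unique (hC t x); have := hC `|t| x; rewrite normr_id. Qed.

Lemma C_opp t x : C (- t) x = C t x.
Proof. by rewrite -C_abs normrN C_abs. Qed.

Lemma C_le t x : nr (C t x) <= K `|t| * nr x.
Proof.
by apply: (le_hcvg (N := 0%N) (hC t x)) => m _; apply: nr_T; apply: nsteps_le.
Qed.

Lemma C0 x : C 0 x = x.
Proof.
apply: (@hcvg_unique _ _ (fun m => chT (B m) (nsteps m `|0|) x)); first exact: hC.
by apply: eq_hcvg (hcvg_cst x) => m; rewrite normr0 nsteps0.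
Qed.

Lemma C_J s t x : s0 <= s -> C t (J s x) = J s (C t x).
Proof.
move=> ss; apply: (hcvg_unique (hC t (J s x))).
apply: (@eq_hcvg _ _ (fun m => J s (chT (B m) (nsteps m `|t|) x))) => [m|].
  by rewrite T_J.
apply: (hcvg_lip (c := 2) _ (hC t x)) => u.
by rewrite -linearB; apply: J_le.
Qed.

Lemma approxD s t N N' : approx s N -> approx t N' ->
  approx (s + t) (fun m => (N m + N' m)%N).
Proof.
move=> [c1 [c10 h1]] [c2 [c20 h2]]; exists (c1 + c2); split=> [|m].
  exact: addr_ge0.
by have [a1 a2] := h1 m; have [b1 b2] := h2 m; rewrite natrD; lra.
Qed.

Lemma approxB s t N N' : approx s N -> approx t N' ->
  approx `|s - t| (fun m => (maxn (N m) (N' m) - minn (N m) (N' m))%N).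
Proof.
move=> [c1 [c10 h1]] [c2 [c20 h2]]; exists (c1 + c2); split=> [|m].
  exact: addr_ge0.
have [a1 a2] := h1 m; have [b1 b2] := h2 m; have hm := mesh_gt0 m.
rewrite natrB; last by rewrite geq_min leq_maxl.
case: (leqP (N m) (N' m)) => [|/ltnW]; rewrite -(ler_nat R) -(ler_pM2l hm) mulrBr;
  move: a1 a2 b1 b2; move: (mesh m * _) (mesh m * _) => p q *;
  by case: (ger0P (s - t)) => ?; split; lra.
Qed.

Lemma C_mul s t x : 0 <= s -> 0 <= t ->
  2 *r C s (C t x) = C (s + t) x + C `|s - t| x.
Proof.
move=> sp tp; pose N := nsteps ^~ s; pose N' := nsteps ^~ t.
have aN : approx s N by exact: approx_nsteps.
have aN' : approx t N' by exact: approx_nsteps.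
have h1 := C_approx x (addr_ge0 sp tp) (approxD aN aN').
have h2 := C_approx x (normr_ge0 _) (approxB aN aN').
apply: hcvg_unique (hcvgD h1 h2).
apply: (@eq_hcvg _ _ (fun m => 2 *r chT (B m) (N m) (chT (B m) (N' m) x))) => [m|].
  case: (leqP (N m) (N' m)) => [le|/ltnW le].
    by rewrite T_T (chTM _ _ le) addnC.
  by rewrite (chTM _ _ le).
apply: hcvgZ => e e0.
have K0 : 0 < K s by exact: expR_gt0.
have [|M1 hM1] := C_approx x tp aN' (e := e / (2 * K s)); first by rewrite divr_gt0// mulr_gt0.
have [|M2 hM2] := C_approx (C t x) sp aN (e := e / 2); first by rewrite divr_gt0.
exists (maxn M1 M2) => m; rewrite geq_max => /andP[/hM1 l1 /hM2 l2].
have := ler_nr3 (chT (B m) (N m) (C t x)) (chT (B m) (N m) (chT (B m) (N' m) x)) (C s (C t x)).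
rewrite -linearB => /= l3.
have := @nr_T m (N m) (chT (B m) (N' m) x - C t x) s (nsteps_le m sp).
move: l1; rewrite ltr_pdivlMr ?mulr_gt0//; lra.
Qed.

Lemma C_eq s t x : C (t + s) x + C (t - s) x = 2 *r C t (C s x).
Proof.
rewrite -(C_abs t (C s x)) -(C_abs s x) C_mul// C_abs.
case: (ger0P t) => t0; case: (ger0P s) => ss.
- by [].
- by rewrite opprK addrC.
- by rewrite addrC -[in LHS](C_opp (t - s)) -[in LHS](C_opp (t + s)) opprB opprD addrC [s - t]addrC addrC.
- by rewrite -opprD opprK C_opp -[in LHS](C_opp (t - s)) opprB addrC [s - t]addrC addrC.
Qed.

Lemma C_lip s t x y : A (x, y) -> 0 <= s -> s <= t ->
  nr (C t x - C s x) <= (t - s) * ((2 * t + h0) * K t * nr y).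
Proof.
move=> xy sp st; have tp := le_trans sp st.
have aN := approx_nsteps tp; have aN' := approx_nsteps sp.
have E0 : 0 <= (2 * t + h0) * K t * nr y.
  by have h0' := h00; have : 0 < K t by [exact: expR_gt0]; move=> ?; pos.
set E := (2 * t + h0) * K t * nr y in E0 *.
apply/ler_addgt0Pr => e e0.
have [|M hM] := @mesh_small (e / (E + 1)); first by rewrite divr_gt0// ltr_wpDl.
apply: (le_hcvg (N := M) (hcvgB (C_approx x tp aN) (C_approx x sp aN'))) => m Mm.
pose m' := m; have hm := mesh_gt0 m'.
have le : (nsteps m' s <= nsteps m' t)%N.
  by apply: le_truncn; rewrite ler_pM2r ?invr_gt0.
have [i iE] : exists i, nsteps m' t = (nsteps m' s + i)%N by exists (nsteps m' t - nsteps m' s)%N; rewrite subnKC.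
have := @lip m' (nsteps m' s) i x y t xy; rewrite -iE => /(_ (nsteps_le _ tp)); rewrite -/E => h.
apply: (le_trans h).
have h1 := nsteps_le m' tp; have h2 := nsteps_gt m' s.
have := hM _ Mm; rewrite -/m' ltr_pdivlMr ?ltr_wpDl// => h3.
move: h1; rewrite iE natrD mulrDr => h1.
have : mesh m' * i%:R * E <= (t - s + mesh m') * E by apply: ler_wpM2r => //; lra.
lra.
Qed.

(* The discrete analogue of [C t x - x = \int_0^t (t - u) C u (C'' 0 x) du]. *)
Lemma T_second_order m n x y (t r : R) : A (x, y) -> mesh m * n%:R <= t ->
  (forall i, mesh m * i%:R <= t -> nr (chT (B m) i y - y) <= r) ->
  nr (chT (B m) n x - x + (mesh m * n%:R) ^+ 2 / 2 *r J (4 / mesh m ^+ 2) y) <=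
  (mesh m * n%:R) ^+ 2 * r.
Proof.
move=> xy nt hr; have hm := mesh_gt0 m; set k := mesh m ^+ 2 / 4; set s := 4 / mesh m ^+ 2.
have ss : s0 <= s by exact: s0_le.
have kp : 0 <= k by rewrite /k; pos.
pose u := B m x - x.
have uE : u = (- (2 * k)) *r J s y.
  rewrite /u BE (J_dom (s0_le m) xy) invf_div -/k -/s.
  by apply: ip_ext => v; rewrite !ipE; ring.
pose d i := chT (B m) i.+1 x - chT (B m) i x.
have dS i : d i.+1 = d i + 2 *r chT (B m) i.+1 u.
  have -> : chT (B m) i.+1 u = B m (chT (B m) i.+1 x) - chT (B m) i.+1 x.
    by rewrite -chT_commB -linearB.
  by rewrite /d chTSS; apply: ip_ext => v; rewrite !ipE; ring.
have Tu i : mesh m * i%:R <= t -> nr (chT (B m) i u - u) <= 4 * k * r.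
  move=> it; have -> : chT (B m) i u - u = (- (2 * k)) *r J s (chT (B m) i y - y).
    by rewrite uE (linZ (chT (B m) i)) /= T_J// linearB scalerBr.
  rewrite nrZr normrN ger0_norm; last by pos.
  have := J_le (chT (B m) i y - y) ss; have := hr i it => h1 h2.
  have : 2 * k * nr (J s (chT (B m) i y - y)) <= 2 * k * (2 * r).
    by apply: ler_wpM2l; [pos|lra].
  lra.
have it i : (i <= n)%N -> mesh m * i%:R <= t.
  by move=> iN; apply: le_trans nt; rewrite ler_pM2l// ler_nat.
(* First differences follow [(2 i + 1) u]; these odd numbers sum to [i ^+ 2] in [he]. *)
have hd i : (i <= n)%N -> nr (d i - (2 * i%:R + 1) *r u) <= i%:R * (8 * k * r).
  elim: i => [_|i IH iN].
    by rewrite /d /= mulr0 add0r rs1 subrr nr0 mul0r.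
  have -> : d i.+1 - (2 * i.+1%:R + 1) *r u = (d i - (2 * i%:R + 1) *r u) + 2 *r (chT (B m) i.+1 u - u).
    by rewrite dS -natr1; apply: ip_ext => v; rewrite !ipE; ring.
  apply: (le_trans (ler_nrD _ _)); rewrite nrZr ger0_norm//.
  have := IH (ltnW iN); have := Tu _ (it _ iN); rewrite -natr1; lra.
have he i : (i <= n)%N -> nr (chT (B m) i x - x - (i%:R ^+ 2) *r u) <= i%:R ^+ 2 * (4 * k * r).
  elim: i => [_|i IH iN].
    by rewrite /= subrr expr0n/= rs0 subrr nr0 mul0r.
  have -> : chT (B m) i.+1 x - x - (i.+1%:R ^+ 2) *r u =
    (chT (B m) i x - x - (i%:R ^+ 2) *r u) + (d i - (2 * i%:R + 1) *r u).
    by rewrite /d -natr1; apply: ip_ext => v; rewrite !ipE; ring.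
  apply: (le_trans (ler_nrD _ _)).
  have r0 : 0 <= r by apply: le_trans (hr 0%N _); rewrite ?nr_ge0// mulr0 (le_trans _ (it _ (leq0n _))) ?mulr0.
  have kr : 0 <= k * r by exact: mulr_ge0.
  have := IH (ltnW iN); have := hd _ (ltnW iN); rewrite -[i.+1%:R]natr1; move: i%:R kr => p; lra.
have := he n (leqnn n); rewrite uE.
have -> : n%:R ^+ 2 *r (- (2 * k) *r J s y) = - ((mesh m * n%:R) ^+ 2 / 2 *r J s y).
  by apply: ip_ext => v; rewrite !ipE /k; field.
by rewrite opprK /k => h; apply: (le_trans h); rewrite le_eqVlt; apply/orP; left; apply/eqP; field.
Qed.

Lemma C_second_order x y (t r : R) : A (x, y) -> 0 <= t ->
  (forall m i, mesh m * i%:R <= t -> nr (chT (B m) i y - y) <= r) ->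
  nr (C t x - x + (t ^+ 2 / 2) *r y) <= t ^+ 2 * r.
Proof.
move=> xy tp hr.
have r0 : 0 <= r by apply: le_trans (hr 0%N 0%N _); rewrite ?nr_ge0// mulr0.
have aN := approx_nsteps tp.
have cJ : hcvg (fun m => J (4 / mesh m ^+ 2) y) y.
  move=> e e0; have [S Ss hS] := J_cvg y e0; have S0 := lt_le_trans s00 Ss.
  have [|M hM] := @mesh_small (Num.min 1 (4 / S)); first by rewrite lt_min ltr01 divr_gt0.
  exists M => m /hM; rewrite lt_min => /andP[h1 h2]; rewrite nrB; apply: hS.
  have hm := mesh_gt0 m.
  rewrite ler_pdivlMr ?exprn_gt0// -ler_pdivlMl// mulrC.
  apply: ltW; apply: le_lt_trans h2; rewrite expr2 ler_piMr ?ltW//.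
pose p m := mesh m * (nsteps m t)%:R.
have pt m : 0 <= p m <= t by rewrite mulr_ge0 ?(ltW (mesh_gt0 m))//= nsteps_le.
have cp : forall e : R, 0 < e -> exists M, forall m, (M <= m)%N -> t - p m < e.
  move=> e e0; have [M hM] := mesh_small e0; exists M => m /hM.
  by have := nsteps_gt m t; rewrite /p; lra.
apply: (@le_hcvg _ _ (fun m => chT (B m) (nsteps m t) x - x + (p m ^+ 2 / 2) *r J (4 / mesh m ^+ 2) y) _ _ 0); last first.
  move=> m _; apply: (le_trans (T_second_order xy (nsteps_le m tp) (hr m))).
  have /andP[p0 p1] := pt m; rewrite ler_wpM2r//.
  by apply: lerXn2r; rewrite ?nnegrE.
apply: hcvgD; first by apply: hcvgB; [exact: C_approx|exact: hcvg_cst].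
apply: (hcvg_dist (hcvgZ _ cJ)) => e e0.
pose E := (2 * t + 1) * (2 * nr y) + 1.
have E0 : 0 < E by have := nr_ge0 y; rewrite /E => h; rewrite ltr_wpDl//; pos.
have [|M hM] := cp (e / E); first by rewrite divr_gt0.
exists M => m /hM; rewrite ltr_pdivlMr// => h.
rewrite -scalerBl -rmorphB nrZr ler0_norm.
  have := J_le y (s0_le m); have /andP[p0 p1] := pt m; have := nr_ge0 (J (4 / mesh m ^+ 2) y).
  have := nr_ge0 y; rewrite /E in h; move: (p m) p0 p1 h => q p0 p1 h n1 n2 n3.
  have : - (q ^+ 2 / 2 - t ^+ 2 / 2) <= (t - q) * t by nra.
  have : 0 <= (t - q) * t by apply: mulr_ge0; lra.
  nra.
have /andP[p0 p1] := pt m; rewrite subr_le0 ler_pM2r// ?invr_gt0//.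
by apply: lerXn2r; rewrite ?nnegrE.
Qed.

(** The remainder in [C_second_order] is the oscillation of [T_i y] over times up to [t]. Replacing
    [y] by a nearby element of the domain makes it small, by [lip]. *)
Lemma C_generator x y (e : R) : A (x, y) -> 0 < e -> exists2 ta : R, 0 < ta &
  forall t, `|t| < ta -> nr (C t x - x + (t ^+ 2 / 2) *r y) <= t ^+ 2 * e.
Proof.
move=> xy e0; pose K1 : R := K 1.
have K10 : 1 <= K1 by exact: K_ge1.
have [|y' [z [w [yz _]]] yy'] := @dom2_dense y (e / (4 * K1)).
  by rewrite divr_gt0// mulr_gt0// (lt_le_trans ltr01).
have h0' := h00.
pose E : R := (2 + h0) * K1 * nr z + 1.
have E0 : 0 < E.
  have : 0 <= nr z by exact: nr_ge0.
  have K1p : 0 <= K1 by exact: expR_ge0.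
  by move=> ?; rewrite /E ltr_wpDl//; pos.
exists (Num.min 1 (e / 2 / E)); first by rewrite lt_min ltr01 !divr_gt0.
move=> t; rewrite lt_min => /andP[t1]; rewrite ltr_pdivlMr// => te.
rewrite -C_abs -(real_normK (num_real t)); apply: C_second_order => // m i it.
have i1 : mesh m * i%:R <= 1 by lra.
have := @lip m 0 i y' z 1 yz; rewrite add0n mulr1 => /(_ i1) h /=.
have h1 := @nr_T m i (y - y') 1 i1; rewrite -/K1 linearB in h1.
have h2 := ler_nr3 (chT (B m) i y') (chT (B m) i y) y.
have h3 := ler_nr3 y' (chT (B m) i y') y; rewrite (nrB y') in h3.
have K1p : 0 < K1 by exact: expR_gt0.
move: yy'; rewrite ltr_pdivlMr ?mulr_gt0// => yy'.
have h4 : nr (y - y') <= K1 * nr (y - y') by rewrite ler_peMl ?nr_ge0.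
rewrite -/K1 in h.
have h5 : mesh m * i%:R * ((2 + h0) * K1 * nr z) <= `|t| * ((2 + h0) * K1 * nr z).
  by apply: ler_wpM2r => //; have := nr_ge0 z => ?; pos.
move: te; rewrite /E mulrDr mulr1; move: h h5; have := normr_ge0 t; move: `|t| => q.
move: (_ * nr z) => p; lra.
Qed.

Lemma C_strongly_continuous x : continuous (fun t => C t x).
Proof.
move=> t; apply/cvg_nrP => e e0.
pose T : R := `|t| + 1; have T0 : 0 < T by rewrite ltr_wpDl.
have KT : 0 < K T by exact: expR_gt0.
have [|y [z [w [yz _]]] xy] := @dom2_dense x (e / (4 * K T)).
  by rewrite divr_gt0// mulr_gt0.
pose E : R := (2 * T + h0) * K T * nr z + 1.
have E0 : 0 < E.
  have h0' := h00; have : 0 <= nr z by exact: nr_ge0.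
  by move=> ?; rewrite /E ltr_wpDl//; pos.
have near_t : \forall s \near t, `|t - s| < Num.min 1 (e / 2 / E).
  have/cvgrPdist_lt : s @[s --> t] --> t by exact: cvg_id.
  by apply; rewrite lt_min ltr01 !divr_gt0.
apply: filterS near_t => s; rewrite lt_min => /andP[ts1]; rewrite ltr_pdivlMr// => tsE.
have tT : `|t| <= T by rewrite /T lerDl.
have sT : `|s| <= T.
  rewrite /T; have := ler_normB t (t - s); rewrite opprB addrCA subrr addr0.
  by move=> h; apply: (le_trans h); rewrite lerD2l ltW.
have big u : `|u| <= T -> nr (C u (x - y)) < e / 4.
  move=> uT; apply: (le_lt_trans (C_le _ _)).
  have := ler_wpM2r (nr_ge0 (x - y)) (K_le uT).
  by move: xy; rewrite ltr_pdivlMr ?mulr_gt0//; lra.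
have mid u v : `|u| <= `|v| -> `|v| <= T -> `|v| - `|u| <= `|t - s| -> nr (C v y - C u y) <= `|t - s| * (E - 1).
  move=> uv vT vu; rewrite -(C_abs v) -(C_abs u).
  apply: (le_trans (C_lip yz (normr_ge0 u) uv)); rewrite /E addrK.
  have h0' := h00; have z0 := nr_ge0 z; have v0 := normr_ge0 v.
  apply: ler_pM => //; rewrite ?subr_ge0//; first by have := expR_ge0 (c * `|v|) => ?; pos.
  apply: ler_wpM2r => //; apply: ler_pM; rewrite ?expR_ge0 ?K_le//; first by pos.
  by rewrite lerD2r ler_pM2l.
have h1 := big t tT; have h2 := big s sT; rewrite !linearB in h1 h2.
have h3 : nr (C t y - C s y) <= `|t - s| * (E - 1).
  have [ts|/ltW st] := lerP `|s| `|t|.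
    by apply: mid => //; rewrite lerBlDr; have := ler_normD (t - s) s; rewrite subrK.
  rewrite nrB; apply: mid => //; rewrite lerBlDr distrC.
  by have := ler_normD (s - t) t; rewrite subrK.
have := ler_nr3 (C t y) (C t x) (C s x); have := ler_nr3 (C s y) (C t y) (C s x).
rewrite (nrB (C s y)) => h4 h5.
move: h1 h2 h3 h4 h5 tsE; have := normr_ge0 (t - s); rewrite mulrBr mulr1; move: `|t - s| => q /=; lra.
Qed.

Lemma C_cosine : cosine_function C.
Proof.
split.
- by move=> t; apply: (lipschitz_continuous (M := K `|t|)) => x; exact: C_le.
- exact: C0.
- by move=> s t x; rewrite C_eq rmorph_nat.
- exact: C_strongly_continuous.
Qed.

Lemma A_sub_generator x y : A (x, y) -> cosine_generator C (x, - y).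
Proof.
move=> xy; apply/cvg_nrP => e e0.
have e20 : 0 < e / 4 by rewrite divr_gt0.
have [ta ta0 hta] := C_generator xy e20.
have h1 : \forall t \near (0 : R)^', `|t| < ta by exact: dnbhs0_lt.
have h2 : \forall t \near (0 : R)^', t != 0 by exact: nbhs_dnbhs_neq.
apply: filterS2 h1 h2 => t /hta ht t0 /=.
have t20 : 0 < t ^+ 2 by rewrite exprn_even_gt0.
have -> : - y - (2 / t ^+ 2) *r (C t x - x) =
    (- (2 / t ^+ 2)) *r (C t x - x + (t ^+ 2 / 2) *r y).
  by apply: ip_ext => v; rewrite !ipE; field.
rewrite nrZr normrN ger0_norm ?divr_ge0 ?ltW// mulrAC ltr_pdivrMr//.
have := mulr_gt0 e0 t20; lra.
Qed.

(** For the inclusion of the generator in [- A], apply [J k]: it commutes with [C], and [J k x] lies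
    in the domain of [A], where the generator is already known. Equating the two values gives
    [J k z = - k (x - J k x)], which is [x = J k (x - k^-1 z)]. *)
Lemma C_generator_eq : cosine_generator C = op_opp A.
Proof.
apply/seteqP; split=> [[x z]|[x z]] /=; last first.
  by rewrite /op_opp /= => /A_sub_generator /=; rewrite opprK.
rewrite /op_opp /= => xz.
have ss := lexx s0; set k := s0 in ss.
have g1 := A_sub_generator (J_ran x ss).
have g2 : cosine_generator C (J k x, J k z).
  apply/cvg_nrP => e e0.
  have e20 : 0 < e / 2 by rewrite divr_gt0.
  have/cvg_nrP/(_ _ e20) := xz; apply: filterS => t /= h.
  rewrite C_J// -!linearB -(linZ (J k)) -linearB.
  by apply: (le_lt_trans (J_le _ ss)); rewrite mulrC -ltr_pdivlMr.
have e1 : J k z = - (k *r (x - J k x)) by exact: (cvg_unique _ g2 g1).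
apply/(J_A _ _ ss); rewrite linearD (linZ (J k)) /= linearN /= e1 opprK rsA.
by rewrite mulVf ?gt_eqF// rs1 addrC subrK.
Qed.

End cosine.

Section form_cosine.
Context {R : realType} {V H : hilbertType R} {j : {linear V -> H}}.
Variables (a : V -> V -> R[i]) (Mj M d w Mb : R).
Hypothesis Mj0 : 0 <= Mj.
Hypothesis j_le : forall u : V, nr (j u) <= Mj * nr u.
Hypothesis j_dense : dense (range j).
Hypothesis aDl : forall u u' v : V, a (u + u') v = a u v + a u' v.
Hypothesis aZl : forall (c : R[i]) (u v : V), a (c *: u) v = c * a u v.
Hypothesis aDr : forall u v v' : V, a u (v + v') = a u v + a u v'.
Hypothesis aZr : forall (c : R[i]) (u v : V), a u (c *: v) = c^*%R * a u v.
Hypothesis M0 : 0 <= M.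
Hypothesis al_le : forall u v : V, al a u v <= M * nr u * nr v.
Hypothesis d0 : 0 < d.
Hypothesis w0 : 0 <= w.
Hypothesis al_ge : forall u : V, d * nr u ^+ 2 <= al a u u + w * nr (j u) ^+ 2.

Lemma resolvents_exist : exists Rs : R -> {linear H -> V}, forall s, w <= s ->
  forall x v, s * ip (j (Rs s x)) (j v) + al a (Rs s x) v = ip x (j v).
Proof.
have ex s : exists F : {linear H -> V}, w <= s ->
    forall x v, s * ip (j (F x)) (j v) + al a (F x) v = ip x (j v).
  have [ws|sw] := leP w s.
    by have [F hF] := resolvent_exists Mj0 j_le aDl aZl aDr aZr M0 al_le d0 w0 al_ge ws; exists F.
  have [F _] := resolvent_exists Mj0 j_le aDl aZl aDr aZr M0 al_le d0 w0 al_ge (lexx w).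
  by exists F.
by have [Rs hRs] := choice ex; exists Rs.
Qed.

Section resolvent.
Variable Rs : R -> {linear H -> V}.
Hypothesis RsP : forall s, w <= s ->
  forall x v, s * ip (j (Rs s x)) (j v) + al a (Rs s x) v = ip x (j v).

Lemma form_opP s x y : w <= s -> form_op j a (x, y) <-> x = j (Rs s (y + s *r x)).
Proof.
move=> ws; split=> [[u /= <-] /(al_inner aZr)|xE].
  by move=> /(res_opP aDl aZl d0 al_ge RsP ws) {1}->.
exists (Rs s (y + s *r x)) => //=; apply/(al_inner aZr) => v.
by rewrite (al_res RsP)// -xE addrK.
Qed.
End resolvent.

Hypothesis Mb0 : 0 <= Mb.
Hypothesis Im_le : forall u : V, complex.Im (a u u) ^+ 2 <= (Mb * nr (j u) * nr u) ^+ 2.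

Theorem form_generates_cosine : generates_cosine (op_opp (form_op j a)).
Proof.
have [Rs RsP] := resolvents_exist.
pose s0 : R := 2 * w + 1; have w0' := w0.
pose om : R := omega d w Mb; have om0 : 0 < om by exact: omega_gt0.
(* This [h0] serves both [om * h0 <= 4^-1], for the stability bound, and [s0 * h0 ^+ 2 <= 4], so
   that every mesh uses a resolvent parameter above [s0]. *)
pose h0 : R := (4 * om + s0)^-1.
have h0i : 0 < 4 * om + s0 by rewrite /s0; lra.
have h00 : 0 < h0 by rewrite invr_gt0.
have h0h : h0 * (4 * om + s0) = 1 by rewrite mulVf// gt_eqF.
have s00 : 0 < s0 by rewrite /s0; lra.
have oh0 : 0 < om * h0 by exact: mulr_gt0.
have omh : om * h0 <= 4^-1 by have := mulr_gt0 s00 h00; lra.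
have h0s : s0 <= 4 / h0 ^+ 2.
  rewrite ler_pdivlMr ?exprn_gt0//.
  have s1 : 1 <= s0 by rewrite /s0; lra.
  have hs : s0 * h0 <= 1 by lra.
  have h1 : h0 <= 1 by have := ler_wpM2r (ltW h00) s1; lra.
  have := ler_pM (mulr_ge0 (ltW s00) (ltW h00)) (ltW h00) hs h1.
  by rewrite mulr1 -mulrA -expr2; lra.
pose J s : {linear H -> H} := Jop (j := j) Rs s.
pose B m : {linear H -> H} := Bop (j := j) Rs (4 / mesh h0 m ^+ 2).
have ws s : s0 <= s -> w <= s by rewrite /s0; lra.
have J_le s x : s0 <= s -> nr (J s x) <= 2 * nr x.
  by move=> ss; apply: (Jop_le d0 w0 al_ge RsP); move: ss; rewrite /s0; lra.
have J_A s x y : s0 <= s -> form_op j a (x, y) <-> x = J s (x + s^-1 *r y).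
  move=> ss; have sn : s != 0 by rewrite gt_eqF//; move: ss; rewrite /s0; lra.
  have -> : J s (x + s^-1 *r y) = j (Rs s (y + s *r x)).
    rewrite /J /= /Jop -!linZ scalerDr rsA mulfV// rs1 [in RHS]addrC//.
  exact: form_opP (ws _ ss).
have J_comm s t x : s0 <= s -> s0 <= t -> J s (J t x) = J t (J s x).
  move=> ss st; rewrite /J /= /Jop (linZ (Rs s)) (linZ (Rs t)) (linZ j) [in RHS](linZ j) !rsA.
  by rewrite (res_comm aDl aZl d0 al_ge RsP x (ws _ ss) (ws _ st)) mulrC.
have J_cvg x (e : R) : 0 < e -> exists2 S, s0 <= S & forall s, S <= s -> nr (x - J s x) < e.
  move=> e0; have [S wS hS] := res_cvg aDl aZl al_le d0 w0 al_ge RsP j_dense x e0.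
  exists (Num.max s0 S); first by rewrite le_max lexx.
  by move=> s; rewrite ge_max => /andP[_ Ss]; exact: hS.
have c0 : 0 <= 4 * om by rewrite mulr_ge0// ltW.
have BE m x : B m x = 2 *r J (4 / mesh h0 m ^+ 2) x - x by [].
have T_le m n x : nr (chT (B m) n x) <= expR (4 * om * (mesh h0 m * n%:R)) * nr x.
  apply: (chT_Bop_le aZl aZr d0 w0 al_ge Mb0 Im_le RsP); first exact: mesh_gt0.
  by apply: le_trans omh; rewrite ler_pM2l// mesh_le.
have [C hC] := cosine_exists s00 J_le J_A J_comm J_cvg c0 h00 h0s BE T_le.
exists C.
  exact: (C_cosine s00 J_le J_A J_comm J_cvg c0 h00 h0s BE T_le hC).
exact: (C_generator_eq s00 J_le J_A J_comm J_cvg c0 h00 h0s BE T_le hC).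
Qed.

End form_cosine.

(** * Square roots of positive operators and of forms *)

Section contraction_sqrt.
Context {R : realType} {H : hilbertType R}.
Variable T : {linear H -> H}.

(** Visser's iteration [Y_(n+1) = (T + Y_n^2) / 2]: its limit satisfies [2 Y = T + Y^2], so [1 - Y]
    is a square root of [1 - T]. *)
Fixpoint visser n (x : H) : H :=
  if n is n'.+1 then 2^-1 *r (T x + visser n' (visser n' x)) else 0.

Lemma visser_linear n : linear (visser n).
Proof.
elim: n => [|n IH] c x y /=; first by rewrite scaler0 addr0.
by rewrite !IH linearP addrACA -(scalerDr c) (scalerDr _ (c *: _)) !scalerA mulrC.
Qed.

HB.instance Definition _ n :=
  GRing.isLinear.Build R[i] H H _ (visser n) (visser_linear n).

(** The same iteration for the number 1. The iterates are polynomials in [T] with nonnegative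
    coefficients, so for a contraction it majorises their norms and those of their increments. *)
Fixpoint visser1 n : R := if n is n'.+1 then (1 + visser1 n' ^+ 2) / 2 else 0.

(** Convergence is only of order [1 / n], as 1 is a double fixed point of [(1 + y ^+ 2) / 2]. The
    lower bound reproduces itself under the recurrence, with the positive remainder
    [2 / ((n + 2)^2 (n + 3))]. *)
Lemma visser1_bounds n : 1 - 2 / (n%:R + 2) <= visser1 n /\ visser1 n <= 1 /\
  0 <= visser1 n <= visser1 n.+1.
Proof.
elim: n => [|n [IH1 [IH2 /andP[IH3 IH4]]]] /=.
  by rewrite add0r; split; [lra|split; lra].
have n0 : 0 <= n%:R :> R by [].
split.
  have h : 0 <= 1 - 2 / (n%:R + 2) :> R.
    by rewrite subr_ge0 ler_pdivrMr ?mul1r; lra.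
  have h2 : (1 - 2 / (n%:R + 2)) ^+ 2 <= visser1 n ^+ 2.
    by apply: lerXn2r; rewrite ?nnegrE.
  suff : 1 - 2 / (n.+1%:R + 2) <= (1 + (1 - 2 / (n%:R + 2)) ^+ 2) / 2 :> R.
    by move=> h3; apply: (le_trans h3); rewrite ler_pM2r// lerD2l.
  rewrite -[n.+1%:R]natr1 -subr_ge0.
  have -> : (1 + (1 - 2 / (n%:R + 2)) ^+ 2) / 2 - (1 - 2 / (n%:R + 1 + 2)) =
     2 / ((n%:R + 2) ^+ 2 * (n%:R + 3)) :> R.
    by move: n%:R n0 => p p0; field; apply/andP; split; rewrite gt_eqF//; lra.
  by rewrite divr_ge0// mulr_ge0 ?sqr_ge0; lra.
have y2 : 0 <= visser1 n ^+ 2 <= 1 by rewrite sqr_ge0 expr_le1.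
split; first lra.
apply/andP; split; first lra.
rewrite /= in IH4.
have : visser1 n ^+ 2 <= ((1 + visser1 n ^+ 2) / 2) ^+ 2.
  by apply: lerXn2r; rewrite ?nnegrE//; lra.
lra.
Qed.

Lemma visser_comm (F : {linear H -> H}) n x : (forall y, F (T y) = T (F y)) ->
  F (visser n x) = visser n (F x).
Proof.
move=> FT; elim: n x => [|n IH] x /=; first by rewrite linear0.
by rewrite linZ linearD FT !IH.
Qed.

Lemma visser_visser m n x : visser m (visser n x) = visser n (visser m x).
Proof.
rewrite (visser_comm (F := visser m))// => y.
by rewrite (visser_comm (F := T)).
Qed.

Hypothesis T_sym : forall x y, ip (T x) y = ip x (T y).
Hypothesis T_le : forall x, nr (T x) <= nr x.

Lemma visser_sym n x y : ip (visser n x) y = ip x (visser n y).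
Proof.
elim: n x y => [|n IH] x y /=; first by rewrite ip0l ip0r.
by rewrite !ipE T_sym !IH.
Qed.

Lemma visser_le n x : nr (visser n x) <= visser1 n * nr x.
Proof.
elim: n x => [|n IH] x; first by rewrite /= nr0 mul0r.
have [_ [_ /andP[y0 _]]] := visser1_bounds n.
rewrite /= nrZr ger0_norm//.
have := ler_nrD (T x) (visser n (visser n x)); have := T_le x.
have h1 := IH (visser n x); have := ler_wpM2l y0 (IH x); lra.
Qed.

(** For commuting iterates, [Y^2 - Z^2 = Y (Y - Z) + Z (Y - Z)]; the scalar increments satisfy the
    same identity, so the induction closes. *)
Lemma visser_step n x :
  nr (visser n.+1 x - visser n x) <= (visser1 n.+1 - visser1 n) * nr x.
Proof.
elim: n x => [|n IH] x.
  rewrite /= !subr0 addr0 nrZr ger0_norm// expr0n/= addr0.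
  by rewrite mul1r ler_pM2l.
pose Y : {linear H -> H} := visser n.+1; pose Z : {linear H -> H} := visser n.
have YZ : Z (Y x) = Y (Z x) by exact: visser_visser.
change (nr (visser n.+2 x - visser n.+1 x) <= (visser1 n.+2 - visser1 n.+1) * nr x).
have -> : visser n.+2 x - visser n.+1 x =
    2^-1 *r (Y (Y x - Z x) + Z (Y x - Z x)).
  have -> : visser n.+2 x = 2^-1 *r (T x + Y (Y x)) by [].
  have -> : visser n.+1 x = 2^-1 *r (T x + Z (Z x)) by [].
  rewrite (linearB Y) (linearB Z) YZ.
  by apply: ip_ext => v; rewrite !ipE; ring.
have [_ [_ /andP[y0 y1]]] := visser1_bounds n.
have [_ [_ /andP[y2 _]]] := visser1_bounds n.+1.
rewrite nrZr ger0_norm//.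
have := ler_nrD (Y (Y x - Z x)) (Z (Y x - Z x)).
have := visser_le n.+1 (Y x - Z x); have := visser_le n (Y x - Z x).
have h : nr (Y x - Z x) <= (visser1 n.+1 - visser1 n) * nr x by exact: IH.
have := ler_wpM2l (addr_ge0 y0 y2) h.
have -> : visser1 n.+2 - visser1 n.+1 = (visser1 n + visser1 n.+1) * (visser1 n.+1 - visser1 n) / 2.
  have -> : visser1 n.+2 = (1 + visser1 n.+1 ^+ 2) / 2 by [].
  have {2}-> : visser1 n.+1 = (1 + visser1 n ^+ 2) / 2 by [].
  by field.
move: (visser1 n.+1) => p; lra.
Qed.

Lemma visser_dist m n x : (n <= m)%N ->
  nr (visser m x - visser n x) <= 2 / (n%:R + 2) * nr x.
Proof.
move=> nm; apply: (@le_trans _ _ ((visser1 m - visser1 n) * nr x)).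
  elim: m nm => [|m IH]; first by rewrite leqn0 => /eqP->; rewrite !subrr nr0 mul0r.
  rewrite leq_eqVlt => /orP[/eqP->|]; first by rewrite !subrr nr0 mul0r.
  rewrite ltnS => /IH h; have := ler_nr3 (visser m x) (visser m.+1 x) (visser n x).
  by have := visser_step m x; lra.
rewrite ler_wpM2r ?nr_ge0//.
have [h _] := visser1_bounds n; have [_ [h' _]] := visser1_bounds m; lra.
Qed.

Lemma contraction_sqrt : exists g : {linear H -> H},
  [/\ forall x, g (g x) = x - T x, forall x y, ip (g x) y = ip x (g y) &
      forall x, 0 <= ip (g x) x].
Proof.
have ex x : exists l, hcvg (fun n => visser n x) l.
  apply: cauchy_hcvg => e e0.
  have [N hN] : exists N : nat, 4 * (nr x + 1) / e < N%:R.
    by exists (Num.truncn (4 * (nr x + 1) / e)).+1; exact: truncnS_gt.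
  exists N => m n Nm Nn; have := visser_dist x Nm; have := visser_dist x Nn.
  have := ler_nr3 (visser N x) (visser m x) (visser n x).
  rewrite (nrB (visser N x)).
  have N2 : 0 < N%:R + 2 :> R by rewrite ltr_wpDl.
  have : 2 / (N%:R + 2) * nr x < e / 2.
    rewrite mulrAC ltr_pdivrMr//; move: hN; rewrite ltr_pdivrMr//.
    have := nr_ge0 x; lra.
  lra.
have [f hf] := choice ex.
have uq x l : hcvg (fun n => visser n x) l -> f x = l by exact: hcvg_unique.
have [Y hY] : exists Y : {linear H -> H}, Y =1 f.
  apply: complex_linear => [x y|b x|x]; apply: uq.
  - by apply: eq_hcvg (hcvgD (hf x) (hf y)) => m; rewrite linearD.
  - by apply: eq_hcvg (hcvgZ _ (hf x)) => m; rewrite linearZ.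
  - by apply: eq_hcvg (hcvgZ _ (hf x)) => m; rewrite linearZ.
have YP x : hcvg (fun n => visser n x) (Y x) by rewrite hY.
have v_le n x : nr (visser n x) <= nr x.
  apply: (le_trans (visser_le n x)); rewrite ler_piMl ?nr_ge0//.
  by have [_ [h _]] := visser1_bounds n.
have Y_le x : nr (Y x) <= nr x.
  by apply: (le_hcvg (N := 0%N) (YP x)) => n _; exact: v_le.
have Y_sym x y : ip (Y x) y = ip x (Y y).
  have cvgr (u : nat -> H) l z : hcvg u l -> forall e : R, 0 < e ->
      exists N, forall n, (N <= n)%N -> `|ip (u n) z - ip l z| < e.
    move=> ul e e0; have z0 : 0 < nr z + 1 by rewrite ltr_wpDl ?nr_ge0.
    have [|N hN] := ul (e / (nr z + 1)); first by rewrite divr_gt0.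
    exists N => n /hN; rewrite ltr_pdivlMr// => h.
    have -> : ip (u n) z - ip l z = ip (u n - l) z by rewrite !ipE.
    apply: (le_lt_trans (ip_abs _ _)); apply: le_lt_trans h.
    by rewrite ler_wpM2l ?nr_ge0// lerDl.
  apply/eqP; rewrite -subr_eq0 -normr_le0; apply/ler_addgt0Pr => e e0; rewrite add0r.
  have e20 : 0 < e / 2 by rewrite divr_gt0.
  have [N1 h1] := cvgr _ _ y (YP x) _ e20; have [N2 h2] := cvgr _ _ x (YP y) _ e20.
  have e1 := h1 _ (leq_maxl N1 N2); have e2 := h2 _ (leq_maxr N1 N2).
  rewrite (ipC _ x) (ipC (Y y)) in e2; rewrite visser_sym in e1.
  have := ler_distD (ip x (visser (maxn N1 N2) y)) (ip (Y x) y) (ip x (Y y)).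
  rewrite (distrC (ip (Y x) y) (ip x (visser _ _))); lra.
have YE x : Y x = 2^-1 *r (T x + Y (Y x)).
  apply: (hcvg_unique (u := fun n => visser n.+1 x)); first exact: (@hcvg_shift _ _ (visser ^~ x)).
  apply: hcvgZ; apply: hcvgD; first exact: hcvg_cst.
  apply: (hcvg_dist (u := fun n => visser n (Y x))) => // e e0.
  have [N hN] := YP x _ e0; exists N => n /hN; apply: le_lt_trans.
  suff : nr (visser n (visser n x) - visser n (Y x)) <= nr (visser n x - Y x) by [].
  by rewrite -linearB v_le.
pose g x := x - Y x.
have [G hG] : exists G : {linear H -> H}, G =1 g.
  by apply: complex_linear => [x y|b x|x]; rewrite /g ?linearD ?linearZ/=;
    apply: ip_ext => v; rewrite !ipE ?ip_iN; ring.
exists G; split=> [x|x y|x]; rewrite ?hG /g.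
- by apply: ip_ext => v; have := congr1 (ip ^~ v) (YE x); rewrite linearB !ipE; lra.
- by rewrite !ipE Y_sym.
- rewrite !ipE subr_ge0; apply: (le_trans (ip_le _ _)).
  by rewrite ip_nr expr2 ler_wpM2r ?nr_ge0.
Qed.

End contraction_sqrt.

(** * Inverses of [1 + p P] for a positive operator [P] *)

Section positive_operator.
Context {R : realType} {H : hilbertType R}.
Variables (P : {linear H -> H}) (CP : R).
Hypothesis P_sym : forall x y, ip (P x) y = ip x (P y).
Hypothesis P_ge0 : forall x, 0 <= ip (P x) x.
Hypothesis CP0 : 0 <= CP.
Hypothesis P_le : forall x, nr (P x) <= CP * nr x.

(** A resolvent at 1: the form [p * inner (P x) y] lives on [H] itself, imbedded by the identity. *)
Lemma positive_inverse p : 0 <= p ->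
  exists K : {linear H -> H}, forall x, K x + p *r P (K x) = x.
Proof.
move=> p0; pose a (x y : H) := inner (p *r P x) y.
have aDl u u' v : a (u + u') v = a u v + a u' v.
  by rewrite /a linearD scalerDr innerDl.
have aZl c u v : a (c *: u) v = c * a u v.
  by rewrite /a linearZ /= scalerA mulrC -scalerA innerZl.
have aDr u v v' : a u (v + v') = a u v + a u v' by rewrite /a innerDr.
have aZr c u v : a u (c *: v) = c^*%R * a u v by rewrite /a innerZr.
have alE u v : al a u v = p * ip (P u) v by rewrite -ipZl.
have a_le u v : al a u v <= p * CP * nr u * nr v.
  rewrite alE -!mulrA ler_wpM2l//; apply: (le_trans (ip_le _ _)).
  by rewrite mulrA ler_wpM2r ?nr_ge0.
have a_ge u : 1 * nr u ^+ 2 <= al a u u + 1 * nr (idfun u) ^+ 2.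
  by rewrite /= lerDr alE mulr_ge0.
have [|K hK] := @resolvent_exists R H H (idfun : {linear H -> H}) a 1 (p * CP) 1 1
  ler01 _ aDl aZl aDr aZr (mulr_ge0 p0 CP0) a_le ltr01 ler01 a_ge 1 (lexx 1).
  by move=> u; rewrite mul1r.
by exists K => x; apply: ip_ext => y; have := hK x y; rewrite alE !ipE mul1r.
Qed.

Lemma positive_inverses : exists K : R -> {linear H -> H}, forall p, 0 <= p ->
  forall x, K p x + p *r P (K p x) = x.
Proof.
have ex (p : R) : exists F : {linear H -> H}, 0 <= p -> forall x, F x + p *r P (F x) = x.
  have [p0|p0] := leP 0 p; last by exists idfun.
  by have [F hF] := positive_inverse p0; exists F.
by have [K hK] := choice ex; exists K.
Qed.

Lemma positive_ip_sqr p x : 0 <= p -> nr x ^+ 2 <= ip (x + p *r P x) x.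
Proof. by move=> p0; rewrite !ipE ip_nr lerDl mulr_ge0. Qed.

Section inverse.
Variables (p : R) (K : {linear H -> H}).
Hypothesis p0 : 0 <= p.
Hypothesis KE : forall x, K x + p *r P (K x) = x.

Lemma inverse_le x : nr (K x) <= nr x.
Proof.
have := positive_ip_sqr (K x) p0; rewrite KE => h.
have := le_trans h (ip_le _ _); have [->|] := eqVneq (nr (K x)) 0; first by rewrite nr_ge0.
rewrite neq_lt ltNge nr_ge0/= => n0; rewrite expr2 ler_pM2r//.
Qed.

Lemma inverse_uniq x y : y + p *r P y = x -> y = K x.
Proof.
move=> yx; apply/eqP; rewrite -subr_eq0; apply/eqP/nr0_eq0/eqP.
have := positive_ip_sqr (y - K x) p0.
have -> : y - K x + p *r P (y - K x) = 0.
  apply: ip_ext => v; have := congr1 (ip ^~ v) yx; have := congr1 (ip ^~ v) (KE x).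
  by rewrite linearB !ipE; lra.
by rewrite ip0l => h; rewrite -sqrf_eq0 eq_le h sqr_ge0.
Qed.

Lemma inverse_comm (F : {linear H -> H}) x :
  (forall y, F (P y) = P (F y)) -> F (K x) = K (F x).
Proof.
by move=> FP; apply: inverse_uniq; rewrite -FP -linZ -linearD KE.
Qed.

Lemma inverse_sym x y : ip (K x) y = ip x (K y).
Proof.
by rewrite -{1}(KE y) -[in RHS](KE x) !ipE P_sym.
Qed.

End inverse.

Lemma ip_positive_le x y : 2 * ip x (P y) <= ip (P x) x + ip (P y) y.
Proof.
have := P_ge0 (x - y); rewrite linearB !ipE.
by have := ipC (P y) x; have := P_sym x y; lra.
Qed.

End positive_operator.

Lemma hcvg_eq {R : realType} {V H : hilbertType R} (f : V -> R) (k : H -> R)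
    (cf ck : R) (u : nat -> V) (w : nat -> H) l z :
  (forall x y, `|f x - f y| <= cf * nr (x - y)) ->
  (forall x y, `|k x - k y| <= ck * nr (x - y)) ->
  hcvg u l -> hcvg w z -> (forall n, f (u n) = k (w n)) -> f l = k z.
Proof.
move=> hf hk ul wz fk; apply/eqP; rewrite -subr_eq0 -normr_le0.
apply/ler_addgt0Pr => e e0; rewrite add0r.
have small (X : hilbertType R) (p : X -> R) (c : R) (v : nat -> X) x :
    (forall x y, `|p x - p y| <= c * nr (x - y)) -> hcvg v x ->
    exists N, forall n, (N <= n)%N -> `|p (v n) - p x| < e / 2.
  move=> hp vx; have c0 : 0 < `|c| + 1 by rewrite ltr_wpDl.
  have [|N hN] := vx (e / 2 / (`|c| + 1)); first by rewrite !divr_gt0.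
  exists N => n /hN; rewrite ltr_pdivlMr// => h.
  apply: (le_lt_trans (hp _ _)); apply: le_lt_trans h; rewrite mulrC.
  by rewrite ler_wpM2l ?nr_ge0// (le_trans (ler_norm c))// lerDl.
have [N1 h1] := small _ _ _ _ _ hf ul; have [N2 h2] := small _ _ _ _ _ hk wz.
have := h1 _ (leq_maxl N1 N2); have := h2 _ (leq_maxr N1 N2); rewrite -fk.
have := ler_distD (f (u (maxn N1 N2))) (f l) (k z).
rewrite (distrC (f l) (f (u _))); lra.
Qed.

Section form_sqrt.
Context {R : realType} {V H : hilbertType R} {j : {linear V -> H}}.
Variables (h : V -> V -> R[i]) (Mj M d : R).
Hypothesis Mj0 : 0 <= Mj.
Hypothesis j_le : forall u : V, nr (j u) <= Mj * nr u.
Hypothesis j_inj : injective j.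
Hypothesis j_dense : dense (range j).
Hypothesis hDl : forall u u' v : V, h (u + u') v = h u v + h u' v.
Hypothesis hZl : forall (c : R[i]) (u v : V), h (c *: u) v = c * h u v.
Hypothesis hDr : forall u v v' : V, h u (v + v') = h u v + h u v'.
Hypothesis hZr : forall (c : R[i]) (u v : V), h u (c *: v) = c^*%R * h u v.
Hypothesis M0 : 0 <= M.
Hypothesis h_le : forall u v : V, al h u v <= M * nr u * nr v.
Hypothesis d0 : 0 < d.
Hypothesis h_ge : forall u : V, d * nr u ^+ 2 <= al h u u.
Hypothesis h_sym : forall u v : V, al h u v = al h v u.
Hypothesis h_j : forall u : V, nr (j u) ^+ 2 <= al h u u.

Let al_abs u v : `|al h u v| <= M * nr u * nr v.
Proof. by rewrite ler_norml h_le andbT lerNl -(alNl hZl) -(nrN u) h_le. Qed.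

Let al_lip v x y : `|al h x v - al h y v| <= M * nr v * nr (x - y).
Proof.
rewrite -(alNl hZl) -(alDl hDl); apply: (le_trans (al_abs _ _)).
by rewrite mulrAC.
Qed.

Let ip_lip (v x y : H) : `|ip x v - ip y v| <= nr v * nr (x - y).
Proof.
have -> : ip x v - ip y v = ip (x - y) v by rewrite !ipE.
by apply: (le_trans (ip_abs _ _)); rewrite mulrC.
Qed.

(* For the inner product [al h] on [V], [N] is the unitary part in the polar
   decomposition of the adjoint of [j], and [g] its positive part. *)
Theorem form_sqrt : exists (N : {linear H -> V}) (g : {linear H -> H}),
  [/\ [/\ forall x, j (N x) = g x, forall x y, al h (N x) (N y) = ip x y &
          forall v, exists x, N x = v],
      forall x v, al h (N (g x)) v = ip x (j v),
      forall x y, ip (g x) y = ip x (g y),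
      forall x, 0 <= ip (g x) x & forall x, nr (g x) <= 1 * nr x].
Proof.
have h_ge' u : d * nr u ^+ 2 <= al h u u + 0 * nr (j u) ^+ 2 by rewrite mul0r addr0.
have [Rs RsP] := resolvents_exist Mj0 j_le hDl hZl hDr hZr M0 h_le d0 (lexx 0) h_ge'.
(* [G] is the adjoint of [j] for [al h], so [j G] is a positive contraction. Its square root is [g],
   and [N] will be [G g^-1]. *)
pose G := Rs 0.
have GP x v : al h (G x) v = ip x (j v) by rewrite -(RsP _ (lexx 0)) mul0r add0r.
have G_uniq u y : (forall v, al h u v = ip y (j v)) -> u = G y.
  by move=> uy; rewrite (res_opP hDl hZl d0 h_ge' RsP (lexx 0) uy) rs0 addr0.
have Q_sym x y : ip (j (G x)) y = ip x (j (G y)).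
  by rewrite ipC -!GP h_sym.
have Q_sqr x : nr (j (G x)) ^+ 2 <= ip (j (G x)) x.
  by rewrite [leRHS]ipC -GP.
have Q_le x : nr (j (G x)) <= nr x.
  have [->|] := eqVneq (nr (j (G x))) 0; first by rewrite nr_ge0.
  rewrite neq_lt ltNge nr_ge0/= => n0; rewrite -(ler_pM2l n0) -expr2.
  exact: le_trans (Q_sqr x) (ip_le _ _).
have [T TE] : exists T : {linear H -> H}, forall x, T x = x - j (G x).
  apply: complex_linear => [x y|b x|x]; rewrite ?linearD ?linearZ/= ?scalerDr//.
  by rewrite addrACA.
have T_sym x y : ip (T x) y = ip x (T y) by rewrite !TE !ipE Q_sym.
have T_le x : nr (T x) <= nr x.
  rewrite TE -ler_sqr ?nnegrE ?nr_ge0// nrB2.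
  have := Q_sqr x; have := sqr_ge0 (nr (j (G x))); rewrite (ipC x); lra.
have [g [gg g_sym g_ge]] := contraction_sqrt T_sym T_le.
have ggE x : g (g x) = j (G x) by rewrite gg TE opprB addrC subrK.
have g_sqr x : nr (g x) ^+ 2 = ip (j (G x)) x.
  by rewrite -ip_nr g_sym ggE ipC.
have g_le x : nr (g x) <= 1 * nr x.
  rewrite mul1r -ler_sqr ?nnegrE ?nr_ge0// g_sqr; apply: (le_trans (ip_le _ _)).
  by rewrite expr2 ler_wpM2r ?nr_ge0.
(* With [K n = (1 + n g)^-1], the operators [n K n] approximate the possibly unbounded inverse of
   [g]. *)
have [K KE] : exists K : nat -> {linear H -> H},
    forall n x, K n x + n%:R *r g (K n x) = x.
  have ex n := positive_inverse g_ge ler01 g_le (ler0n R n).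
  by have [K hK] := choice ex; exists K.
have K_le n x : nr (K n x) <= nr x by exact: (inverse_le g_ge (ler0n R n) (KE n)).
have K_g n x : K n (g x) = g (K n x).
  by rewrite -(inverse_comm g_ge (ler0n R n) (KE n)).
have ngK n x : n%:R *r g (K n x) = x - K n x by apply/eqP; rewrite eq_sym subr_eq addrC KE.
(* The range of [g] is dense, since it contains that of [j G], and on it
   [K n (g z) = (z - K n z) / n]. *)
have K_cvg x : hcvg (fun n => K n x) 0.
  move=> e e0; have e40 : 0 < e / 2 by rewrite divr_gt0.
  have [S S0 /(_ _ (lexx S)) hS] := res_cvg hDl hZl h_le d0 (lexx 0) h_ge' RsP j_dense x e40.
  have [z zE] : exists z, S *r j (Rs S x) = g z.
    have -> : Rs S x = G (x - S *r j (Rs S x)).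
      by apply: G_uniq => v; rewrite (al_res RsP) ?ltW.
    by rewrite -ggE -linZ; eexists.
  have [N hN] : exists N : nat, 2 * (2 * nr z) / e < N%:R.
    by exists (Num.truncn (2 * (2 * nr z) / e)).+1; exact: truncnS_gt.
  exists N => n Nn; rewrite subr0.
  have n0 : 0 < n%:R :> R.
    apply: le_lt_trans (lt_le_trans hN _); last by rewrite ler_nat.
    by rewrite divr_ge0 ?(ltW e0)// !mulr_ge0 ?nr_ge0.
  have h1 : nr (K n (g z)) <= e / 2.
    have : n%:R * nr (K n (g z)) <= 2 * nr z.
      rewrite -[X in X * _]gtr0_norm// -nrZr K_g ngK.
      by have := ler_nrBD z (K n z); have := K_le n z; lra.
    rewrite -ler_pdivlMl// => h1; apply: (le_trans h1); rewrite ler_pdivrMl//.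
    have : 2 * (2 * nr z) / e <= n%:R by apply: ltW; apply: lt_le_trans hN _; rewrite ler_nat.
    by rewrite ler_pdivrMr//; lra.
  have -> : K n x = K n (x - g z) + K n (g z) by rewrite linearB subrK.
  apply: (le_lt_trans (ler_nrD _ _)); rewrite zE in hS.
  by have := K_le n (x - g z); lra.
have G_le y : d * nr (G y) ^+ 2 <= nr (g y) ^+ 2.
  by apply: (le_trans (h_ge _)); rewrite GP g_sqr ipC.
pose N_ n x := G (n%:R *r K n x).
have gN n x : g (n%:R *r K n x) = x - K n x by rewrite linZ ngK.
have sd0 : 0 < Num.sqrt d by rewrite sqrtr_gt0.
(* Since [al h (G y) (G y) = nr (g y) ^+ 2], distances in [V] between approximants are controlled by
   those between the [g (n K_n x) = x - K_n x] in [H]. *)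
have N_dist m n x : Num.sqrt d * nr (N_ m x - N_ n x) <= nr (K n x - K m x).
  rewrite -ler_sqr ?nnegrE ?mulr_ge0 ?nr_ge0 ?(ltW sd0)// exprMn sqr_sqrtr ?(ltW d0)//.
  rewrite /N_ -linearB; apply: (le_trans (G_le _)); rewrite linearB /= !gN.
  suff -> : x - K m x - (x - K n x) = K n x - K m x by [].
  by apply: ip_ext => v; rewrite !ipE; ring.
have ex x : exists l, hcvg (fun n => N_ n x) l.
  apply: cauchy_hcvg => e e0.
  have [|N hN] := K_cvg x (Num.sqrt d * e / 2); first by rewrite divr_gt0// mulr_gt0.
  exists N => m n Nm Nn; rewrite -(ltr_pM2l sd0); apply: (le_lt_trans (N_dist _ _ _)).
  apply: (le_lt_trans (ler_nrBD _ _)).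
  by have := hN _ Nm; have := hN _ Nn; rewrite !subr0; lra.
have [f hf] := choice ex.
have uq x l : hcvg (fun n => N_ n x) l -> f x = l by exact: hcvg_unique.
have [N hN] : exists N : {linear H -> V}, N =1 f.
  have N_D n x y : N_ n (x + y) = N_ n x + N_ n y by rewrite /N_ linearD scalerDr linearD.
  have N_Z n c x : N_ n (c *: x) = c *: N_ n x.
    by rewrite /N_ (linZ (K n)) scalerA mulrC -scalerA (linZ G).
  apply: complex_linear => [x y|b x|x]; apply: uq.
  - by apply: eq_hcvg (hcvgD (hf x) (hf y)) => m; rewrite N_D.
  - by apply: eq_hcvg (hcvgZ _ (hf x)) => m; rewrite N_Z.
  - by apply: eq_hcvg (hcvgZ _ (hf x)) => m; rewrite N_Z.
have NP x : hcvg (fun n => N_ n x) (N x) by rewrite hN.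
have xK x : hcvg (fun n => x - K n x) x.
  by rewrite -[X in hcvg _ X]subr0; apply: hcvgB; [exact: hcvg_cst|exact: K_cvg].
have jN x : j (N x) = g x.
  have c1 : hcvg (fun n => j (N_ n x)) (j (N x)).
    by apply: (hcvg_lip (c := Mj)) (NP x) => y; rewrite -linearB.
  have c2 : hcvg (fun n => g (x - K n x)) (g x).
    by apply: (hcvg_lip (c := 1)) (xK x) => y; rewrite -linearB.
  apply: hcvg_unique c1 _; apply: eq_hcvg c2 => n.
  by rewrite -gN ggE.
have NN x y : al h (N x) (N y) = ip x y.
  apply: (hcvg_eq (al_lip (N y)) (ip_lip y) (NP x) (xK x)) => n.
  by rewrite GP jN -g_sym gN.
have Ng x : N (g x) = G x by apply: j_inj; rewrite jN ggE.
have N_le x : d * nr (N x) ^+ 2 <= nr x ^+ 2.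
  by apply: (le_trans (h_ge _)); rewrite NN ip_nr.
exists N, g; split=> //; last by move=> x v; rewrite Ng GP.
split=> // v.
(* Surjectivity: represent [z |-> al h v (N z)] by a vector [x] of [H]; then [j (N x) = j v]. *)
have [||||x hx] := @riesz _ H (fun z => al h v (N z)) (M * nr v / Num.sqrt d).
- by rewrite divr_ge0 ?(ltW sd0)// mulr_ge0// nr_ge0.
- by move=> y z; rewrite linearD (alDr hDr).
- by move=> c y; rewrite linZ (alZr hZr).
- move=> z; apply: (le_trans (h_le _ _)); rewrite -(mulrA _ _ (nr z)) ler_wpM2l ?mulr_ge0 ?nr_ge0//.
  rewrite ler_pdivlMl// -ler_sqr ?nnegrE ?mulr_ge0 ?nr_ge0 ?(ltW sd0)// exprMn sqr_sqrtr ?(ltW d0)//.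
exists x; apply: j_inj; apply: ip_ext => y.
by rewrite jN g_sym -hx Ng h_sym GP ipC.
Qed.

End form_sqrt.

(** * Integrals over the half-line *)

(** Caratheodory's form of differentiability: only continuity of the slope function [psi] at [x] has
    to be checked. *)
Lemma caratheodory_derive {R : realType} (f psi : R -> R) x (e : R) : 0 < e ->
  (forall y, `|y - x| < e -> f y - f x = (y - x) * psi y) ->
  {for x, continuous psi} -> is_derive x 1 f (psi x).
Proof.
move=> e0 fpsi cpsi.
have cvg : h^-1 *: ((f \o shift x) (h *: 1) - f x) @[h --> (0 : R)^'] --> psi x.
  have c1 : psi (h + x) @[h --> (0 : R)^'] --> psi x.
    apply/cvgrPdist_lt => eps eps0; have /cvgrPdist_lt/(_ _ eps0)/nbhs_ballP := cpsi.
    move=> [r /= r0 hr]; near=> h; apply: hr; rewrite /ball/= opprD addrCA subrr addr0 normrN.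
    by near: h; exact: dnbhs0_lt.
  apply: cvg_trans c1; apply: near_eq_cvg; near=> h.
  have h0 : h != 0 by near: h; exact: nbhs_dnbhs_neq.
  have he : `|h| < e by near: h; exact: dnbhs0_lt.
  rewrite /= /GRing.scale /= mulr1 fpsi ?addrK//.
  by rewrite mulKf.
apply: DeriveDef; first by apply/cvg_ex; exists (psi x).
exact/cvg_lim.
Unshelve. all: by end_near. Qed.

(** * Integrability on the half-line from a bounded antiderivative *)

Section FTC_halfline.
Context {R : realType}.
Notation mu := lebesgue_measure.
Variables (f F : R -> R) (L : R).
Hypothesis f_ge0 : forall s : R, 0 < s -> 0 <= f s.
Hypothesis f_cont : forall s : R, 0 < s -> {for s, continuous f}.
Hypothesis F_f : forall s : R, 0 < s -> is_derive s 1 F (f s).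
Hypothesis F_bound : forall s : R, 0 < s -> 0 <= F s <= L.

Lemma FTC_segment a b : 0 < a -> a < b ->
  (\int[mu]_(x in `[a, b]) (f x)%:E = (F b - F a)%:E)%E.
Proof.
move=> a0 ab.
have pos x : x \in `[a, b] -> 0 < x by rewrite in_itv/= => /andP[ax _]; apply: lt_le_trans ax.
have F_cont s : 0 < s -> {for s, continuous F}.
  move=> s0; apply/differentiable_continuous/derivable1_diffP.
  by have [] := F_f s0.
rewrite EFinB; apply: continuous_FTC2 => //.
- apply/continuous_within_itvP => //; split.
  + by move=> x xab; apply: f_cont; apply: pos; exact: subset_itv_oo_cc.
  + by apply: cvg_at_right_filter; exact: f_cont.
  + by apply: cvg_at_left_filter; apply: f_cont; exact: lt_trans ab.
- split.
  + move=> x xab; have x0 : 0 < x by apply: pos; exact: subset_itv_oo_cc.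
    by have [] := F_f x0.
  + by apply: cvg_at_right_filter; exact: F_cont.
  + by apply: cvg_at_left_filter; apply: F_cont; exact: lt_trans ab.
- move=> x xab; have x0 : 0 < x by apply: pos; exact: subset_itv_oo_cc.
  by rewrite derive1E; have [_] := F_f x0.
Qed.

Lemma measurable_halfline (k : R -> R) : (forall s : R, 0 < s -> {for s, continuous k}) ->
  measurable_fun (`]0, +oo[%classic : set R) k.
Proof.
move=> kc; apply: open_continuous_measurable_fun; first exact: interval_open.
by move=> s; rewrite inE /= in_itv/= andbT; exact: kc.
Qed.

Let mf : measurable_fun (`]0, +oo[%classic : set R) (fun x => (f x)%:E).
Proof. by apply/measurable_EFinP; exact: measurable_halfline. Qed.

Let f_ge0' x : `]0, +oo[%classic x -> (0 <= (f x)%:E)%E.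
Proof. by rewrite /= in_itv/= andbT lee_fin => /f_ge0. Qed.

Let I n : set R := `[n.+1%:R^-1, n.+2%:R].

Let I_sub n : I n `<=` `]0, +oo[%classic.
Proof.
move=> x; rewrite /I/= !in_itv/= andbT => /andP[h _].
by apply: lt_le_trans h.
Qed.

Let integral_le : (\int[mu]_(x in `]0%R, +oo[) (f x)%:E <= L%:E)%E.
Proof.
have -> : `]0%R, +oo[%classic = \bigcup_n I n.
  apply/seteqP; split=> [x|x [n _]]; last exact: I_sub.
  rewrite /= in_itv/= andbT => x0.
  exists (maxn (Num.truncn x^-1) (Num.truncn x)) => //.
  rewrite /I/= in_itv/=; apply/andP; split.
    rewrite -[leRHS]invrK lef_pV2 ?posrE ?invr_gt0//.
    apply: (le_trans (ltW (truncnS_gt _))).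
    by rewrite ler_nat ltnS leq_maxl.
  apply: (le_trans (ltW (truncnS_gt _))).
  by rewrite ler_nat ltnS (leq_trans (leq_maxr (Num.truncn x^-1) _)).
have mI n : measurable (I n) by exact: measurable_itv.
have mfI n : measurable_fun (I n) (fun x => (f x)%:E).
  by apply: measurable_funS mf => //; exact: I_sub.
have ndI : nondecreasing_seq I.
  move=> m n mn; rewrite subsetEset => x; rewrite /I/= !in_itv/= => /andP[h1 h2].
  apply/andP; split.
    by apply: le_trans h1; rewrite lef_pV2 ?posrE// ler_nat ltnS.
  by apply: (le_trans h2); rewrite ler_nat !ltnS.
have f0I n x : I n x -> (0 <= (f x)%:E)%E by move=> /I_sub; exact: f_ge0'.
have : (\int[mu]_(x in I n) (f x)%:E @[n --> \oo] -->
    \int[mu]_(x in \bigcup_n I n) (f x)%:E)%E.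
  exact: ge0_nondecreasing_set_cvg_integral.
move=> /(cvg_lim _)<- //; apply: lime_le.
  apply: ereal_nondecreasing_is_cvgn.
  exact: ge0_nondecreasing_set_nondecreasing_integral.
apply: nearW => n; have n0 : 0 < n.+1%:R^-1 :> R by [].
rewrite /I FTC_segment//; last first.
  by apply: (@le_lt_trans _ _ 1); rewrite ?ltr1n// invf_le1// ler1n.
rewrite lee_fin; have /andP[h1 _] := F_bound n0.
have /andP[_ h2] := F_bound (ltr0Sn R n.+1); lra.
Qed.

Lemma FTC_integrable : mu.-integrable `]0, +oo[%classic (EFin \o f).
Proof.
apply/integrableP; split=> //; apply: (@le_lt_trans _ _ L%:E); last exact: ltry.
apply: le_trans integral_le; rewrite le_eqVlt; apply/orP; left; apply/eqP.
by apply: eq_integral => x; rewrite inE => /f_ge0' fx; rewrite gee0_abs.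
Qed.

Lemma FTC_le : \int[mu]_(x in `]0, +oo[) f x <= L.
Proof.
rewrite /Rintegral -lee_fin fineK; first exact: integral_le.
exact: integrable_fin_num FTC_integrable.
Qed.

Lemma FTC_ge a b : 0 < a -> a < b -> F b - F a <= \int[mu]_(x in `]0, +oo[) f x.
Proof.
move=> a0 ab; rewrite /Rintegral -lee_fin fineK; last first.
  exact: integrable_fin_num FTC_integrable.
rewrite -FTC_segment//; apply: ge0_subset_integral => //.
by move=> x /=; rewrite in_itv/= => /andP[h _]; rewrite in_itv/= andbT; apply: lt_le_trans h.
Qed.

End FTC_halfline.

Lemma halfline_continuous {R : realType} (f k : R -> R) (c s : R) : 0 < s ->
  (forall t, 0 < t -> `|f s - f t| <= c * `|k s - k t|) ->
  {for s, continuous k} -> {for s, continuous f}.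
Proof.
move=> s0 fk kc; apply/cvgrPdist_lt => e e0.
have c0 : 0 < `|c| + 1 by rewrite ltr_wpDl.
have /cvgrPdist_lt/(_ (e / (`|c| + 1))) := kc.
rewrite divr_gt0// => /(_ isT) h1.
have h2 : \forall t \near s, 0 < t by exact: lt_nbhsr.
apply: filterS2 h1 h2 => t; rewrite ltr_pdivlMr// => h t0.
apply: (le_lt_trans (fk _ t0)); apply: le_lt_trans h; rewrite mulrC.
by rewrite ler_wpM2l// (le_trans (ler_norm c))// lerDl.
Qed.

(** * The integral of [g (1 + sqrt s g)^-2 / sqrt s] *)

Section positive_integral.
Context {R : realType} {H : hilbertType R}.
Notation mu := lebesgue_measure.
Variables (g : {linear H -> H}) (K : R -> {linear H -> H}).
Hypothesis g_sym : forall x y, ip (g x) y = ip x (g y).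
Hypothesis g_ge0 : forall x, 0 <= ip (g x) x.
Hypothesis g_le : forall x, nr (g x) <= 1 * nr x.
Hypothesis KE : forall p : R, 0 <= p -> forall x, K p x + p *r g (K p x) = x.

(** Chosen for its explicit antiderivative [2 * ip (x - K (sqrt s) x) x], which stays between 0 and
    [2 * nr x ^+ 2]. It stands in for the integrand [g (1 + s g^2)^-1 / sqrt s], to which
    [square_inverse_bounds] compares it. *)
Definition weight x (s : R) : R := ip (g (K (Num.sqrt s) (K (Num.sqrt s) x))) x / Num.sqrt s.

Lemma K_g (p : R) x : 0 <= p -> K p (g x) = g (K p x).
Proof. by move=> p0; rewrite -(inverse_comm g_ge0 p0 (KE p0)). Qed.

Let K_le (p : R) x : 0 <= p -> nr (K p x) <= nr x.
Proof. by move=> p0; exact: (inverse_le g_ge0 p0 (KE p0)). Qed.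

Let K_sym (p : R) x y : 0 <= p -> ip (K p x) y = ip x (K p y).
Proof. by move=> p0; exact: (inverse_sym g_sym (KE p0)). Qed.

Let K_diff (p r : R) x : 0 <= p -> 0 <= r ->
  K p x - K r x = (r - p) *r g (K p (K r x)).
Proof.
move=> p0 r0; have h1 := KE p0 (K r x); have h2 := congr1 (K p) (KE r0 x).
rewrite linearD (linZ (K p)) K_g// in h2.
apply: ip_ext => v; have := congr1 (ip ^~ v) h1; have := congr1 (ip ^~ v) h2.
by rewrite !ipE; lra.
Qed.

Lemma K_lip (p r : R) x : 0 <= p -> 0 <= r -> nr (K p x - K r x) <= `|p - r| * nr x.
Proof.
move=> p0 r0; rewrite K_diff// nrZr distrC; apply: ler_wpM2l => //.
have := g_le (K p (K r x)); have := K_le (K r x) p0; have := K_le x r0; lra.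
Qed.

Let weight_ip x (p : R) : 0 <= p -> ip (g (K p (K p x))) x = ip (g (K p x)) (K p x).
Proof. by move=> p0; rewrite -K_g// K_sym// K_g. Qed.

Lemma weight_ge0 x (s : R) : 0 < s -> 0 <= weight x s.
Proof. by move=> s0; rewrite /weight weight_ip ?sqrtr_ge0// divr_ge0 ?sqrtr_ge0. Qed.

Let F x (s : R) : R := 2 * ip (x - K (Num.sqrt s) x) x.

Let F_bound x (s : R) : 0 < s -> 0 <= F x s <= 2 * nr x ^+ 2.
Proof.
move=> s0; have p0 := sqrtr_ge0 s; set p := Num.sqrt s in p0 *; rewrite /F -/p !ipE ip_nr.
have h1 : 0 <= ip (K p x) x.
  rewrite -{2}(KE p0 x) !ipE ip_nr.
  have := g_ge0 (K p x); have := sqr_ge0 (nr (K p x)).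
  by rewrite (ipC (K p x)) => h1 h2; have := mulr_ge0 p0 h2; lra.
have h2 : ip (K p x) x <= nr x ^+ 2.
  by apply: (le_trans (ip_le _ _)); rewrite expr2 ler_wpM2r ?nr_ge0// K_le.
lra.
Qed.

Let ip_gKK x (p r q : R) : 0 <= p -> 0 <= r -> 0 <= q ->
  `|ip (g (K q (K p x))) x - ip (g (K q (K r x))) x| <= nr x ^+ 2 * `|p - r|.
Proof.
move=> p0 r0 q0; have -> : ip (g (K q (K p x))) x - ip (g (K q (K r x))) x =
    ip (g (K q (K p x - K r x))) x by rewrite !linearB !ipE.
apply: (le_trans (ip_abs _ _)); rewrite mulrC expr2 -mulrA ler_wpM2l ?nr_ge0//.
have := K_lip x p0 r0; have := K_le (K p x - K r x) q0.
have := g_le (K q (K p x - K r x)); lra.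
Qed.

Lemma weight_continuous x (s : R) : 0 < s -> {for s, continuous (weight x)}.
Proof.
move=> s0; apply: cvgM; last first.
  by apply: cvgV; [rewrite gt_eqF// sqrtr_gt0|exact: sqrt_continuous].
apply: (halfline_continuous (c := 2 * nr x ^+ 2) (k := Num.sqrt) s0) => [t t0|]; last first.
  exact: sqrt_continuous.
have p0 := sqrtr_ge0 s; have r0 := sqrtr_ge0 t.
set p := Num.sqrt s in p0 *; set r := Num.sqrt t in r0 *.
have h1 := ip_gKK x p0 r0 p0; have h2 := ip_gKK x p0 r0 r0.
have KK : K r (K p x) = K p (K r x).
  by rewrite -(inverse_comm g_ge0 r0 (KE r0))// => y; rewrite K_g.
rewrite KK in h2.
have := ler_distD (ip (g (K p (K r x))) x) (ip (g (K p (K p x))) x) (ip (g (K r (K r x))) x).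
lra.
Qed.

(** The derivative of [(1 + p g)^-1] in [p] is [- g (1 + p g)^-2]. The slope [psi] results from
    [K_diff] and [t - s = (sqrt t - sqrt s) (sqrt t + sqrt s)]. *)
Let F_weight x (s : R) : 0 < s -> is_derive s 1 (F x) (weight x s).
Proof.
move=> s0; have p0 := sqrtr_ge0 s; have p1 : 0 < Num.sqrt s by rewrite sqrtr_gt0.
pose psi t := 2 * (ip (g (K (Num.sqrt s) (K (Num.sqrt t) x))) x / (Num.sqrt t + Num.sqrt s)).
have -> : weight x s = psi s.
  by rewrite /psi /weight; field; rewrite !gt_eqF ?addr_gt0.
apply: (caratheodory_derive s0) => [t ts|].
  have t0 : 0 < t by move: ts; rewrite ltr_norml => /andP[]; lra.
  have r0 := sqrtr_ge0 t; have r1 : 0 < Num.sqrt t by rewrite sqrtr_gt0.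
  rewrite /F /psi.
  have -> : 2 * ip (x - K (Num.sqrt t) x) x - 2 * ip (x - K (Num.sqrt s) x) x =
    2 * ip (K (Num.sqrt s) x - K (Num.sqrt t) x) x by rewrite !ipE; ring.
  have -> : t - s = Num.sqrt t ^+ 2 - Num.sqrt s ^+ 2.
    by rewrite (sqr_sqrtr (ltW t0)) (sqr_sqrtr (ltW s0)).
  rewrite K_diff// ipZl.
  by field; rewrite gt_eqF// addr_gt0.
apply: cvgM; first exact: cvg_cst.
apply: cvgM; last first.
  apply: cvgV; first by rewrite gt_eqF// addr_gt0.
  by apply: cvgD; [exact: sqrt_continuous|exact: cvg_cst].
apply: (halfline_continuous (c := nr x ^+ 2) (k := Num.sqrt) s0) => [t t0|]; last first.
  exact: sqrt_continuous.
exact: ip_gKK (sqrtr_ge0 _) (sqrtr_ge0 _) p0.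
Qed.

Lemma weight_integrable x :
  lebesgue_measure.-integrable `]0, +oo[%classic (fun s => (weight x s)%:E).
Proof.
exact: (FTC_integrable (weight_ge0 x) (@weight_continuous x) (F_weight x) (F_bound x)).
Qed.

Lemma weight_integral_le x : \int[mu]_(s in `]0, +oo[) weight x s <= 2 * nr x ^+ 2.
Proof.
exact: FTC_le (weight_ge0 x) (@weight_continuous x) (F_weight x) (F_bound x).
Qed.

Hypothesis g_dense : forall x (e : R), 0 < e -> exists z, nr (x - g z) < e.

(** By density of the range of [g], [(1 + p g)^-1] tends strongly to 0, so [F x b] approaches
    [2 * nr x ^+ 2] for large [b]; and [F x] tends to 0 at 0. The points [b] and [q ^+ 2] make each
    error at most [e / 2]. *)
Lemma weight_integral_ge x : 2 * nr x ^+ 2 <= \int[mu]_(s in `]0, +oo[) weight x s.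
Proof.
apply/ler_addgt0Pr => e e0; set I := Rintegral _ _ _.
have ge a b : 0 < a -> a < b -> F x b - F x a <= I.
  by move=> a0 ab; exact: (FTC_ge (weight_ge0 x) (@weight_continuous x) (F_weight x) (F_bound x) a0 ab).
pose n1 : R := nr x + 1; have n10 : 0 < n1 by rewrite ltr_wpDl ?nr_ge0.
have nx : nr x <= n1 by rewrite lerDl.
have [|z xz] := g_dense x (e := e / (8 * n1)); first by rewrite divr_gt0// mulr_gt0.
pose b : R := (16 * n1 * nr z / e + 1) ^+ 2.
have b1 : 0 < 16 * n1 * nr z / e + 1.
  by rewrite ltr_wpDl// divr_ge0 ?(ltW e0)// !mulr_ge0 ?nr_ge0// ltW.
have sb : Num.sqrt b = 16 * n1 * nr z / e + 1 by rewrite sqrtr_sqr gtr0_norm.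
have b0 : 0 < b by rewrite exprn_gt0.
have Fb : 2 * nr x ^+ 2 - e / 2 <= F x b.
  set p := Num.sqrt b in sb *; have p0 : 0 < p by rewrite sb.
  have h1 : nr (K p (g z)) <= e / (8 * n1).
    have pgK : p *r g (K p z) = z - K p z.
      by apply/eqP; rewrite eq_sym subr_eq addrC KE// ltW.
    have h : p * nr (K p (g z)) <= 2 * nr z.
      rewrite -[X in X * _]gtr0_norm// -nrZr (K_g _ (ltW p0)) pgK.
      by have := ler_nrBD z (K p z); have := K_le z (ltW p0); lra.
    rewrite -ler_pdivlMl// in h; apply: (le_trans h); rewrite ler_pdivrMl//.
    rewrite sb; have -> : (16 * n1 * nr z / e + 1) * (e / (8 * n1)) = 2 * nr z + e / (8 * n1).
      by field; rewrite !gt_eqF.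
    by rewrite lerDl divr_ge0 ?(ltW e0)// mulr_ge0// ltW.
  have h2 : nr (K p x) <= e / (4 * n1).
    have -> : K p x = K p (x - g z) + K p (g z) by rewrite linearB subrK.
    apply: (le_trans (ler_nrD _ _)); have := K_le (x - g z) (ltW p0).
    have -> : e / (4 * n1) = e / (8 * n1) + e / (8 * n1) by field; rewrite gt_eqF.
    lra.
  rewrite /F -/p !ipE ip_nr; have h3 := ip_le (K p x) x.
  have h4 : nr (K p x) * nr x <= e / (4 * n1) * n1.
    by apply: ler_pM; rewrite ?nr_ge0.
  have h5 : e / (4 * n1) * n1 = e / 4 by field; rewrite gt_eqF.
  lra.
pose q : R := Num.min (Num.sqrt b / 2) (e / (4 * n1 ^+ 2)).
have q0 : 0 < q by rewrite lt_min !divr_gt0 ?sqrtr_gt0// mulr_gt0// exprn_gt0.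
have Fa : F x (q ^+ 2) <= e / 2.
  rewrite /F sqrtr_sqr gtr0_norm//.
  have -> : x - K q x = q *r g (K q x).
    by apply/eqP; rewrite subr_eq addrC KE// ltW.
  rewrite ipZl; have h1 := ip_le (g (K q x)) x.
  have h2 : nr (g (K q x)) <= nr x.
    by have := g_le (K q x); have := K_le x (ltW q0); lra.
  have h3 : ip (g (K q x)) x <= n1 ^+ 2.
    apply: (le_trans h1); rewrite expr2; apply: ler_pM; rewrite ?nr_ge0//.
    exact: le_trans h2 nx.
  have h4 : q <= e / (4 * n1 ^+ 2) by rewrite ge_min lexx orbT.
  have h5 : q * ip (g (K q x)) x <= e / (4 * n1 ^+ 2) * n1 ^+ 2.
    apply: (@le_trans _ _ (q * n1 ^+ 2)); first by rewrite ler_pM2l.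
    by rewrite ler_pM2r ?exprn_gt0.
  have h6 : e / (4 * n1 ^+ 2) * n1 ^+ 2 = e / 4 by field; rewrite gt_eqF.
  lra.
have ab : q ^+ 2 < b.
  rewrite -(sqr_sqrtr (ltW b0)) ltr_sqr ?nnegrE ?sqrtr_ge0 ?(ltW q0)//.
  have : q <= Num.sqrt b / 2 by rewrite ge_min lexx.
  by have : 0 < Num.sqrt b by [rewrite sqrtr_gt0]; lra.
have := ge _ _ (exprn_gt0 2 q0) ab; lra.
Qed.

End positive_integral.

Section square_inverse.
Context {R : realType} {H : hilbertType R}.
Variables (g K W : {linear H -> H}) (p : R).
Hypothesis p0 : 0 <= p.
Hypothesis g_sym : forall x y, ip (g x) y = ip x (g y).
Hypothesis g_ge0 : forall x, 0 <= ip (g x) x.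
Hypothesis KE : forall x, K x + p *r g (K x) = x.
Hypothesis WE : forall x, W x + (p ^+ 2) *r g (g (W x)) = x.

Let gg_ge0 x : 0 <= ip (g (g x)) x.
Proof. by rewrite g_sym ip_nr sqr_ge0. Qed.

(* [g (1 + p g)^-2 <= g (1 + p^2 g^2)^-1 <= 2 g (1 + p g)^-2], since
   [1 + p^2 t^2 <= (1 + p t)^2 <= 2 (1 + p^2 t^2)] for [t >= 0]. *)
Lemma square_inverse_bounds x :
  ip (g (K (K x))) x <= ip (g (W x)) x <= 2 * ip (g (K (K x))) x.
Proof.
have Kg y : K (g y) = g (K y) by rewrite (inverse_comm g_ge0 p0 KE).
(* In terms of [v = (1 + p g)^-2 (1 + p^2 g^2)^-1 x], every quantity is a combination of the
   nonnegative moments [ip (g^i v) v]. The left inequality then has nonnegative coefficients. *)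
pose v := K (K (W x)).
have wE : W x = v + (2 * p) *r g v + (p ^+ 2) *r g (g v).
  have h1 := KE (W x); have h2 := KE (K (W x)); rewrite -/v in h2.
  rewrite -h1 -h2 linearD (linZ g).
  by apply: ip_ext => z; rewrite !ipE; ring.
have xE : x = W x + (p ^+ 2) *r g (g (W x)) by rewrite WE.
have KKx : K (K x) = v + (p ^+ 2) *r g (g v).
  by rewrite {1}xE !linearD !(linZ K) !Kg.
have m0 y : 0 <= ip (g (g y)) y by exact: gg_ge0.
(* For the right inequality, with [v' = (1 - p^2 g^2) v], the difference is [ip (g v') v' + p ^+ 2 *
   ip (g (g v')) (g v')]. *)
pose v' := v - (p ^+ 2) *r g (g v).
have := g_ge0 v'; have := g_ge0 (g v'); rewrite KKx.
have -> : ip (g (W x)) x = ip (g (W x)) (W x + (p ^+ 2) *r g (g (W x))) by rewrite WE.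
have -> y : ip y x = ip y (W x + (p ^+ 2) *r g (g (W x))) by rewrite WE.
rewrite wE /v' !(linearD g, linearN g, linZ g).
rewrite !(ipDl, ipDr, ipZl, ipZr, ipNl, ipNr) -!g_sym.
have n1 := g_ge0 v; have n2 := m0 v.
have := g_ge0 (g v); rewrite -g_sym => n3.
have := m0 (g v); rewrite -g_sym => n4.
have := g_ge0 (g (g v)); rewrite -!g_sym => n5.
have := m0 (g (g v)); rewrite -!g_sym => n6.
have p2 : 0 <= p ^+ 2 by exact: sqr_ge0.
move: n2 n3 n4 n5 n6; set m2 := ip (g (g v)) v; set m3 := ip (g _) v; set m4 := ip (g _) v.
set m5 := ip (g _) v; set m6 := ip (g _) v; move=> n2 n3 n4 n5 n6.
have q1 := mulr_ge0 p0 n2; have q2 := mulr_ge0 p2 n3.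
have q3 := mulr_ge0 (mulr_ge0 p2 p0) n4; have q4 := mulr_ge0 (mulr_ge0 p2 p2) n5.
have q5 := mulr_ge0 (mulr_ge0 (mulr_ge0 p2 p2) p0) n6.
move=> r1 r2; have r3 := mulr_ge0 p2 r1.
apply/andP; split.
  move: q1 q2 q3 q4 q5; clear.
  lra.
move: r2 r3; clear.
lra.
Qed.

Lemma square_inverse_energy x : nr (W x) ^+ 2 + p ^+ 2 * nr (g (W x)) ^+ 2 <= nr x ^+ 2.
Proof.
have h : nr (W x) ^+ 2 + p ^+ 2 * nr (g (W x)) ^+ 2 = ip x (W x).
  have -> : ip x (W x) = ip (W x + p ^+ 2 *r g (g (W x))) (W x) by rewrite WE.
  by rewrite !ipE g_sym !ip_nr.
have q := mulr_ge0 (sqr_ge0 p) (sqr_ge0 (nr (g (W x)))).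
have h2 := ip_le x (W x); have := sqr_ge0 (nr x - nr (W x)); have := nr_ge0 x.
nra.
Qed.

Lemma square_inverse_comm y : g (W y) = W (g y).
Proof.
pose P : {linear H -> H} := g \o g.
have P0 x : 0 <= ip (P x) x by exact: gg_ge0.
exact: (@inverse_comm _ _ P P0 (p ^+ 2) W (sqr_ge0 p) WE).
Qed.

(** Cauchy-Schwarz for the positive operator [g W], in additive form so that only quadratic
    integrands remain to be integrated. *)
Lemma square_inverse_ip x y :
  `|ip x (g (W y))| <= (ip (g (W x)) x + ip (g (W y)) y) / 2.
Proof.
pose P : {linear H -> H} := g \o W; pose Q : {linear H -> H} := g \o g.
have W_sym u v : ip (W u) v = ip u (W v).
  apply: (@inverse_sym _ _ Q _ (p ^+ 2) W WE) => s t.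
  by rewrite /= !g_sym.
have P_sym u v : ip (P u) v = ip u (P v).
  by rewrite /P /= g_sym W_sym square_inverse_comm.
have P_ge0 u : 0 <= ip (P u) u.
  have -> : ip (P u) u = ip (g (W u)) (W u + (p ^+ 2) *r g (g (W u))) by rewrite WE.
  rewrite ipDr ipZr addr_ge0//; last rewrite mulr_ge0 ?sqr_ge0//.
  by rewrite -g_sym.
have h1 := ip_positive_le P_sym P_ge0 x y.
have h2 := ip_positive_le P_sym P_ge0 (- x) y.
rewrite linearN !ipE opprK in h2; rewrite ler_norml; move: h1 h2; rewrite /P /=; lra.
Qed.

End square_inverse.

(** * The square root of an elliptic operator *)

Section skew_part.
Context {R : realType} {V H : hilbertType R} {j : {linear V -> H}}.
Variables (a : V -> V -> R[i]) (Mb : R).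
Hypothesis aDl : forall u u' v : V, a (u + u') v = a u v + a u' v.
Hypothesis aZl : forall (c : R[i]) (u v : V), a (c *: u) v = c * a u v.
Hypothesis aDr : forall u v v' : V, a u (v + v') = a u v + a u v'.
Hypothesis aZr : forall (c : R[i]) (u v : V), a u (c *: v) = c^*%R * a u v.
Hypothesis Mb0 : 0 <= Mb.
Hypothesis Im_le : forall u : V, complex.Im (a u u) ^+ 2 <= (Mb * nr (j u) * nr u) ^+ 2.

Definition skew (u v : V) : R := (al a u v - al a v u) / 2.

Let Q (u : V) : R := complex.Im (a u u).

Let Q_le u (t : R) : 0 < t -> `|Q u| <= Mb / 2 * (t ^+ 2 * nr (j u) ^+ 2 + nr u ^+ 2 / t ^+ 2).
Proof.
move=> t0; have h : `|Q u| <= Mb * nr (j u) * nr u.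
  have b0 : 0 <= Mb * nr (j u) * nr u by rewrite !mulr_ge0 ?nr_ge0.
  by rewrite -(ger0_norm b0) -ler_sqr ?nnegrE// !real_normK ?num_real// Im_le.
apply: (le_trans h).
have := sqr_ge0 (t * nr (j u) - nr u / t).
have -> : (t * nr (j u) - nr u / t) ^+ 2 =
  (t ^+ 2 * nr (j u) ^+ 2 + nr u ^+ 2 / t ^+ 2) - 2 * (nr (j u) * nr u).
  by field; rewrite gt_eqF.
by move=> h1; have := mulr_ge0 Mb0 h1; lra.
Qed.

(* Polarisation of the numerical range: [skew] is the imaginary part of the
   Hermitian form with quadratic form [Im a(u, u)]. *)
Let skewE u v : skew u v = (Q (u - 'i%C *: v) - Q (u + 'i%C *: v)) / 4.
Proof.
have E y : Q y = al a y ('i%C *: y) by rewrite /Q (al_Im aZr).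
pose w := 'i%C *: v; have iw : 'i%C *: w = - v by rewrite scalerA -expr2 sqr_i scaleN1r.
have wi : al a w ('i%C *: u) = al a v u.
  by rewrite /w (al_i aZl aZr) scalerA -expr2 sqr_i scaleN1r (alNr aZr) opprK.
rewrite !E -/w scalerBr scalerDr iw opprK.
by rewrite !(alDl aDl, alDr aDr, alNl aZl, alNr aZr) wi /skew; field.
Qed.

(** Passing to [e u] and [e^-1 v] with [e = s^(1/4)] leaves [skew] unchanged. The weights come from
    [Q_le] at [t = e] and the parallelogram law; they fit the decay of resolvents when [s] is the
    resolvent parameter. *)
Lemma skew_le u v (s : R) : 0 < s -> `|skew u v| <=
  Mb / 4 * (s * nr (j u) ^+ 2 + nr u ^+ 2 + nr (j v) ^+ 2 + nr v ^+ 2 / s).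
Proof.
move=> s0; pose e := Num.sqrt (Num.sqrt s).
have e0 : 0 < e by rewrite !sqrtr_gt0.
have e4 : s = (e ^+ 2) ^+ 2 by rewrite /e !sqr_sqrtr ?sqrtr_ge0 ?(ltW s0).
have -> : skew u v = skew (e *r u) (e^-1 *r v).
  by rewrite /skew !(alZl aZl, alZr aZr); field; rewrite gt_eqF.
set u' := e *r u; set v' := 'i%C *: (e^-1 *r v).
have := Q_le (u' - v') e0; have := Q_le (u' + v') e0.
rewrite skewE normrM -/v' linearB linearD /=.
have p1 : nr (j u' + j v') ^+ 2 + nr (j u' - j v') ^+ 2 = 2 * (e ^+ 2 * nr (j u) ^+ 2 + nr (j v) ^+ 2 / e ^+ 2).
  have -> : j v' = 'i%C *: (e^-1 *r j v) by rewrite /v' (linZ j) (linZ j).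
  rewrite nrD2 nrB2 nrZi /u' (linZ j) !nrZr !gtr0_norm ?invr_gt0//.
  by field; rewrite gt_eqF.
have p2 : nr (u' + v') ^+ 2 + nr (u' - v') ^+ 2 = 2 * (e ^+ 2 * nr u ^+ 2 + nr v ^+ 2 / e ^+ 2).
  rewrite nrD2 nrB2 /v' nrZi !nrZr !gtr0_norm ?invr_gt0//.
  by field; rewrite gt_eqF.
move=> h1 h2; rewrite [X in _ * X]ger0_norm// ler_pdivrMr//.
apply: (le_trans (ler_normB _ _)).
have -> : s * nr (j u) ^+ 2 + nr u ^+ 2 + nr (j v) ^+ 2 + nr v ^+ 2 / s =
   e ^+ 2 * (e ^+ 2 * nr (j u) ^+ 2 + nr (j v) ^+ 2 / e ^+ 2) + (e ^+ 2 * nr u ^+ 2 + nr v ^+ 2 / e ^+ 2) / e ^+ 2.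
  by rewrite e4; field; rewrite gt_eqF.
apply: (le_trans (lerD h2 h1)).
have -> : Mb / 4 * (e ^+ 2 * (e ^+ 2 * nr (j u) ^+ 2 + nr (j v) ^+ 2 / e ^+ 2) +
   (e ^+ 2 * nr u ^+ 2 + nr v ^+ 2 / e ^+ 2) / e ^+ 2) * 4 =
   Mb / 2 * (e ^+ 2 * (nr (j u' + j v') ^+ 2 + nr (j u' - j v') ^+ 2) +
   (nr (u' + v') ^+ 2 + nr (u' - v') ^+ 2) / e ^+ 2).
  by rewrite p1 p2; field; rewrite gt_eqF.
lra.
Qed.

End skew_part.

(** Normalising both arguments trades the sum of squares for a product. *)
Lemma bilinear_le {R : realType} {H : hilbertType R} (B : H -> H -> R) C :
  (forall (c : R) x y, B (c *r x) y = c * B x y) ->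
  (forall (c : R) x y, B x (c *r y) = c * B x y) ->
  (forall x y, B x y <= C * (nr x ^+ 2 + nr y ^+ 2)) ->
  forall x y, B x y <= 2 * C * nr x * nr y.
Proof.
move=> BZl BZr B_le x y.
have unit z : nr z != 0 -> nr ((nr z)^-1 *r z) = 1.
  by move=> z0; rewrite nrZr ger0_norm ?invr_ge0 ?nr_ge0// mulVf.
have [x0|x0] := eqVneq (nr x) 0.
  by rewrite x0 mulr0 mul0r (nr0_eq0 x0) -(rs0 0) BZl mul0r.
have [y0|y0] := eqVneq (nr y) 0.
  by rewrite y0 mulr0 (nr0_eq0 y0) -(rs0 0) BZr mul0r.
have := B_le ((nr x)^-1 *r x) ((nr y)^-1 *r y).
rewrite !unit// BZl BZr => h.
have xy : 0 <= nr x * nr y by rewrite mulr_ge0 ?nr_ge0.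
have := ler_wpM2l xy h.
have -> : nr x * nr y * ((nr x)^-1 * ((nr y)^-1 * B x y)) = B x y by field; rewrite x0 y0.
lra.
Qed.

Section symmetric_part.
Context {R : realType} {V H : hilbertType R} {j : {linear V -> H}}.
Variables (a : V -> V -> R[i]) (la : R).

Definition sympart (u v : V) : R[i] :=
  (2^-1)%:C%C * (a u v + (a v u)^*%R) + la%:C%C * inner (j u) (j v).

Hypothesis aDl : forall u u' v : V, a (u + u') v = a u v + a u' v.
Hypothesis aZl : forall (c : R[i]) (u v : V), a (c *: u) v = c * a u v.
Hypothesis aDr : forall u v v' : V, a u (v + v') = a u v + a u v'.
Hypothesis aZr : forall (c : R[i]) (u v : V), a u (c *: v) = c^*%R * a u v.

Lemma al_sympart u v :
  al sympart u v = (al a u v + al a v u) / 2 + la * ip (j u) (j v).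
Proof.
rewrite /al /sympart /ip conjcE; case: (a u v) (a v u) (inner _ _) => [x y] [x' y'] [p q] /=.
by ring.
Qed.

Lemma sympartDl u u' v : sympart (u + u') v = sympart u v + sympart u' v.
Proof. by rewrite /sympart aDl aDr linearD innerDl rmorphD /=; ring. Qed.

Lemma sympartDr u v v' : sympart u (v + v') = sympart u v + sympart u v'.
Proof. by rewrite /sympart aDl aDr linearD innerDr rmorphD /=; ring. Qed.

Lemma sympartZl (c : R[i]) u v : sympart (c *: u) v = c * sympart u v.
Proof. by rewrite /sympart aZl aZr (linZ j) innerZl rmorphM /= conjCK; ring. Qed.

Lemma sympartZr (c : R[i]) u v : sympart u (c *: v) = c^*%R * sympart u v.
Proof. by rewrite /sympart aZl aZr (linZ j) innerZr rmorphM /=; ring. Qed.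

End symmetric_part.

(** * The inverse square root as a Balakrishnan integral *)

Section half_power.
Context {R : realType} {V H : hilbertType R} {j : {linear V -> H}}.
Variables (a : V -> V -> R[i]) (Mj M d w Mb la : R).
Hypothesis Mj0 : 0 <= Mj.
Hypothesis j_le : forall u : V, nr (j u) <= Mj * nr u.
Hypothesis j_inj : injective j.
Hypothesis j_dense : dense (range j).
Hypothesis aDl : forall u u' v : V, a (u + u') v = a u v + a u' v.
Hypothesis aZl : forall (c : R[i]) (u v : V), a (c *: u) v = c * a u v.
Hypothesis aDr : forall u v v' : V, a u (v + v') = a u v + a u v'.
Hypothesis aZr : forall (c : R[i]) (u v : V), a u (c *: v) = c^*%R * a u v.
Hypothesis M0 : 0 <= M.
Hypothesis al_le : forall u v : V, al a u v <= M * nr u * nr v.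
Hypothesis d0 : 0 < d.
Hypothesis w0 : 0 <= w.
Hypothesis al_ge : forall u : V, d * nr u ^+ 2 <= al a u u + w * nr (j u) ^+ 2.
Hypothesis Mb0 : 0 <= Mb.
Hypothesis Im_le : forall u : V, complex.Im (a u u) ^+ 2 <= (Mb * nr (j u) * nr u) ^+ 2.
Hypothesis la_w : 2 * w + 2 <= la.
Hypothesis la_C : 8 * (Mb * (1 + d^-1)) <= Num.sqrt la.

Let la0 : 0 < la. Proof. by have := w0; have := la_w; lra. Qed.

Notation h := (sympart (j := j) a la).

Let h_ge u : d * nr u ^+ 2 + (la - w) * nr (j u) ^+ 2 <= al h u u.
Proof. by rewrite al_sympart ip_nr; have := al_ge u; lra. Qed.

Let h_ge_d u : d * nr u ^+ 2 <= al h u u.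
Proof.
apply: le_trans (h_ge u); rewrite lerDl mulr_ge0 ?sqr_ge0//.
by have := w0; have := la_w; lra.
Qed.

Let h_j u : nr (j u) ^+ 2 <= al h u u.
Proof.
apply: le_trans (h_ge u); have := mulr_ge0 (ltW d0) (sqr_ge0 (nr u)).
have := sqr_ge0 (nr (j u)); have := w0; have := la_w => h1 h2 h3 h4.
have : 0 <= (la - w - 1) * nr (j u) ^+ 2 by rewrite mulr_ge0//; lra.
lra.
Qed.

Let h_sym u v : al h u v = al h v u.
Proof. by rewrite !al_sympart [ip (j u) _]ipC; ring. Qed.

Let Mh : R := M + la * Mj ^+ 2.

Let Mh0 : 0 <= Mh.
Proof. by rewrite addr_ge0// mulr_ge0 ?sqr_ge0// ltW. Qed.

Let h_le u v : al h u v <= Mh * nr u * nr v.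
Proof.
rewrite al_sympart /Mh; have h1 := al_le u v; have h2 := al_le v u.
have h3 : ip (j u) (j v) <= (Mj * nr u) * (Mj * nr v).
  by apply: (le_trans (ip_le _ _)); apply: ler_pM; rewrite ?nr_ge0.
have := ler_wpM2l (ltW la0) h3; lra.
Qed.

Let hDl := sympartDl (j := j) la aDl aDr.
Let hDr := sympartDr (j := j) la aDl aDr.
Let hZl := sympartZl (j := j) la aZl aZr.
Let hZr := sympartZr (j := j) la aZl aZr.

Lemma sympart_form_sqrt : exists (N : {linear H -> V}) (g : {linear H -> H}),
  [/\ [/\ forall x, j (N x) = g x, forall x y, al h (N x) (N y) = ip x y &
          forall v, exists x, N x = v],
      forall x v, al h (N (g x)) v = ip x (j v),
      forall x y, ip (g x) y = ip x (g y),
      forall x, 0 <= ip (g x) x & forall x, nr (g x) <= 1 * nr x].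
Proof. exact: (form_sqrt Mj0 j_le j_inj j_dense hDl hZl hDr hZr Mh0 h_le d0 h_ge_d h_sym h_j). Qed.

Variable Rs : R -> {linear H -> V}.
Hypothesis RsP : forall s, w <= s ->
  forall x v, s * ip (j (Rs s x)) (j v) + al a (Rs s x) v = ip x (j v).

Variables (N : {linear H -> V}) (g : {linear H -> H}).
Hypothesis jN : forall x, j (N x) = g x.
Hypothesis hNN : forall x y, al h (N x) (N y) = ip x y.
Hypothesis N_onto : forall v, exists x, N x = v.
Hypothesis hNg : forall x v, al h (N (g x)) v = ip x (j v).
Hypothesis g_sym : forall x y, ip (g x) y = ip x (g y).
Hypothesis g_ge0 : forall x, 0 <= ip (g x) x.
Hypothesis g_le : forall x, nr (g x) <= 1 * nr x.
Variables K W : R -> {linear H -> H}.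
Hypothesis KE : forall p : R, 0 <= p -> forall x, K p x + p *r g (K p x) = x.
Hypothesis WE : forall p : R, 0 <= p -> forall x, W p x + (p ^+ 2) *r g (g (W p x)) = x.

Let S (s : R) := Rs (s + la).

Let ws s : 0 < s -> w <= s + la.
Proof. by have := w0; have := la_w; lra. Qed.

(** Write [z = y + s g^2 y] with [y = W z]. The part [s g^2 y] supplies the term
    [s * ip (j u) (g y)] missing from the resolvent equation tested with [N y]; replacing [al a] by
    its symmetric part leaves [skew]. *)
Let form_split s x z : 0 < s ->
  al h (S s x) (N z) = ip x (g (W (Num.sqrt s) z)) - skew a (S s x) (N (W (Num.sqrt s) z)).
Proof.
move=> s0; set y := W _ z; set u := S s x.
have zE : z = y + s *r g (g y).
  by rewrite -(sqr_sqrtr (ltW s0)) WE// sqrtr_ge0.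
have e1 := RsP (ws s0) x (N y); rewrite -/u jN in e1.
have e2 : al h u (N (g (g y))) = ip (j u) (g y) by rewrite h_sym hNg ipC.
have e3 := al_sympart (j := j) a la u (N y); rewrite jN in e3.
rewrite zE linearD (linZ N) (alDr hDr) (alZr hZr) e2 /skew; lra.
Qed.

Let jS_le s x : 0 < s -> nr (j (S s x)) <= 2 / (s + la) * nr x.
Proof.
move=> s0; have sl : 0 < s + la by rewrite addr_gt0.
have := res_le d0 al_ge RsP x (ws s0); rewrite -/(S s x) => h1.
rewrite mulrAC ler_pdivlMr//; have : (s + la) <= 2 * (s + la - w).
  by have := w0; have := la_w; lra.
by move/(ler_wpM2r (nr_ge0 (j (S s x)))); lra.
Qed.

Let S_le s x : 0 < s -> nr (S s x) <= Mj / d * nr x.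
Proof.
move=> s0; have [->|] := eqVneq (nr (S s x)) 0.
  by rewrite !mulr_ge0 ?nr_ge0 ?invr_ge0 ?(ltW d0).
rewrite neq_lt ltNge nr_ge0/= => n0; rewrite mulrAC ler_pdivlMr// -(ler_pM2r n0).
have h1 := res_energy al_ge RsP x (ws s0); rewrite -/(S s x) in h1.
have h2 : ip x (j (S s x)) <= nr x * (Mj * nr (S s x)).
  by apply: (le_trans (ip_le _ _)); rewrite ler_wpM2l ?nr_ge0.
have h3 : 0 <= (s + la - w) * nr (j (S s x)) ^+ 2.
  by rewrite mulr_ge0 ?sqr_ge0// subr_ge0 ws.
by rewrite -mulrA (mulrC d) mulrA -expr2 mulrC; lra.
Qed.

Let S_lip s t x : 0 < s -> 0 < t ->
  nr (S s x - S t x) <= Mj * (Mj / d) ^+ 2 * nr x * `|s - t|.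
Proof.
move=> s0 t0; have e := res_id aDl aZl d0 al_ge RsP x (ws s0) (ws t0).
have -> : S s x - S t x = (t - s) *r S s (j (S t x)).
  have e' : S t x = S s x + (s + la - (t + la)) *r S s (j (S t x)).
    by rewrite /S {1}e linearD (linZ (Rs _)).
  by rewrite {1}e'; apply: ip_ext => v; rewrite !ipE; ring.
rewrite nrZr distrC mulrC ler_wpM2r//; have h1 := S_le (j (S t x)) s0.
have c0 : 0 <= Mj / d by rewrite divr_ge0// ltW.
have h2 := ler_wpM2l c0 (j_le (S t x)).
have h3 := ler_wpM2l (mulr_ge0 c0 Mj0) (S_le x t0).
by move: h1 h2 h3; move: (Mj / d) => q; lra.
Qed.

(** In [skew_le] with weight [s + la], each of the four terms is of order [1 / (s + la)]: by the
    resolvent estimates for [u], and by [square_inverse_energy] with the ellipticity of [h] for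
    [N y]. *)
Let skew_bound s x z : 0 < s ->
  `|skew a (S s x) (N (W (Num.sqrt s) z))| <=
  Mb * (1 + d^-1) * (nr x ^+ 2 + nr z ^+ 2) / (s + la).
Proof.
move=> s0; have sl : 0 < s + la by rewrite addr_gt0.
set u := S s x; set y := W _ z.
apply: (le_trans (skew_le aDl aZl aDr aZr Mb0 Im_le u (N y) sl)).
have i0 : 0 < d^-1 by rewrite invr_gt0.
have ju := jS_le x s0; rewrite -/u in ju.
have b1 : (s + la) * nr (j u) ^+ 2 <= 4 * nr x ^+ 2 / (s + la).
  have -> : 4 * nr x ^+ 2 / (s + la) = (s + la) * (2 / (s + la) * nr x) ^+ 2.
    by field; rewrite gt_eqF.
  rewrite ler_pM2l//; apply: lerXn2r; rewrite ?nnegrE ?nr_ge0//.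
  by rewrite mulr_ge0 ?nr_ge0// divr_ge0// ltW.
have b2 : nr u ^+ 2 <= 2 * d^-1 * nr x ^+ 2 / (s + la).
  have h1 := res_energy al_ge RsP x (ws s0); rewrite -/(S s x) -/u in h1.
  have h2 : ip x (j u) <= nr x * (2 / (s + la) * nr x).
    by apply: (le_trans (ip_le _ _)); rewrite ler_wpM2l ?nr_ge0.
  have h3 : 0 <= (s + la - w) * nr (j u) ^+ 2.
    by rewrite mulr_ge0 ?sqr_ge0// subr_ge0 ws.
  have -> : 2 * d^-1 * nr x ^+ 2 / (s + la) = (nr x * (2 / (s + la) * nr x)) / d.
    by field; rewrite !gt_eqF.
  by rewrite ler_pdivlMr//; lra.
have en := square_inverse_energy g_sym (WE (sqrtr_ge0 s)) z.
rewrite -/y sqr_sqrtr ?(ltW s0)// in en.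
have hy := h_ge (N y); rewrite hNN ip_nr jN in hy.
have y0 := sqr_ge0 (nr y); have gy0 := sqr_ge0 (nr (g y)); have Ny0 := mulr_ge0 (ltW d0) (sqr_ge0 (nr (N y))).
have sgy := mulr_ge0 (ltW s0) gy0.
have lgy : la * nr (g y) ^+ 2 <= 2 * nr z ^+ 2.
  have : 0 <= (la - 2 * w) * nr (g y) ^+ 2 by rewrite mulr_ge0//; have := la_w; lra.
  by lra.
have b3 : nr (g y) ^+ 2 <= 3 * nr z ^+ 2 / (s + la) by rewrite ler_pdivlMr//; lra.
have b4 : nr (N y) ^+ 2 / (s + la) <= d^-1 * nr z ^+ 2 / (s + la).
  rewrite ler_pM2r ?invr_gt0// mulrC ler_pdivlMr//.
  have : 0 <= (la - w) * nr (g y) ^+ 2.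
    by rewrite mulr_ge0//; have := w0; have := la_w; lra.
  lra.
have il : 0 <= (s + la)^-1 by rewrite invr_ge0 ltW.
have x0 := mulr_ge0 (sqr_ge0 (nr x)) il; have z0 := mulr_ge0 (sqr_ge0 (nr z)) il.
have x1 := mulr_ge0 (ltW i0) x0; have z1 := mulr_ge0 (ltW i0) z0.
rewrite jN; have := lerD (lerD (lerD b1 b2) b3) b4 => hs.
have mb4 : 0 <= Mb / 4 by rewrite divr_ge0.
apply: (le_trans (ler_wpM2l mb4 hs)).
have -> : Mb * (1 + d^-1) * (nr x ^+ 2 + nr z ^+ 2) / (s + la) =
  Mb / 4 * ((4 + 4 * d^-1) * (nr x ^+ 2 + nr z ^+ 2) / (s + la)).
  by field; rewrite !gt_eqF.
by apply: ler_wpM2l => //; lra.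
Qed.

Let kap : R := (Num.sqrt la)^-1.

Let sla0 : 0 < Num.sqrt la. Proof. by rewrite sqrtr_gt0. Qed.

Let kap0 : 0 < kap. Proof. by rewrite invr_gt0. Qed.

(** A scalar operator: with it, the integral estimates made for [g] also serve to integrate
    [(s + la)^-1 / sqrt s]. *)
Let g1 : {linear H -> H} := *:%R (kap%:C)%C.
Let K1 (p : R) : {linear H -> H} := *:%R ((1 + p * kap)^-1%:C)%C.

Let g1_sym x y : ip (g1 x) y = ip x (g1 y).
Proof. by rewrite ipZl ipZr. Qed.

Let g1_ge0 x : 0 <= ip (g1 x) x.
Proof. by rewrite ipZl ip_nr mulr_ge0 ?sqr_ge0 ?(ltW kap0). Qed.

Let g1_le x : nr (g1 x) <= 1 * nr x.
Proof.
rewrite nrZr gtr0_norm// ler_wpM2r ?nr_ge0// invf_le1//.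
have la1 : 1 <= la by have := w0; have := la_w; lra.
by rewrite -(sqrtr1 R) ler_wsqrtr.
Qed.

Let K1E p : 0 <= p -> forall x, K1 p x + p *r g1 (K1 p x) = x.
Proof.
move=> p0 x; have pk : 0 < 1 + p * kap by rewrite ltr_wpDr// mulr_ge0// ltW.
by apply: ip_ext => y; rewrite !(ipDl, ipZl); field; rewrite gt_eqF.
Qed.

Let E x s : R := weight g1 K1 x s.

(** This is [(sqrt s + sqrt la) ^+ 2 <= 2 * (s + la)]. *)
Let E_ge x s : 0 < s -> nr x ^+ 2 / (s + la) / Num.sqrt s <= 2 * kap * E x s.
Proof.
move=> s0; have p0 : 0 < Num.sqrt s by rewrite sqrtr_gt0.
have s2 := sqr_sqrtr (ltW s0); have la2 := sqr_sqrtr (ltW la0).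
rewrite /E /weight !ipZl ip_nr mulrA ler_pM2r ?invr_gt0// /kap.
move: (Num.sqrt s) (Num.sqrt la) p0 s2 sla0 la2 => p q p0 s2 q0 la2.
have pq : 0 < q + p by rewrite addr_gt0.
have -> : 2 / q * (q^-1 * ((1 + p / q)^-1 * ((1 + p / q)^-1 * nr x ^+ 2))) =
  nr x ^+ 2 * (2 / (q + p) ^+ 2).
  by field; rewrite !gt_eqF ?addr_gt0 ?divr_gt0.
rewrite ler_wpM2l ?sqr_ge0// ler_pdivlMr ?exprn_gt0//.
rewrite ler_pdivrMl ?addr_gt0// -s2 -la2.
by have := sqr_ge0 (p - q); lra.
Qed.

Let phi x z (s : R) : R := al h (S s x) (N z) / Num.sqrt s.

(** The relative size of the skew part, of order [la^(-1/2)]; the factor 8 in [la_C] is what brings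
    it down to [4^-1]. *)
Let c1 : R := 2 * kap * (Mb * (1 + d^-1)).

Let c1_ge0 : 0 <= c1.
Proof. by rewrite !mulr_ge0 ?(ltW kap0)// addr_ge0// invr_ge0 ltW. Qed.

Let c1_le : c1 <= 4^-1.
Proof.
rewrite /c1 mulrAC ler_pdivrMr//; have := la_C; lra.
Qed.

Let skew_term x z s : 0 < s ->
  `|skew a (S s x) (N (W (Num.sqrt s) z))| / Num.sqrt s <= c1 * (E x s + E z s).
Proof.
move=> s0; have p0 : 0 < Num.sqrt s by rewrite sqrtr_gt0.
have C0 : 0 <= Mb * (1 + d^-1) by rewrite mulr_ge0// addr_ge0// invr_ge0 ltW.
have h1 := ler_wpM2l C0 (lerD (E_ge x s0) (E_ge z s0)).
have ip0' : 0 <= (Num.sqrt s)^-1 by rewrite invr_ge0 ltW.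
have := ler_wpM2r ip0' (skew_bound x z s0); rewrite /c1; lra.
Qed.

Let bounds x s : 0 < s ->
  weight g K x s <= ip x (g (W (Num.sqrt s) x)) / Num.sqrt s <= 2 * weight g K x s.
Proof.
move=> s0; have p0 : 0 < Num.sqrt s by rewrite sqrtr_gt0.
have /andP[h1 h2] := square_inverse_bounds (ltW p0) g_sym g_ge0 (KE (ltW p0)) (WE (ltW p0)) x.
by rewrite ipC /weight mulrA !ler_pM2r ?invr_gt0// h1.
Qed.

Let phi_le x z s : 0 < s ->
  `|phi x z s| <= weight g K x s + weight g K z s + c1 * (E x s + E z s).
Proof.
move=> s0; have p0 : 0 < Num.sqrt s by rewrite sqrtr_gt0.
have ip0' : 0 <= (Num.sqrt s)^-1 by rewrite invr_ge0 ltW.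
rewrite /phi form_split// normrM (ger0_norm ip0').
have h1 := square_inverse_ip g_sym g_ge0 (WE (sqrtr_ge0 s)) x z.
have h2 := ler_normB (ip x (g (W (Num.sqrt s) z))) (skew a (S s x) (N (W (Num.sqrt s) z))).
have := ler_wpM2r ip0' h2; have := ler_wpM2r ip0' h1.
have := skew_term x z s0; have /andP[_ b1] := bounds x s0; have /andP[_ b2] := bounds z s0.
move: b1 b2; rewrite ipC (ipC z); lra.
Qed.

Let phi_ge x s : 0 < s -> weight g K x s - c1 * (E x s + E x s) <= phi x x s.
Proof.
move=> s0; have p0 : 0 < Num.sqrt s by rewrite sqrtr_gt0.
have ip0' : 0 <= (Num.sqrt s)^-1 by rewrite invr_ge0 ltW.
rewrite /phi form_split// mulrBl.
have := ler_wpM2r ip0' (ler_norm (skew a (S s x) (N (W (Num.sqrt s) x)))).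
have := skew_term x x s0; have /andP[b1 _] := bounds x s0; lra.
Qed.

Notation mu := lebesgue_measure.

Let al_abs u v : `|al h u v| <= Mh * nr u * nr v.
Proof. by rewrite ler_norml h_le andbT lerNl -(alNl hZl) -(nrN u) h_le. Qed.

Let phi_continuous x z s : 0 < s -> {for s, continuous (phi x z)}.
Proof.
move=> s0; apply: cvgM; last first.
  by apply: cvgV; [rewrite gt_eqF// sqrtr_gt0|exact: sqrt_continuous].
apply: (halfline_continuous (c := Mh * (Mj * (Mj / d) ^+ 2 * nr x) * nr (N z)) (k := id) s0) => [t t0|]; last first.
  by [].
have -> : al h (S s x) (N z) - al h (S t x) (N z) = al h (S s x - S t x) (N z).
  by rewrite (alDl hDl) (alNl hZl).
apply: (le_trans (al_abs _ _)).
have h1 := S_lip x s0 t0; have := ler_wpM2r (nr_ge0 (N z)) (ler_wpM2l Mh0 h1).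
rewrite -!mulrA (mulrC `|s - t|); exact.
Qed.

Let w_int x : mu.-integrable `]0, +oo[%classic (fun s => (weight g K x s)%:E).
Proof. exact: weight_integrable g_sym g_ge0 g_le KE x. Qed.

Let E_int x : mu.-integrable `]0, +oo[%classic (fun s => (E x s)%:E).
Proof. exact: weight_integrable g1_sym g1_ge0 g1_le K1E x. Qed.

Let D_int (f k : R -> R) : mu.-integrable `]0, +oo[%classic (fun s => (f s)%:E) ->
  mu.-integrable `]0, +oo[%classic (fun s => (k s)%:E) ->
  mu.-integrable `]0, +oo[%classic (fun s => (f s + k s)%:E).
Proof.
move=> fi ki.
rewrite (_ : (fun s => _) = ((fun s => (f s)%:E) \+ (fun s => (k s)%:E))%E)//.
exact: integrableD.
Qed.

Let Z_int (c : R) (f : R -> R) : mu.-integrable `]0, +oo[%classic (fun s => (f s)%:E) ->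
  mu.-integrable `]0, +oo[%classic (fun s => (c * f s)%:E).
Proof.
move=> fi; rewrite (_ : (fun s => _) = (fun s => c%:E * (f s)%:E)%E)//.
exact: integrableZl.
Qed.

Let ID (f k : R -> R) : mu.-integrable `]0, +oo[%classic (fun s => (f s)%:E) ->
  mu.-integrable `]0, +oo[%classic (fun s => (k s)%:E) ->
  \int[mu]_(s in `]0, +oo[) (f s + k s) =
  \int[mu]_(s in `]0, +oo[) f s + \int[mu]_(s in `]0, +oo[) k s.
Proof. exact: RintegralD. Qed.

Let IZ (c : R) (f : R -> R) : mu.-integrable `]0, +oo[%classic (fun s => (f s)%:E) ->
  \int[mu]_(s in `]0, +oo[) (c * f s) = c * \int[mu]_(s in `]0, +oo[) f s.
Proof. exact: RintegralZl. Qed.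

Let I_le (f k : R -> R) : mu.-integrable `]0, +oo[%classic (fun s => (f s)%:E) ->
  mu.-integrable `]0, +oo[%classic (fun s => (k s)%:E) ->
  (forall s : R, 0 < s -> f s <= k s) ->
  \int[mu]_(s in `]0, +oo[) f s <= \int[mu]_(s in `]0, +oo[) k s.
Proof.
move=> fi ki fk; apply: le_Rintegral => // s /=.
by rewrite in_itv/= andbT; exact: fk.
Qed.

Let major x z s := weight g K x s + weight g K z s + c1 * (E x s + E z s).

Let major_int x z : mu.-integrable `]0, +oo[%classic (fun s => (major x z s)%:E).
Proof. by apply: D_int; [exact: D_int|apply: Z_int; exact: D_int]. Qed.

Let le_int (f k : R -> R) : (forall s : R, 0 < s -> {for s, continuous f}) ->
  (forall s : R, 0 < s -> `|f s| <= k s) ->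
  mu.-integrable `]0, +oo[%classic (fun s => (k s)%:E) ->
  mu.-integrable `]0, +oo[%classic (fun s => (f s)%:E).
Proof.
move=> fc fk; apply: le_integrable => //.
  by apply/measurable_EFinP; exact: measurable_halfline.
move=> s /=; rewrite in_itv/= andbT => s0; rewrite lee_fin.
by apply: (le_trans (fk _ s0)); exact: ler_norm.
Qed.

Let phi_int x z : mu.-integrable `]0, +oo[%classic (fun s => (phi x z s)%:E).
Proof.
by apply: le_int (major_int x z) => s s0; [exact: phi_continuous|exact: phi_le].
Qed.

Let E_le x : \int[mu]_(s in `]0, +oo[) E x s <= 2 * nr x ^+ 2.
Proof. exact: weight_integral_le g1_sym g1_ge0 g1_le K1E x. Qed.

Let w_le x : \int[mu]_(s in `]0, +oo[) weight g K x s <= 2 * nr x ^+ 2.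
Proof. exact: weight_integral_le g_sym g_ge0 g_le KE x. Qed.

Let w_ge x : 2 * nr x ^+ 2 <= \int[mu]_(s in `]0, +oo[) weight g K x s.
Proof.
apply: weight_integral_ge g_sym g_ge0 g_le KE _ x => {}x e e0.
have [_ [v _ <-] xv] := dense_nr j_dense x e0.
by have [z zv] := N_onto v; exists z; rewrite -jN zv.
Qed.

Let beta x z : R := pi^-1 * \int[mu]_(s in `]0, +oo[) phi x z s.

Let pi0 : 0 < pi^-1 :> R. Proof. by rewrite invr_gt0 pi_gt0. Qed.

Let betaDl x y z : beta (x + y) z = beta x z + beta y z.
Proof.
rewrite /beta -mulrDr -ID; [|exact: phi_int|exact: phi_int]; congr (_ * _).
by apply: eq_Rintegral => s _; rewrite /phi linearD (alDl hDl) mulrDl.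
Qed.

Let betaDr x y z : beta z (x + y) = beta z x + beta z y.
Proof.
rewrite /beta -mulrDr -ID; [|exact: phi_int|exact: phi_int]; congr (_ * _).
by apply: eq_Rintegral => s _; rewrite /phi linearD (alDr hDr) mulrDl.
Qed.

Let betaZl (c : R) x z : beta (c *r x) z = c * beta x z.
Proof.
rewrite /beta mulrCA -(IZ c); last exact: phi_int.
congr (_ * _).
by apply: eq_Rintegral => s _; rewrite /phi (linZ (S s)) (alZl hZl) mulrA.
Qed.

Let betaZr (c : R) x z : beta z (c *r x) = c * beta z x.
Proof.
rewrite /beta mulrCA -(IZ c); last exact: phi_int.
congr (_ * _).
by apply: eq_Rintegral => s _; rewrite /phi (linZ N) (alZr hZr) mulrA.
Qed.

Let beta_i x z : beta ('i%C *: x) z = - beta x ('i%C *: z).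
Proof.
rewrite /beta -mulrN -mulN1r -(IZ (-1)); last exact: phi_int.
congr (_ * _).
apply: eq_Rintegral => s _.
by rewrite /phi (linZ (S s)) (linZ N) (al_i hZl hZr) mulN1r mulNr.
Qed.

(** The symmetric part contributes at least [2 * nr x ^+ 2], and the skew part removes at most
    [4 * c1 * nr x ^+ 2 <= nr x ^+ 2]. *)
Let beta_ge x : pi^-1 * nr x ^+ 2 <= beta x x.
Proof.
rewrite ler_pM2l//.
have low : \int[mu]_(s in `]0, +oo[) (weight g K x s + (- c1) * (E x s + E x s)) <=
    \int[mu]_(s in `]0, +oo[) phi x x s.
  apply: I_le (phi_int x x) _ => [|s s0].
    by apply: D_int => //; apply: Z_int; exact: D_int.
  by have := phi_ge x s0; lra.
apply: le_trans low; rewrite ID; [|exact: w_int|by apply: Z_int; exact: D_int].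
rewrite IZ; last exact: D_int.
rewrite ID//.
have h1 := E_le x; have h2 := w_ge x.
have := ler_wpM2l c1_ge0 (lerD h1 h1).
have := ler_wpM2r (sqr_ge0 (nr x)) c1_le; lra.
Qed.

Let beta_le0 x z : beta x z <= pi^-1 * 3 * (nr x ^+ 2 + nr z ^+ 2).
Proof.
rewrite -mulrA ler_pM2l//.
have up : \int[mu]_(s in `]0, +oo[) phi x z s <= \int[mu]_(s in `]0, +oo[) major x z s.
  apply: I_le (phi_int x z) (major_int x z) _ => s s0.
  by apply: le_trans (phi_le x z s0); exact: ler_norm.
apply: (le_trans up); rewrite /major ID; [|exact: D_int|by apply: Z_int; exact: D_int].
rewrite IZ; last exact: D_int.
rewrite !ID//.
have h1 := E_le x; have h2 := w_le x; have h3 := E_le z; have h4 := w_le z.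
have := ler_wpM2l c1_ge0 (lerD h1 h3).
have := sqr_ge0 (nr x); have := sqr_ge0 (nr z).
have := ler_wpM2r (addr_ge0 (sqr_ge0 (nr x)) (sqr_ge0 (nr z))) c1_le; lra.
Qed.

Let cb : R := 2 * (pi^-1 * 3).

Let beta_le x z : beta x z <= cb * nr x * nr z.
Proof. exact: (bilinear_le betaZl (fun c x y => betaZr c y x) beta_le0 x z). Qed.

Let cb0 : 0 <= cb. Proof. by rewrite /cb !mulr_ge0// ltW. Qed.

(** [Z] represents [beta]. Coercivity makes it onto by Lax-Milgram, which is how the range of the
    inverse square root becomes the whole of [j V]. *)
Let half_power_exists : exists Z : {linear H -> H},
  [/\ forall x z, beta x z = ip (Z x) z,
      forall x, pi^-1 * nr x <= nr (Z x), forall x, nr (Z x) <= cb * nr x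
    & forall y, exists x, Z x = y].
Proof.
have ex x : exists y, forall z, beta x z = ip y z.
  apply: (@riesz _ _ (beta x) (cb * nr x)).
  - by rewrite mulr_ge0 ?nr_ge0.
  - by move=> y z; exact: betaDr.
  - by move=> c z; exact: betaZr.
  - exact: beta_le.
have [f hf] := choice ex.
have [Z hZ] : exists Z : {linear H -> H}, Z =1 f.
  apply: complex_linear => [x y|c x|x]; apply: ip_ext => z.
  - by rewrite ipDl -!hf betaDl.
  - by rewrite ipZl -!hf betaZl.
  - by rewrite ip_iN -!hf beta_i.
have ZP x z : beta x z = ip (Z x) z by rewrite hZ hf.
exists Z; split=> // [x|x|y].
- have := beta_ge x; rewrite ZP => h1; have h2 := ip_le (Z x) x.
  have [->|] := eqVneq (nr x) 0; first by rewrite mulr0 nr_ge0.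
  rewrite neq_lt ltNge nr_ge0/= => n0; rewrite -(ler_pM2r n0) -mulrA -expr2.
  exact: le_trans h1 h2.
- have h1 := beta_le x (Z x); rewrite ZP ip_nr in h1.
  have [->|] := eqVneq (nr (Z x)) 0; first by rewrite mulr_ge0 ?nr_ge0.
  by rewrite neq_lt ltNge nr_ge0/= => n0; rewrite -(ler_pM2r n0) -expr2.
- have [u hu] := lax_milgram cb0 betaDl betaZl betaDr betaZr beta_le pi0 beta_ge y.
  by exists u; apply: ip_ext => v; rewrite -ZP hu.
Qed.

Notation A := (op_shift la (form_op j a)).

Lemma shifted_resolventP s x y : 0 <= s -> op_shift s A (y, x) <-> y = j (Rs (s + la) x).
Proof.
move=> s0; have wsl : w <= s + la by have := w0; have := la_w; lra.
rewrite /op_shift /=; have := form_opP aDl aZl aZr d0 al_ge RsP y (x - s *r y - la *r y) wsl.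
suff -> : x - s *r y - la *r y + (s + la) *r y = x by [].
by apply: ip_ext => v; rewrite !ipE; ring.
Qed.

Let bounded_inverseP s (T : {linear H -> H}) : 0 <= s ->
  op_bounded_inverse (op_shift s A) T <-> forall x, T x = j (Rs (s + la) x).
Proof.
move=> s0; split=> [[_ hT] x|TE].
  by apply/(shifted_resolventP _ _ s0)/hT.
split=> [|x y].
  apply: (lipschitz_continuous (M := 1)) => x; rewrite TE mul1r.
  have wsl : w <= s + la by have := w0; have := la_w; lra.
  have := res_le d0 al_ge RsP x wsl.
  have h1 : 1 <= s + la - w by have := w0; have := la_w; lra.
  have := ler_wpM2r (nr_ge0 (j (Rs (s + la) x))) h1; lra.
by rewrite (shifted_resolventP _ _ s0) TE.
Qed.

Lemma shifted_form_positive_op : positive_op A.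
Proof.
exists 1 => s s0; exists (j \o Rs (s + la)); first exact/bounded_inverseP.
move=> x; rewrite !nrE -rmorphM lecR /=.
have wsl : w <= s + la by have := w0; have := la_w; lra.
have := res_le d0 al_ge RsP x wsl; rewrite div1r ler_pdivlMl; last lra.
have h1 : 1 + s <= s + la - w by have := w0; have := la_w; lra.
have := ler_wpM2r (nr_ge0 (j (Rs (s + la) x))) h1; lra.
Qed.

Section negpower.
Variable Z : {linear H -> H}.
Hypothesis ZP : forall x z, beta x z = ip (Z x) z.

Let sqrt_power (s : R) : 0 < s -> s `^ (- (1 / 2)) = (Num.sqrt s)^-1.
Proof. by move=> s0; rewrite powRN div1r powR12_sqrt// ltW. Qed.

Let phi_ip x v s : 0 < s ->
  complex.Re (inner ((s `^ (- (1 / 2)))%:C%C *: j (S s x)) v) = phi x (g v) s.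
Proof.
move=> s0; rewrite -/(ip _ v) ipZl sqrt_power// /phi h_sym hNg (ipC v) mulrC.
by [].
Qed.

Let beta_g x v : pi * ip (j (N (Z x))) v = \int[mu]_(s in `]0, +oo[) phi x (g v) s.
Proof.
by rewrite jN g_sym -ZP /beta mulrA mulfV ?mul1r// gt_eqF ?pi_gt0.
Qed.

Let pi_half : pi / sin (pi * (1 / 2)) = pi :> R.
Proof. by rewrite div1r sin_pihalf divr1. Qed.

Let norm_cont x s : 0 < s -> {for s, continuous (fun s => nr (j (S s x)) / Num.sqrt s)}.
Proof.
move=> s0; apply: cvgM; last first.
  by apply: cvgV; [rewrite gt_eqF// sqrtr_gt0|exact: sqrt_continuous].
apply: (halfline_continuous (c := Mj * (Mj * (Mj / d) ^+ 2 * nr x)) (k := id) s0) => [t t0|]; last first.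
  by [].
have h1 : `|nr (j (S s x)) - nr (j (S t x))| <= nr (j (S s x) - j (S t x)).
  have := ler_nrD (j (S s x) - j (S t x)) (j (S t x)).
  have := ler_nrD (j (S t x) - j (S s x)) (j (S s x)).
  by rewrite !subrK (nrB (j (S t x))) ler_norml; lra.
apply: (le_trans h1); rewrite -linearB; apply: (le_trans (j_le _)).
by rewrite -mulrA ler_wpM2l// S_lip.
Qed.

(** By [hNg], pairing with [v] in [H] is pairing with [N (g v)] in [al h]. So the weak integral
    against [v] is [pi * beta x (g v)], and [sin (pi / 2) = 1] leaves just the factor [pi]. *)
Let op_negpowerP_Z x y : op_negpower (1 / 2) A (x, y) <-> y = j (N (Z x)).
Proof.
have Dpos s : s \in `]0, +oo[%classic -> 0 < s by rewrite inE /= in_itv/= andbT.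
split=> [[T hT [_ _]]|->].
  move=> /= hint; apply: ip_ext => v.
  have pi1 : pi != 0 :> R by rewrite gt_eqF// pi_gt0.
  apply: (mulfI pi1); rewrite beta_g -ipZl.
  have h1 := hint v; rewrite pi_half in h1; apply: (etrans h1).
  apply: eq_Rintegral => s /Dpos s0.
  by have /(bounded_inverseP _ (ltW s0)) -> := hT s s0; rewrite phi_ip.
exists (fun s => j \o S s).
  by move=> s s0; apply/bounded_inverseP => //; exact: ltW.
split=> [v||v] /=.
- apply: (eq_measurable_fun (phi x (g v))).
    by move=> s /Dpos s0; rewrite phi_ip.
  by apply: measurable_halfline => s; exact: phi_continuous.
- have E_ s : 0 < s -> complex.Re `|(s `^ (- (1 / 2)))%:C%C *: j (S s x)| = nr (j (S s x)) / Num.sqrt s.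
    move=> s0; rewrite -/(nr _) nrZr sqrt_power// mulrC ger0_norm ?invr_ge0 ?sqrtr_ge0//.
  suff : mu.-integrable `]0, +oo[%classic (fun s => (nr (j (S s x)) / Num.sqrt s)%:E).
    by apply: eq_integrable => // s /Dpos s0; rewrite E_.
  (* The majorant [E] is quadratic in its vector while the norm to dominate is linear in [x]; hence
     a rescaling with [nr x' ^+ 2 = nr x]. *)
  pose x' := (Num.sqrt (nr x))^-1 *r x.
  have x'E : nr x' ^+ 2 = nr x.
    rewrite /x' nrZr ger0_norm ?invr_ge0 ?sqrtr_ge0// exprMn exprVn sqr_sqrtr ?nr_ge0//.
    have [->|x0] := eqVneq (nr x) 0; first by rewrite expr0n mulr0.
    by rewrite expr2 mulKf.
  apply: (le_int (@norm_cont x) _ (Z_int 2 (Z_int (2 * kap) (E_int x')))) => s s0.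
  have p0 : 0 < Num.sqrt s by rewrite sqrtr_gt0.
  rewrite ger0_norm ?divr_ge0 ?nr_ge0 ?sqrtr_ge0//.
  have h1 := E_ge x' s0; rewrite x'E in h1.
  have ip0' : 0 <= (Num.sqrt s)^-1 by rewrite invr_ge0 ltW.
  have := ler_wpM2r ip0' (jS_le x s0); lra.
- rewrite pi_half -/(ip _ v) ipZl beta_g; apply: eq_Rintegral => s /Dpos s0.
  by rewrite phi_ip.
Qed.

Lemma op_negpowerP x y : op_negpower (1 / 2) A (x, y) <-> y = j (N (Z x)).
Proof. exact: op_negpowerP_Z. Qed.
End negpower.

Lemma op_power_half : exists T : {linear H -> V},
  [/\ forall x y, op_power (1 / 2) A (x, y) <-> x = j (T y),
      forall v, exists x, T x = v &
      exists c1 c2 : R, [/\ 0 < c1, 0 < c2 &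
        forall x, c1 * nr x <= nr (T x) /\ nr (T x) <= c2 * nr x]].
Proof.
have [Z [ZP Z_ge Z_le Z_onto]] := half_power_exists.
exists (N \o Z); split=> [x y|v|].
- exact: (op_negpowerP ZP).
- by have [y yv] := N_onto v; have [x xy] := Z_onto y; exists x; rewrite /= xy.
have sd0 : 0 < Num.sqrt d by rewrite sqrtr_gt0.
have Mh1 : 0 < Num.sqrt (Mh + 1) by rewrite sqrtr_gt0 ltr_wpDl.
exists (pi^-1 / Num.sqrt (Mh + 1)), ((cb + 1) / Num.sqrt d); split.
- exact: divr_gt0.
- by rewrite divr_gt0// ltr_wpDl.
move=> x /=; have n0 := nr_ge0 (N (Z x)); split.
  rewrite mulrAC ler_pdivrMr//; apply: (le_trans (Z_ge x)).
  rewrite -ler_sqr ?nnegrE ?nr_ge0 ?mulr_ge0 ?(ltW Mh1)// exprMn sqr_sqrtr; last first.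
    by rewrite addr_ge0.
  have := h_le (N (Z x)) (N (Z x)); rewrite hNN ip_nr.
  by have := sqr_ge0 (nr (N (Z x))); lra.
rewrite mulrAC ler_pdivlMr//; apply: (@le_trans _ _ (nr (Z x))); last first.
  by have := Z_le x; have := nr_ge0 x; lra.
rewrite -ler_sqr ?nnegrE ?nr_ge0 ?mulr_ge0 ?(ltW sd0)// exprMn sqr_sqrtr ?(ltW d0)//.
by have := h_ge_d (N (Z x)); rewrite hNN ip_nr; lra.
Qed.

End half_power.

Lemma linear_inverse {R : realType} {V W : lmodType R[i]} (T : {linear V -> W}) :
  injective T -> (forall y, exists x, T x = y) ->
  exists L : {linear W -> V}, (forall x, L (T x) = x) /\ (forall y, T (L y) = y).
Proof.
move=> T_inj T_onto; have [f fT] := choice T_onto.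
have [L hL] : exists L : {linear W -> V}, L =1 f.
  by apply: complex_linear => [x y|c x|x]; apply: T_inj;
    rewrite ?linearD ?linZ !fT.
by exists L; split=> x; rewrite hL ?fT//; apply: T_inj; rewrite fT.
Qed.

(** * From an isomorphism of [H] onto [V] to the two domain statements *)

Section graph_norm.
Context {R : realType} {V H : hilbertType R} {j : {linear V -> H}}.
Variables (Mj c1 c2 : R) (T : {linear H -> V}) (P : set (H * H)).
Hypothesis Mj0 : 0 <= Mj.
Hypothesis j_le : forall u : V, nr (j u) <= Mj * nr u.
Hypothesis j_inj : injective j.
Hypothesis j_dense : dense (range j).
Hypothesis c10 : 0 < c1.
Hypothesis c20 : 0 < c2.
Hypothesis T_bounds : forall x, c1 * nr x <= nr (T x) /\ nr (T x) <= c2 * nr x.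
Hypothesis T_onto : forall v, exists x, T x = v.
Hypothesis PP : forall x y, P (x, y) <-> x = j (T y).

Let op_domainE : op_domain P = range j.
Proof.
apply/seteqP; split=> [x [y /PP->]|_ [v _ <-]]; first by exists (T y).
by have [y yv] := T_onto v; exists y; apply/PP; rewrite yv.
Qed.

Let graph_normE (x y : H) :
  sqrtC (`|x| ^+ 2 + `|y| ^+ 2) = (Num.sqrt (nr x ^+ 2 + nr y ^+ 2))%:C%C.
Proof.
have s0 : 0 <= nr x ^+ 2 + nr y ^+ 2 by rewrite addr_ge0 ?sqr_ge0.
have -> : `|x| ^+ 2 + `|y| ^+ 2 = ((Num.sqrt (nr x ^+ 2 + nr y ^+ 2))%:C%C) ^+ 2 :> R[i].
  by rewrite !nrE -!rmorphXn -rmorphD /= sqr_sqrtr.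
by rewrite sqrCK// lecR sqrtr_ge0.
Qed.

Lemma graph_norm_equiv : domain_equiv j P.
Proof.
split; first exact: op_domainE.
exists c2^-1, (Num.sqrt (Mj ^+ 2 + c1^-1 ^+ 2)); split.
- by rewrite invr_gt0.
- by rewrite sqrtr_gt0 ltr_wpDl ?sqr_ge0// exprn_gt0// invr_gt0.
move=> u y /PP/j_inj uE; rewrite graph_normE !nrE -!rmorphM !lecR.
have [h1 h2] := T_bounds y; rewrite -uE in h1 h2.
have s0 : 0 <= Mj ^+ 2 + c1^-1 ^+ 2 by rewrite addr_ge0 ?sqr_ge0.
apply/andP; split.
  rewrite ler_pdivrMl//; apply: (le_trans h2); rewrite ler_pM2l//.
  rewrite -[leLHS]ger0_norm ?nr_ge0// -sqrtr_sqr ler_wsqrtr//.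
  by rewrite lerDr sqr_ge0.
rewrite -[in leRHS](ger0_norm (nr_ge0 u)) -sqrtr_sqr -sqrtrM//.
rewrite ler_wsqrtr// mulrDl -!exprMn; apply: lerD.
  by apply: lerXn2r; rewrite ?nnegrE ?mulr_ge0 ?nr_ge0.
have c1i : 0 < c1^-1 by rewrite invr_gt0.
apply: lerXn2r; rewrite ?nnegrE ?nr_ge0 ?mulr_ge0 ?nr_ge0 ?(ltW c1i)//.
by rewrite ler_pdivlMl.
Qed.

(** On [V] there are two equivalent inner products: a multiple [h1] of the given one, and [h2], the
    graph inner product of [P] pulled back by [j]. By [form_sqrt], [N1] and [N2] map [H] unitarily
    onto [V] with each of them, so [N2 N1^-1] is an isometry between the two. *)
Lemma graph_norm_isometric : domain_isometric V P.
Proof.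
have T_inj : injective T.
  move=> x y xy; apply/eqP; rewrite -subr_eq0; apply/eqP/nr0_eq0/eqP.
  rewrite eq_le nr_ge0 andbT -(pmulr_rle0 _ c10).
  by have [h _] := T_bounds (x - y); rewrite linearB xy subrr nr0 in h.
have [L [LT TL]] := linear_inverse T_inj T_onto.
have L_le u : nr (L u) <= c1^-1 * nr u.
  by rewrite ler_pdivlMl//; have [h _] := T_bounds (L u); rewrite TL in h.
have L_ge u : c2^-1 * nr u <= nr (L u).
  by rewrite ler_pdivrMl//; have [_ h] := T_bounds (L u); rewrite TL in h.
(* [form_sqrt] requires the form to dominate [nr (j u) ^+ 2], hence this factor; [k] undoes it in
   [F]. *)
pose c := Mj ^+ 2 + 1; have c0 : 0 < c by rewrite ltr_wpDl ?sqr_ge0.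
pose h1 (u v : V) : R[i] := c%:C%C * inner u v.
pose h2 (u v : V) : R[i] := inner (j u) (j v) + inner (L u) (L v).
have al1 u v : al h1 u v = c * ip u v by rewrite /al /h1 -innerZl -/(ip _ v) ipZl.
have al2 u v : al h2 u v = ip (j u) (j v) + ip (L u) (L v) by rewrite /al /h2 raddfD.
have j_sqr u : nr (j u) ^+ 2 <= Mj ^+ 2 * nr u ^+ 2.
  by rewrite -exprMn; apply: lerXn2r; rewrite ?nnegrE ?mulr_ge0 ?nr_ge0.
have [||||||||||N1 [g1 [[_ N1N N1_onto] _ _ _ _]]] :=
  @form_sqrt _ V H j h1 Mj c c Mj0 j_le j_inj j_dense.
- by move=> u u' v; rewrite /h1 innerDl mulrDr.
- by move=> l u v; rewrite /h1 innerZl mulrCA.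
- by move=> u v v'; rewrite /h1 innerDr mulrDr.
- by move=> l u v; rewrite /h1 innerZr mulrCA.
- exact: ltW.
- by move=> u v; rewrite al1 -mulrA ler_pM2l// ip_le.
- exact: c0.
- by move=> u; rewrite al1 ip_nr.
- by move=> u v; rewrite !al1 ipC.
- by move=> u; rewrite al1 ip_nr mulrDl; have := j_sqr u; have := sqr_ge0 (nr u); lra.
have c2i : 0 < c2^-1 by rewrite invr_gt0.
have c1i : 0 < c1^-1 by rewrite invr_gt0.
have [||||||||||N2 [g2 [[_ N2N N2_onto] _ _ _ _]]] :=
  @form_sqrt _ V H j h2 Mj (Mj ^+ 2 + c1^-1 ^+ 2) (c2^-1 ^+ 2) Mj0 j_le j_inj j_dense.
- by move=> u u' v; rewrite /h2 !linearD !innerDl addrACA.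
- by move=> l u v; rewrite /h2 !linZ !innerZl mulrDr.
- by move=> u v v'; rewrite /h2 !linearD !innerDr addrACA.
- by move=> l u v; rewrite /h2 !linZ !innerZr mulrDr.
- by rewrite addr_ge0 ?sqr_ge0.
- move=> u v; rewrite al2 !mulrDl; apply: lerD; apply: (le_trans (ip_le _ _)).
    have -> : Mj ^+ 2 * nr u * nr v = Mj * nr u * (Mj * nr v) by ring.
    by apply: ler_pM; rewrite ?nr_ge0.
  have -> : c1^-1 ^+ 2 * nr u * nr v = c1^-1 * nr u * (c1^-1 * nr v) by ring.
  by apply: ler_pM; rewrite ?nr_ge0.
- exact: exprn_gt0.
- move=> u; rewrite al2 !ip_nr -exprMn ler_wpDl ?sqr_ge0//.
  by apply: lerXn2r; rewrite ?nnegrE ?nr_ge0 ?mulr_ge0 ?nr_ge0 ?(ltW c2i).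
- by move=> u v; rewrite !al2 ipC [X in _ + X]ipC.
- by move=> u; rewrite al2 !ip_nr lerDl sqr_ge0.
have N1_inj : injective N1.
  move=> x y xy; apply/eqP; rewrite -subr_eq0; apply/eqP/nr0_eq0/eqP.
  by rewrite -sqrf_eq0 -ip_nr -N1N linearB xy subrr al1 ip0l mulr0.
have [G [GN NG]] := linear_inverse N1_inj N1_onto.
pose k : R := (Num.sqrt c)^-1.
have sc0 : 0 < Num.sqrt c by rewrite sqrtr_gt0.
have [F FE] : exists F : {linear V -> H}, forall u, F u = j (N2 (G (k *r u))).
  by exists (j \o N2 \o G \o ( *:%R (k%:C)%C)).
exists F; split.
  rewrite op_domainE; apply/seteqP; split=> [_ [v _ <-]|_ [u _ <-]]; last first.
    by exists (N2 (G (k *r u))); rewrite // -FE.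
  have [x xv] := N2_onto v; exists (Num.sqrt c *r N1 x) => //.
  by rewrite FE rsA mulVf ?gt_eqF// rs1 GN xv.
move=> u y /PP; rewrite FE => /j_inj E; rewrite graph_normE nrE; congr (_%:C)%C.
have -> : y = L (N2 (G (k *r u))) by rewrite E LT.
rewrite -!ip_nr -al2 N2N -[RHS]ger0_norm ?nr_ge0// -sqrtr_sqr; congr Num.sqrt.
have := N1N (G (k *r u)) (G (k *r u)); rewrite NG => <-.
rewrite al1 ip_nr nrZr ger0_norm ?invr_ge0 ?sqrtr_ge0// exprMn /k exprVn.
by rewrite sqr_sqrtr ?(ltW c0)// mulVKf ?gt_eqF.
Qed.

End graph_norm.

Section form_theorem.
Context {R : realType} {V H : hilbertType R} {j : {linear V -> H}}.
Variables (a : V -> V -> R[i]) (Mj M d w Mb : R).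
Hypothesis Mj0 : 0 <= Mj.
Hypothesis j_le : forall u : V, nr (j u) <= Mj * nr u.
Hypothesis j_inj : injective j.
Hypothesis j_dense : dense (range j).
Hypothesis aDl : forall u u' v : V, a (u + u') v = a u v + a u' v.
Hypothesis aZl : forall (c : R[i]) (u v : V), a (c *: u) v = c * a u v.
Hypothesis aDr : forall u v v' : V, a u (v + v') = a u v + a u v'.
Hypothesis aZr : forall (c : R[i]) (u v : V), a u (c *: v) = c^*%R * a u v.
Hypothesis M0 : 0 <= M.
Hypothesis al_le : forall u v : V, al a u v <= M * nr u * nr v.
Hypothesis d0 : 0 < d.
Hypothesis w0 : 0 <= w.
Hypothesis al_ge : forall u : V, d * nr u ^+ 2 <= al a u u + w * nr (j u) ^+ 2.
Hypothesis Mb0 : 0 <= Mb.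
Hypothesis Im_le : forall u : V, complex.Im (a u u) ^+ 2 <= (Mb * nr (j u) * nr u) ^+ 2.

Theorem form_square_root : exists2 la0 : R, 0 < la0 & forall la : R, la0 <= la ->
  let P := op_power (1 / 2) (op_shift la (form_op j a)) in
  [/\ positive_op (op_shift la (form_op j a)), domain_equiv j P & domain_isometric V P].
Proof.
have [Rs RsP] := resolvents_exist Mj0 j_le aDl aZl aDr aZr M0 al_le d0 w0 al_ge.
pose C : R := 8 * (Mb * (1 + d^-1)).
have C0 : 0 <= C by rewrite !mulr_ge0// addr_ge0// invr_ge0 ltW.
(* [2 * w + 2] secures the ellipticity of the shifted form, and [C ^+ 2] the smallness of its skew
   part. *)
exists (2 * w + 2 + C ^+ 2).
  by rewrite ltr_wpDr ?sqr_ge0// ltr_wpDl// mulr_ge0.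
move=> la la0 P; have w0' := w0.
have C2 := sqr_ge0 C.
have la_w : 2 * w + 2 <= la by lra.
have la_C : C <= Num.sqrt la.
  by rewrite -(ger0_norm C0) -sqrtr_sqr ler_wsqrtr//; lra.
have [N [g [[jN hNN N_onto] hNg g_sym g_ge0 g_le]]] :=
  sympart_form_sqrt Mj0 j_le j_inj j_dense aDl aZl aDr aZr M0 al_le d0 w0 al_ge la_w.
have [K KE] := positive_inverses g_ge0 ler01 g_le.
have [W WE] : exists W : R -> {linear H -> H}, forall p : R, 0 <= p ->
    forall x, W p x + (p ^+ 2) *r g (g (W p x)) = x.
  have gg_ge0 x : 0 <= ip ((g \o g) x) x by rewrite /= g_sym ip_nr sqr_ge0.
  have gg_le x : nr ((g \o g) x) <= 1 * nr x.
    by apply: (le_trans (g_le _)); rewrite mul1r.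
  have [W WE] := positive_inverses gg_ge0 ler01 gg_le.
  by exists (fun p => W (p ^+ 2)) => p _ x; exact: (WE _ (sqr_ge0 p)).
have [T [TP T_onto [c1 [c2 [c10 c20 T_bounds]]]]] :=
  op_power_half Mj0 j_le j_dense aDl aZl aDr aZr M0 al_le d0 w0 al_ge Mb0 Im_le
    la_w la_C RsP jN hNN N_onto hNg g_sym g_ge0 g_le KE WE.
split; first exact: (shifted_form_positive_op aDl aZl aZr d0 w0 al_ge la_w RsP).
  exact: (graph_norm_equiv Mj0 j_le j_inj c10 c20 T_bounds T_onto TP).
exact: (graph_norm_isometric Mj0 j_le j_inj j_dense c10 c20 T_bounds T_onto TP).
Qed.

End form_theorem.

Lemma nr_dense {R : realType} {V : hilbertType R} (D : set V) :
  (forall x (e : R), 0 < e -> exists2 y, D y & nr (x - y) < e) -> dense D.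
Proof.
move=> hD O [x Ox] oO; have /nbhs_ballP[[e i]/= ] : nbhs x O by exact: open_nbhs_nbhs.
rewrite ltcE/= => /andP[/eqP i0 e0] he; have [y Dy xy] := hD x e e0.
exists y; split => //; apply: he; rewrite -ball_normE /ball_/= nrE i0 ltcR.
exact: xy.
Qed.

Section sesquilinear.
Context {R : realType} {V : hilbertType R} (a : sesquilinear_form V).

Lemma sesquiZl (c : R[i]) u v : a (c *: u) v = c * a u v.
Proof. exact: linearZl_LR. Qed.

Lemma sesquiZr (c : R[i]) u v : a u (c *: v) = c^*%R * a u v.
Proof. exact: linearZr_LR. Qed.

Lemma continuous_form_le : continuous_form a ->
  exists2 M : R, 0 <= M & forall u v, al a u v <= M * nr u * nr v.
Proof.
move=> /(_ (0, 0))/cvgrPdist_lt/(_ 1 ltr01) /=; rewrite linear0l => -[[A B]/=[]].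
move=> /nbhs_ballP[[r i]/=]; rewrite ltcE/= => /andP[/eqP -> r0] hA.
move=> /nbhs_ballP[[t k]/=]; rewrite ltcE/= => /andP[/eqP -> t0] hB AB.
have rt : 0 < r * t by exact: mulr_gt0.
have small (q : R) (x : V) : 0 < q -> nr x != 0 -> nr ((q / 2 / nr x) *r x) < q.
  move=> q0 x0; rewrite nrZr ger0_norm ?divr_ge0 ?nr_ge0 ?(ltW q0)//.
  by rewrite divfK// ltr_pdivrMr// ltr_pMr// ltr1n.
exists (4 / (r * t)); first by rewrite divr_ge0// ltW.
move=> u v; have [u0|u0] := eqVneq (nr u) 0.
  by rewrite u0 mulr0 mul0r (nr0_eq0 u0) /al linear0l.
have [v0|v0] := eqVneq (nr v) 0.
  by rewrite v0 mulr0 (nr0_eq0 v0) /al linear0r.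
pose u' := (r / 2 / nr u) *r u; pose v' := (t / 2 / nr v) *r v.
have h1 : `|0 - a u' v'| < 1.
  apply: (AB (u', v')); split=> /=; [apply: hA|apply: hB]; rewrite -ball_normE /ball_/= sub0r normrN nrE ltcR;
  exact: small.
have h : al a u' v' <= complex.Re `|0 - a u' v'|.
  rewrite sub0r normrN -lecR; apply: le_trans (_ : `|al a u' v'|%:C%C <= _).
    by rewrite lecR ler_norm.
  by rewrite /al normc_def /=; case: (a u' v') => x y /=; rewrite lecR -sqrtr_sqr ler_wsqrtr// lerDl sqr_ge0.
have h2 : complex.Re `|0 - a u' v'| < 1.
  by move: h1; rewrite normc_def /= ltcR.
have := lt_le_trans (le_lt_trans h h2) (lexx 1); rewrite /u' /v' (alZl sesquiZl) (alZr sesquiZr).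
have uv : 0 < nr u * nr v by rewrite mulr_gt0// lt_neqAle eq_sym ?u0 ?v0 nr_ge0.
have -> : 4 / (r * t) * nr u * nr v = (r / 2 / nr u * (t / 2 / nr v))^-1.
  by field; rewrite u0 v0 !gt_eqF.
have q0 : 0 < r / 2 / nr u * (t / 2 / nr v).
  have -> : r / 2 / nr u * (t / 2 / nr v) = (r * t / 4) / (nr u * nr v).
    by field; rewrite u0 v0.
  by rewrite !divr_gt0.
by rewrite mulrA => /ltW; rewrite -ler_pdivlMl// mulr1.
Qed.

End sesquilinear.

(** * The matrix form *)

Section matrix.
Context {R : realType} {V H : hilbertType R}.

Lemma matrix_imbedding_linear (j : {linear V -> H}) : linear (matrix_imbedding j).
Proof. by move=> c u v; rewrite /matrix_imbedding /= linearP. Qed.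

HB.instance Definition _ (j : {linear V -> H}) :=
  GRing.isLinear.Build R[i] (hprod V V) (hprod V H) _ (matrix_imbedding j)
    (matrix_imbedding_linear j).

Lemma hprod_nr (U W : hilbertType R) (x : hprod U W) : nr x ^+ 2 = nr x.1 ^+ 2 + nr x.2 ^+ 2.
Proof. by rewrite -!ip_nr /ip -raddfD. Qed.

Lemma hprod_fst_le (U W : hilbertType R) (x : hprod U W) : nr x.1 <= nr x.
Proof. by rewrite -ler_sqr ?nnegrE ?nr_ge0// hprod_nr lerDl sqr_ge0. Qed.

Lemma hprod_snd_le (U W : hilbertType R) (x : hprod U W) : nr x.2 <= nr x.
Proof. by rewrite -ler_sqr ?nnegrE ?nr_ge0// hprod_nr lerDr sqr_ge0. Qed.

Variables (j : {linear V -> H}) (a b : sesquilinear_form V).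

Lemma al_matrix u v : al (matrix_form a b) u v =
  - ip u.2 v.1 + al a u.1 v.2 + al b u.2 v.2.
Proof. by rewrite /al /matrix_form !raddfD raddfN. Qed.

Lemma matrixDl u u' v :
  matrix_form a b (u + u') v = matrix_form a b u v + matrix_form a b u' v.
Proof. by rewrite /matrix_form /= !innerDl !linearDl; ring. Qed.

Lemma matrixDr u v v' :
  matrix_form a b u (v + v') = matrix_form a b u v + matrix_form a b u v'.
Proof. by rewrite /matrix_form /= !innerDr !linearDr; ring. Qed.

Lemma matrixZl (c : R[i]) u v : matrix_form a b (c *: u) v = c * matrix_form a b u v.
Proof. by rewrite /matrix_form /= !innerZl !sesquiZl; ring. Qed.

Lemma matrixZr (c : R[i]) u v : matrix_form a b u (c *: v) = c^*%R * matrix_form a b u v.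
Proof. by rewrite /matrix_form /= !innerZr !sesquiZr; ring. Qed.

Variables (Ma Mb Mj : R).
Hypothesis Ma0 : 0 <= Ma.
Hypothesis a_le : forall u v, al a u v <= Ma * nr u * nr v.

Lemma matrix_form_le : 0 <= Mb -> (forall u v, al b u v <= Mb * nr u * nr v) ->
  forall u v, al (matrix_form a b) u v <= (1 + Ma + Mb) * nr u * nr v.
Proof.
move=> Mb0 b_le u v; rewrite al_matrix.
have h1 := ip_le (- u.2) v.1; rewrite ipNl nrN in h1.
have h2 := a_le u.1 v.2; have h3 := b_le u.2 v.2.
have pr (x y : R) : 0 <= x -> x <= nr u -> 0 <= y -> y <= nr v -> x * y <= nr u * nr v.
  by move=> *; apply: ler_pM.
have p1 := pr _ _ (nr_ge0 u.2) (hprod_snd_le u) (nr_ge0 v.1) (hprod_fst_le v).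
have p2 := pr _ _ (nr_ge0 u.1) (hprod_fst_le u) (nr_ge0 v.2) (hprod_snd_le v).
have p3 := pr _ _ (nr_ge0 u.2) (hprod_snd_le u) (nr_ge0 v.2) (hprod_snd_le v).
have := ler_wpM2l Ma0 p2; have := ler_wpM2l Mb0 p3; lra.
Qed.

(** By Young's inequality, [C] pays for the coupling of [u.1] with [u.2], at the cost of half of
    [d]. The summand [d / 2] of the shift then restores [nr u.1 ^+ 2], which the norm of [V * H]
    contains in full. *)
Lemma matrix_form_elliptic (d w : R) : 0 < d -> 0 <= w ->
  (forall u, d * nr u ^+ 2 <= al b u u + w * nr (j u) ^+ 2) ->
  exists2 w' : R, 0 <= w' & forall u, d / 2 * nr u ^+ 2 <=
    al (matrix_form a b) u u + w' * nr (matrix_imbedding j u : hprod V H) ^+ 2.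
Proof.
move=> d0 w0 b_ge; pose C := (1 + Ma) ^+ 2 / (2 * d).
have C0 : 0 <= C by rewrite divr_ge0 ?sqr_ge0// mulr_ge0// ltW.
exists (C + d / 2 + w); first by rewrite !addr_ge0// divr_ge0// ltW.
move=> u; rewrite al_matrix !hprod_nr /=.
have h1 := ip_le u.2 u.1.
have h2 := a_le (- u.1) u.2; rewrite /al linearNl raddfN nrN -/(al a _ _) in h2.
have h3 := b_ge u.2.
have h4 : (1 + Ma) * (nr u.1 * nr u.2) <= d / 2 * nr u.2 ^+ 2 + C * nr u.1 ^+ 2.
  have -> : d / 2 * nr u.2 ^+ 2 + C * nr u.1 ^+ 2 = (1 + Ma) * (nr u.1 * nr u.2) +
    (d * nr u.2 - (1 + Ma) * nr u.1) ^+ 2 / (2 * d).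
    by rewrite /C; field; rewrite gt_eqF.
  by rewrite lerDl divr_ge0 ?sqr_ge0// mulr_ge0// ltW.
have := mulr_ge0 w0 (sqr_ge0 (nr u.1)).
have p0 : 0 <= C + d / 2 by rewrite addr_ge0// divr_ge0// ltW.
have := mulr_ge0 p0 (sqr_ge0 (nr (j u.2))); lra.
Qed.

(** The coupling terms are bounded by multiples of [nr u.1 * nr u.2], and [nr u.1] is part of the
    norm of [V * H]. This is what the [V]-norm on the first component of the base space achieves. *)
Lemma matrix_form_parabola : 0 <= Mb -> 
  (forall u, `|complex.Im (b u u)| <= Mb * nr (j u) * nr u) ->
  forall u, complex.Im (matrix_form a b u u) ^+ 2 <=
    ((1 + Ma + Mb) * nr (matrix_imbedding j u : hprod V H) * nr u) ^+ 2.
Proof.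
move=> Mb0 b_im u; pose X := nr (matrix_imbedding j u : hprod V H).
have X0 : 0 <= X by exact: nr_ge0.
have u1 : nr u.1 <= X by exact: (hprod_fst_le (matrix_imbedding j u)).
have u2 : nr (j u.2) <= X by exact: (hprod_snd_le (matrix_imbedding j u)).
have u3 := hprod_snd_le u.
have p1 : nr u.1 * nr u.2 <= X * nr u by apply: ler_pM; rewrite ?nr_ge0.
have p2 : nr (j u.2) * nr u.2 <= X * nr u by apply: ler_pM; rewrite ?nr_ge0.
have -> : complex.Im (matrix_form a b u u) =
    - ip u.2 ('i%C *: u.1) + al a u.1 ('i%C *: u.2) + complex.Im (b u.2 u.2).
  by rewrite /matrix_form !raddfD raddfN /= Im_inner (al_Im (sesquiZr a)).
have h1 := ip_abs u.2 ('i%C *: u.1); rewrite nrZi in h1.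
have h2 := a_le u.1 ('i%C *: u.2); rewrite nrZi in h2.
have h3 := a_le (- u.1) ('i%C *: u.2).
rewrite /al linearNl raddfN nrN nrZi -/(al a _ _) in h3.
have h4 := b_im u.2; move: h1 h4; rewrite !ler_norml => /andP[a1 a2] /andP[b1 b2].
have q1 := ler_wpM2l Ma0 p1; have q2 := ler_wpM2l Mb0 p2.
rewrite -(real_normK (num_real (_ + _))); apply: lerXn2r; rewrite ?nnegrE//.
  by rewrite !mulr_ge0 ?nr_ge0// !addr_ge0.
by rewrite -/X ler_norml; lra.
Qed.

Lemma matrix_imbedding_inj : injective j -> injective (matrix_imbedding j).
Proof. by move=> j_inj [u1 u2] [v1 v2] [-> /j_inj->]. Qed.

Lemma matrix_imbedding_le : 0 <= Mj -> (forall u, nr (j u) <= Mj * nr u) ->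
  forall u, nr (matrix_imbedding j u : hprod V H) <= (1 + Mj) * nr u.
Proof.
move=> Mj0 j_le u; have M1 : 0 <= 1 + Mj by rewrite addr_ge0.
rewrite -ler_sqr ?nnegrE ?mulr_ge0 ?nr_ge0// exprMn !hprod_nr /=.
have h : nr (j u.2) ^+ 2 <= Mj ^+ 2 * nr u.2 ^+ 2.
  by rewrite -exprMn; apply: lerXn2r; rewrite ?nnegrE ?mulr_ge0 ?nr_ge0.
have := mulr_ge0 Mj0 (sqr_ge0 (nr u.1)); have := mulr_ge0 Mj0 (sqr_ge0 (nr u.2)).
have := mulr_ge0 (sqr_ge0 Mj) (sqr_ge0 (nr u.1)); have := sqr_ge0 (nr u.2); lra.
Qed.

Lemma matrix_imbedding_dense : dense (range j) ->
  dense (range (matrix_imbedding j : hprod V V -> hprod V H)).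
Proof.
move=> j_dense; apply: nr_dense => x e e0.
have [_ [v _ <-] xv] := dense_nr j_dense x.2 e0.
exists (matrix_imbedding j (x.1, v)); first by exists (x.1, v).
apply: le_lt_trans xv; rewrite -ler_sqr ?nnegrE ?nr_ge0// hprod_nr /=.
by rewrite subrr nr0 expr0n/= add0r.
Qed.

End matrix.
Theorem theorem3p1 (R : realType) (V H : hilbertType R)
    (sepV : separable V) (sepH : separable H)
    (j : {linear V -> H}) (j_inj : injective j) (j_cont : continuous j)
    (j_dense : dense (range j))
    (a b : sesquilinear_form V)
    (a_cont : continuous_form a) (b_cont : continuous_form b)
    (b_ell : elliptic j b)
    (Mb : R) (Mb_gt0 : 0 < Mb)
    (Im_b : forall u : V, `|'Im (b u u)| <= Mb%:C%C * `|j u| * `|u|) :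
  let A := form_op (matrix_imbedding j) (matrix_form a b) in
  generates_cosine (op_opp A) /\
  exists2 la0 : R, 0 < la0 & forall la : R, la0 <= la ->
    let P := op_power (1 / 2) (op_shift la A) in
    [/\ positive_op (op_shift la A),
        domain_equiv (matrix_imbedding j) P
      & domain_isometric (hprod V V) P].
Proof.
move=> A.
have [Mj Mj0 j_le] := continuous_lipschitz j_cont.
have [Ma Ma0 a_le] := continuous_form_le a_cont.
have [Mb' Mb'0 b_le] := continuous_form_le b_cont.
have [d [om [d0 b_ell']]] := b_ell.
(* The constant [om] may be negative, whereas the form theory assumes a nonnegative shift. *)
have b_ge u : d * nr u ^+ 2 <= al b u u + `|om| * nr (j u) ^+ 2.
  have := b_ell' u; rewrite -complexRe !nrE -!rmorphXn -!rmorphM -rmorphD /= lecR.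
  by move=> h; apply: (le_trans h); rewrite lerD2l ler_wpM2r ?sqr_ge0// ler_norm.
have b_im u : `|complex.Im (b u u)| <= Mb * nr (j u) * nr u.
  have := Im_b u; rewrite -complexIm !nrE -!rmorphM /=.
  by rewrite normc_def /= expr0n/= addr0 sqrtr_sqr lecR.
have [w' w'0 m_ge] := matrix_form_elliptic a_le d0 (normr_ge0 om) b_ge.
have m_le := matrix_form_le Ma0 a_le Mb'0 b_le.
have m_im := matrix_form_parabola Ma0 a_le (ltW Mb_gt0) b_im.
have mj_le := matrix_imbedding_le (ltW Mj0) j_le.
have mj_dense := matrix_imbedding_dense j_dense.
have d20 : 0 < d / 2 by rewrite divr_gt0.
have M10 : 0 <= 1 + Mj by rewrite addr_ge0// ltW.
have M20 : 0 <= 1 + Ma + Mb' by rewrite !addr_ge0.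
have M30 : 0 <= 1 + Ma + Mb by rewrite !addr_ge0// ltW.
split.
  exact: (@form_generates_cosine _ _ _ (matrix_imbedding j) _ _ _ _ _ _ M10 mj_le mj_dense
    (matrixDl a b) (matrixZl a b) (matrixDr a b) (matrixZr a b) M20 m_le d20 w'0 m_ge M30 m_im).
exact: (@form_square_root _ _ _ (matrix_imbedding j) _ _ _ _ _ _ M10 mj_le
    (matrix_imbedding_inj j_inj) mj_dense
    (matrixDl a b) (matrixZl a b) (matrixDr a b) (matrixZr a b) M20 m_le d20 w'0 m_ge M30 m_im).
Qed.
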